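(* Let $a=(a_1,\dots,a_n)$ be a tuple of distinct complex numbers. Then the automorphism group $\operatorname{Aut}(\mathscr{V}_a)$ is isomorphic to one of the following groups: a cyclic group $C_N$, a dihedral group $D_N$, the alternating group $A_4$, the symmetric group $S_4$, or the alternating group $A_5$. Moreover, each of these groups occurs as such an automorphism group for some $a$.
   Context: Here $n\in\mathbb{N}=\{1,2,\dots\}$. For a tuple $a=(a_1,\dots,a_n)$ of distinct complex numbers, $R_a$ is the subalgebra of $\mathbb{C}(t)$ generated by $t,(t-a_1)^{-1},\dots,(t-a_n)^{-1}$, and $\mathscr{V}_a=\operatorname{Der}(R_a)=R_a\partial$ with $\partial=d/dt$, a complex Lie algebra with bracket $[f\partial,g\partial]=(f\partial(g)-g\partial(f))\partial$. $\operatorname{Aut}(\mathscr{V}_a)$ is its group of Lie algebra automorphisms, which is isomorphic to the group of algebra automorphisms of $R_a$. $C_N=\langle s\mid s^N=1\rangle$ and $D_N=\langle s,t\mid s^N=1=t^2,\ tst=s^{-1}\rangle$ for a positive integer $N$.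
   Formalization: The tuple is assumed to have n ≥ 2 entries; for n = 1 the claim fails, since t − a_1 ↦ c(t − a_1) with c ≠ 0 induces infinitely many automorphisms of V_a, while all the listed groups are finite. *)

(* Defs.v *)
From HB Require Import structures.
From mathcomp Require Import all_boot all_order all_algebra all_fingroup all_solvable.
From mathcomp Require Import boolp classical_sets functions reals.

Set Implicit Arguments.
Unset Strict Implicit.
Unset Printing Implicit Defensive.

Import GRing.Theory.
Local Open Scope ring_scope.

HB.mixin Record Lmodule_isLieAlgebra (K : fieldType) L of GRing.Lmodule K L := {
  lie : L -> L -> L;
  lie_linearl : forall z, linear (lie^~ z);
  lie_linearr : forall z, linear (lie z);
  liexx : forall x, lie x x = 0;
  lie_jacobi : forall x y z,
    lie x (lie y z) + lie y (lie z x) + lie z (lie x y) = 0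
}.

#[short(type="lieAlgType")]
HB.structure Definition LieAlgebra (K : fieldType) :=
  { L of Lmodule_isLieAlgebra K L & GRing.Lmodule K L }.

Section LieAut.
Variables (K : fieldType) (L : lieAlgType K).

Definition is_lie_aut (f : L -> L) : Prop :=
  [/\ linear f, forall x y, f (lie x y) = lie (f x) (f y) & bijective f].

Definition lie_aut_pred : {pred L -> L} := fun f => `[< is_lie_aut f >].

Record LieAut := MkLieAut {
  lie_aut_fun :> L -> L;
  _ : lie_aut_fun \in lie_aut_pred
}.
HB.instance Definition _ := [isSub for lie_aut_fun].
HB.instance Definition _ := [Choice of LieAut by <:].

Lemma lie_autP (f : LieAut) : is_lie_aut f.
Proof. exact/asboolP/(valP f). Qed.

Lemma lie_aut_id_subproof : idfun \in lie_aut_pred.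
Proof. by apply/asboolP; split=> //; exists idfun. Qed.
Definition lie_aut_id := MkLieAut lie_aut_id_subproof.

Lemma lie_aut_comp_subproof (f g : LieAut) :
  (fun x => f (g x)) \in lie_aut_pred.
Proof.
have [fl fb fbij] := lie_autP f; have [gl gb gbij] := lie_autP g.
apply/asboolP; split=> [k x y|x y|]; first by rewrite gl fl.
  by rewrite gb fb.
exact: bij_comp.
Qed.
Definition lie_aut_comp f g := MkLieAut (lie_aut_comp_subproof f g).

Lemma lie_aut_has_inv (f : LieAut) :
  exists g : LieAut, cancel f g /\ cancel g f.
Proof.
have [fl fb [g fK gK]] := lie_autP f.
have gP : g \in lie_aut_pred.
  apply/asboolP; split=> [k x y|x y|]; last by exists (f : L -> L).
    by apply: (can_inj fK); rewrite fl !gK.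
  by apply: (can_inj fK); rewrite fb !gK.
by exists (MkLieAut gP).
Qed.
Definition lie_aut_inv f := projT1 (cid (lie_aut_has_inv f)).

Lemma lie_aut_compA : associative lie_aut_comp.
Proof. by move=> f g h; apply: val_inj. Qed.
Lemma lie_aut_id_l : left_id lie_aut_id lie_aut_comp.
Proof. by move=> f; apply: val_inj. Qed.
Lemma lie_aut_id_r : right_id lie_aut_id lie_aut_comp.
Proof. by move=> f; apply: val_inj. Qed.
Lemma lie_aut_inv_l : left_inverse lie_aut_id lie_aut_inv lie_aut_comp.
Proof.
move=> f; apply: val_inj; apply: funext => x /=.
by rewrite /lie_aut_inv; case: cid => g [fK gK] /=; rewrite fK.
Qed.
Lemma lie_aut_inv_r : right_inverse lie_aut_id lie_aut_inv lie_aut_comp.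
Proof.
move=> f; apply: val_inj; apply: funext => x /=.
by rewrite /lie_aut_inv; case: cid => g [fK gK] /=; rewrite gK.
Qed.

HB.instance Definition _ := isGroup.Build LieAut
  lie_aut_compA lie_aut_id_l lie_aut_id_r lie_aut_inv_l lie_aut_inv_r.

End LieAut.

Arguments LieAut {K} L.

(* The Lie algebra of K-linear derivations of a K-algebra, under the
   commutator bracket [D, E] = D E - E D. For A = R_a, every D is f d/dt with
   f = D t, and this bracket is [f d/dt, g d/dt] = (f g' - g f') d/dt. *)

Section Derivations.
Variables (K : fieldType) (A : algType K).

Definition is_derivation (D : A -> A) : Prop :=
  linear D /\ forall x y, D (x * y) = D x * y + x * D y.

Definition derivation_pred : {pred A -> A} := fun D => `[< is_derivation D >].

Lemma derivation_submod : submod_closed derivation_pred.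
Proof.
split=> [|k D E /asboolP[Dl DM] /asboolP[El EM]]; apply/asboolP; split.
- by move=> k x y; change (0 = k *: 0 + 0 :> A); rewrite scaler0 addr0.
- by move=> x y; change (0 = 0 * y + x * 0 :> A); rewrite mul0r mulr0 addr0.
- move=> c x y; change (k *: D (c *: x + y) + E (c *: x + y) =
    c *: (k *: D x + E x) + (k *: D y + E y)).
  by rewrite Dl El !scalerDr !scalerA (mulrC k c) addrACA.
- move=> x y; change (k *: D (x * y) + E (x * y) =
    (k *: D x + E x) * y + x * (k *: D y + E y)).
  by rewrite DM EM scalerDr mulrDl mulrDr scalerAl scalerAr addrACA.
Qed.

HB.instance Definition _ :=
  GRing.isSubmodClosed.Build K (A -> A) derivation_pred derivation_submod.

Record Der := MkDer { der_fun :> A -> A; _ : der_fun \in derivation_pred }.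
HB.instance Definition _ := [isSub for der_fun].
HB.instance Definition _ := [Choice of Der by <:].
HB.instance Definition _ := [SubChoice_isSubLmodule of Der by <:].

Lemma derP (D : Der) : is_derivation D.
Proof. exact/asboolP/(valP D). Qed.

Lemma lie_der_subproof (D E : Der) :
  (fun x => D (E x) - E (D x)) \in derivation_pred.
Proof.
have [Dl DM] := derP D; have [El EM] := derP E; apply/asboolP; split.
  move=> k x y /=; rewrite El Dl El Dl.
  by rewrite scalerBr opprD addrACA.
move=> x y /=; rewrite EM DM.
have DD u v : D (u + v) = D u + D v by rewrite -[u]scale1r Dl !scale1r.
have ED u v : E (u + v) = E u + E v by rewrite -[u]scale1r El !scale1r.
rewrite DD ED !DM !EM mulrBl mulrBr [X in X - _](AC (2*2) ((1*4)*(2*3))).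
rewrite [X in _ - X](AC (2*2) ((1*4)*(3*2))) /=.
by rewrite opprD [LHS]addrACA subrr addr0 opprD addrACA.
Qed.
Definition lie_der D E := MkDer (lie_der_subproof D E).

Lemma lie_der_linearl E : linear (lie_der^~ E).
Proof.
move=> k D1 D2; apply: val_inj; apply: funext => x.
have [El _] := derP E.
change (k *: D1 (E x) + D2 (E x) - E (k *: D1 x + D2 x) =
  k *: (D1 (E x) - E (D1 x)) + (D2 (E x) - E (D2 x))).
by rewrite El scalerBr opprD addrACA.
Qed.

Lemma lie_der_linearr E : linear (lie_der E).
Proof.
move=> k D1 D2; apply: val_inj; apply: funext => x.
have [El _] := derP E.
change (E (k *: D1 x + D2 x) - (k *: D1 (E x) + D2 (E x)) =
  k *: (E (D1 x) - D1 (E x)) + (E (D2 x) - D2 (E x))).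
by rewrite El scalerBr opprD addrACA.
Qed.

Lemma lie_derxx D : lie_der D D = 0.
Proof. by apply: val_inj; apply: funext => x; exact: subrr. Qed.

Lemma lie_der_jacobi D E F :
  lie_der D (lie_der E F) + lie_der E (lie_der F D)
  + lie_der F (lie_der D E) = 0.
Proof.
apply: val_inj; apply: funext => x.
have BB (G : Der) u v : G (u - v) = G u - G v.
  by have [Gl _] := derP G; rewrite addrC -scaleN1r Gl scaleN1r addrC.
change (D (E (F x) - F (E x)) - (E (F (D x)) - F (E (D x)))
  + (E (F (D x) - D (F x)) - (F (D (E x)) - D (F (E x))))
  + (F (D (E x) - E (D x)) - (D (E (F x)) - E (D (F x)))) = 0).
rewrite !BB !opprB.
rewrite (AC ((2*2)*(2*2)*(2*2))
  ((1*12)*(7*2)*(3*10)*(5*4)*(11*6)*(9*8))) /=.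
by rewrite !subrr !addr0.
Qed.

HB.instance Definition _ := Lmodule_isLieAlgebra.Build K Der
  lie_der_linearl lie_der_linearr lie_derxx lie_der_jacobi.

End Derivations.

Arguments Der {K} A.


Section GeneratedSubalgebra.
Variables (K : fieldType) (A : comAlgType K) (S : set A).

Definition gen_subalg_pred : {pred A} := fun x =>
  `[< forall B : {pred A},
        subalg_closed B -> (forall y, S y -> y \in B) -> x \in B >].

Lemma gen_subalg_closed : subalg_closed gen_subalg_pred.
Proof.
split=> [|k x y /asboolP xS /asboolP yS|x y /asboolP xS /asboolP yS];
  apply/asboolP => B Bcl SB; have [B1 BZ BM] := Bcl => //.
  by apply: BZ; [exact: xS | exact: yS].
by apply: BM; [exact: xS | exact: yS].
Qed.

HB.instance Definition _ :=
  GRing.isSubalgClosed.Build K A gen_subalg_pred gen_subalg_closed.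

Record gen_subalg := MkGenSubalg {
  gen_subalg_val :> A;
  _ : gen_subalg_val \in gen_subalg_pred
}.
HB.instance Definition _ := [isSub for gen_subalg_val].
HB.instance Definition _ := [Choice of gen_subalg by <:].
HB.instance Definition _ := [SubChoice_isSubComNzRing of gen_subalg by <:].
HB.instance Definition _ := [SubZmodule_isSubLmodule of gen_subalg by <:].
HB.instance Definition _ :=
  [SubNzRing_SubLmodule_isSubLalgebra of gen_subalg by <:].
HB.instance Definition _ := [SubLalgebra_isSubAlgebra of gen_subalg by <:].

End GeneratedSubalgebra.

(* The library gives K(t) = {fraction {poly K}} no K-algebra structure. *)

Section RationalFunctions.
Variable K : fieldType.

Definition ratfun : Type := {fraction {poly K}}.
HB.instance Definition _ := GRing.Field.on ratfun.

Definition ratfunC (c : K) : ratfun := tofrac c%:P.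
Definition ratfunX : ratfun := tofrac 'X.

Definition ratfun_scale (c : K) (f : ratfun) : ratfun := ratfunC c * f.

Lemma ratfun_scaleA c d f :
  ratfun_scale c (ratfun_scale d f) = ratfun_scale (c * d) f.
Proof. by rewrite /ratfun_scale mulrA /ratfunC polyCM rmorphM. Qed.
Lemma ratfun_scale1 : left_id 1 ratfun_scale.
Proof. by move=> f; rewrite /ratfun_scale /ratfunC rmorph1 mul1r. Qed.
Lemma ratfun_scaleDr : right_distributive ratfun_scale +%R.
Proof. by move=> c f g; exact: mulrDr. Qed.
Lemma ratfun_scaleDl f : {morph ratfun_scale^~ f : c d / c + d}.
Proof.
by move=> c d; rewrite /ratfun_scale /ratfunC polyCD rmorphD mulrDl.
Qed.
HB.instance Definition _ := GRing.Zmodule_isLmodule.Build K ratfun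
  ratfun_scaleA ratfun_scale1 ratfun_scaleDr ratfun_scaleDl.

Lemma ratfun_scaleAl (c : K) (f g : ratfun) : c *: (f * g) = (c *: f) * g.
Proof. exact: mulrA. Qed.
HB.instance Definition _ := GRing.Lmodule_isLalgebra.Build K ratfun
  ratfun_scaleAl.

Lemma ratfun_scaleAr (c : K) (f g : ratfun) : c *: (f * g) = f * (c *: g).
Proof. exact: mulrCA. Qed.
HB.instance Definition _ := GRing.Lalgebra_isAlgebra.Build K ratfun
  ratfun_scaleAr.

End RationalFunctions.

Section NPointVirasoro.
Variables (K : fieldType) (n : nat) (a : n.-tuple K).

Definition Ra_gens : set (ratfun K) := fun f =>
  f = ratfunX K \/
  exists i : 'I_n, f = (ratfunX K - ratfunC (tnth a i))^-1.

Definition Ra : comAlgType K := gen_subalg Ra_gens.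

Definition Virasoro : lieAlgType K := Der Ra.

End NPointVirasoro.

Definition group_iso (G H : groupType) : Prop :=
  exists f : {multiplicative G -> H}, bijective f.

(* C_N = < s | s^N > and D_N = < s, t | s^N, t^2, tst = s^-1 >. The library's
   H \isog Grp (...) says that the finite group H is universal among finite
   groups satisfying the relations. For N > 0 both presented groups are finite,
   so this is isomorphism with the presented group; D_1 is cyclic of order 2. *)

Definition iso_cyclic (G : groupType) (N : nat) : Prop :=
  exists (gT : finGroupType) (H : {group gT}),
    (H \isog Grp (s : s ^+ N))%g /\ group_iso G [subg H].

Definition iso_dihedral (G : groupType) (N : nat) : Prop :=
  exists (gT : finGroupType) (H : {group gT}),
    (H \isog Grp (s : t : s ^+ N, t ^+ 2, t * s * t = s^-1))%g /\
    group_iso G [subg H].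

(* Main.v *)
Require Import Defs.
From mathcomp Require Import all_boot all_order all_algebra all_fingroup all_solvable.
From mathcomp Require Import reals.
From mathcomp Require Import complex.
From HB Require Import structures.
From mathcomp Require Import generic_quotient separable cyclotomic boolp.
From mathcomp Require Import ring zify.

(* The bracket of f d/dt and g d/dt is the Wronskian f g' - g f'.  A certain Lie
   polynomial in f, k, x, y takes values depending on f and k only through the
   product f k, and determines f k when x and y vary; hence a Lie algebra
   automorphism respects the relation f k = g h, and is therefore conjugation by an
   algebra automorphism of R_a.  If such an automorphism sends t to P/Q, its inverse
   yields a homogeneous relation that forces P and Q to have degree at most 1, and
   looking at poles shows that the Moebius map permutes the set S of punctures
   (infinity and the a_i).  So the group is the stabilizer of S in PGL_2(C), a group
   of permutations of S.

   A nontrivial Moebius map of finite order has exactly two fixed points.  The maps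
   fixing these two points form a cyclic group C, of index 1 or 2 in its normalizer,
   and these groups C partition the nontrivial elements.  Counting elements conjugacy
   class by conjugacy class leaves at most three classes of groups C and the
   orders of the five families; the last three are identified through their
   conjugation actions on four subgroups of order 3 or five Sylow 2-subgroups.

   To realize C_N and D_N, take S invariant under multiplication by a primitive N-th
   root of unity and such that |S| is odd or N exceeds the orders of the elements of
   A_4, S_4 and A_5.  An odd |S| rules these groups out because they contain a noncyclic
   2-group, which has no fixed point.  Small N is settled by cross-ratios of integer
   points, and the exceptional groups are the stabilizers of the vertices of a
   tetrahedron, an octahedron and an icosahedron. *)

(** The hypothesis [1 < n] provides at least three punctures. A Moebius map is determined by three
    values, so the stabilizer embeds in a finite symmetric group; with a single a_1 every scaling
    about it would survive and the group would be infinite. On the Lie side, write an automorphism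
    as f d/dt -> psi(f) d/dt. The transported relation shows that psi(1) is a unit, and psi divided
    by psi(1) is multiplicative: this quotient is the algebra automorphism. On the group side,
    classes of the groups C are counted instead of orbits of fixed points, so that only conjugation
    in a finite group is involved. The price is that the tetrahedral group appears with two classes,
    one of them self-normalizing, and that the triple (2, 3, 3) with three classes has to be
    excluded. In the realizations, an element of order 2 may be a reflection, whose fixed points a
    dihedral group need not preserve; this is why N = 1 and N = 2 require point sets of their
    own. *)

Set Implicit Arguments.
Unset Strict Implicit.
Unset Printing Implicit Defensive.

Import Order.TTheory GRing.Theory Num.Theory.

Local Open Scope group_scope.

(** * Finite groups covered by cyclic fixers *)

Section Cover.
Variable gT : finGroupType.
Implicit Types (G : {group gT}) (C : gT -> {group gT}).

(* [C x] is modelled on the group of the Moebius maps fixing the two fixed points of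
   [x]: an element of its normalizer outside it swaps these two points. *)
Record fix_cover G C : Prop := FixCover {
  cover_sub : forall x, x \in G^# -> C x \subset G;
  cover_cyclic : forall x, x \in G^# -> cyclic (C x);
  cover_id : forall x, x \in G^# -> x \in C x;
  cover_eq : forall x y, x \in G^# -> y \in (C x)^# -> C y :=: C x;
  cover_conj : forall x g, x \in G^# -> g \in G -> C (x ^ g) :=: C x :^ g;
  cover_mul : forall x y z, x \in G^# ->
    y \in 'N_G(C x) :\: C x -> z \in 'N_G(C x) :\: C x -> y * z \in C x;
  cover_sq : forall x y, x \in G^# -> y \in 'N_G(C x) :\: C x -> y ^+ 2 = 1
}.

Variables (G : {group gT}) (C : gT -> {group gT}).
Hypothesis cov : fix_cover G C.

Definition cclass x := class_support (C x)^# G.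

Lemma cover_nt x : x \in G^# -> x \in (C x)^#.
Proof. by move=> Gx; have /setD1P[nx _] := Gx; rewrite !inE nx (cover_id cov). Qed.

Lemma cover_subN x : x \in G^# -> C x \subset 'N_G(C x).
Proof. by move=> Gx; rewrite subsetI (cover_sub cov Gx) normG. Qed.

Lemma conj_nt x g : x \in G^# -> g \in G -> x ^ g \in G^#.
Proof. by case/setD1P=> nx Gx Gg; rewrite !inE conjg_eq1 nx groupJ. Qed.

Lemma cover_ntG x y : x \in G^# -> y \in (C x)^# -> y \in G^#.
Proof. by move=> Gx; apply/subsetP/setSD/(cover_sub cov). Qed.

(** Two conjugates of [C x] that share a nontrivial y both equal [C y]. Hence the size of a class is
    |C x| - 1 times the number of conjugates. *)
Lemma cover_normedTI x : x \in G^# -> normedTI (C x)^# G 'N_G(C x).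
Proof.
move=> Gx; apply/normedTI_P; split.
- by apply/set0Pn; exists x; apply: cover_nt.
- by apply/subsetP=> g /setIP[Gg ng]; rewrite inE Gg normD1.
move=> g Gg /pred0Pn[y /andP[/= Cy]]; rewrite conjD1g => /setD1P[ny].
rewrite mem_conjg => Cyg; rewrite inE Gg; apply/normP.
have Gy := cover_ntG Gx Cy.
rewrite -(cover_conj cov Gx Gg) -(cover_eq cov Gx Cy).
have Cyg' : y ^ g^-1 \in (C x)^# by rewrite !inE conjg_eq1 ny.
rewrite (cover_conj cov Gx Gg) -(cover_eq cov Gx Cyg').
by rewrite -(cover_conj cov) ?conjgKV // (cover_ntG Gx Cyg').
Qed.

Definition cindex x := #|G : 'N_G(C x)|.

Lemma card_cclass x : x \in G^# -> #|cclass x| = (#|C x|.-1 * cindex x)%N.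
Proof.
move=> Gx; rewrite /cclass (card_support_normedTI (cover_normedTI Gx)).
by rewrite (cardsD1 1 (C x)) group1.
Qed.

(** Two elements of the normalizer outside [C x] multiply into [C x], so a single further coset
    covers the normalizer. *)
Lemma cover_ratio x : x \in G^# ->
  #|'N_G(C x)| = (((C x != 'N_G(C x) :> {set gT})).+1 * #|C x|)%N.
Proof.
move=> Gx; have sCN := cover_subN Gx.
have [eCN | nCN] /= := eqVneq; first by rewrite -eCN mul1n.
have /properP[_ [y Ny Cy]] : C x \proper 'N_G(C x) by rewrite properEneq nCN.
have : 'N_G(C x) \subset C x :|: C x :* y^-1.
  apply/subsetP=> z Nz; rewrite inE; case Cz: (z \in C x) => //=.
  rewrite mem_rcoset invgK; apply: (cover_mul cov Gx); rewrite inE ?Cz //.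
  by rewrite Cy.
move/subset_leq_card; rewrite -(Lagrange sCN) mulnC.
have ltn : 1 < #|'N_G(C x) : C x| 
  by rewrite indexg_gt1; apply: contra Cy => /subsetP; apply.
rewrite cardsU card_rcoset => le2.
have C0 : 0 < #|C x| by rewrite cardG_gt0.
have : #|'N_G(C x) : C x| * #|C x| <= 2 * #|C x|.
  by apply: leq_trans le2 _; rewrite mul2n -addnn leq_subr.
by rewrite leq_pmul2r // => ?; congr (_ * _)%N; apply/eqP; rewrite eqn_leq ltn andbT.
Qed.

Lemma cindexE x : x \in G^# ->
  (((C x != 'N_G(C x) :> {set gT})).+1 * #|C x| * cindex x)%N = #|G|.
Proof. by move=> Gx; rewrite -(cover_ratio Gx) Lagrange ?subsetIl. Qed.

Lemma cover_card x : x \in G^# -> 1 < #|C x|.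
Proof.
move=> Gx; rewrite cardG_gt1; apply/trivgPn; exists x; first exact: cover_id Gx.
by case/setD1P: Gx.
Qed.

Lemma cclass_sub x : x \in G^# -> cclass x \subset G^#.
Proof.
move=> Gx; rewrite /cclass class_supportEr; apply/bigcupsP=> g Gg.
by rewrite conjD1g setSD // conj_subG // (cover_sub cov).
Qed.

Lemma cclassP x y : x \in G^# -> y \in cclass x ->
  exists2 g, g \in G & C y :=: C x :^ g.
Proof.
move=> Gx /imset2P[z g Cz Gg ->]; exists g => //.
by rewrite (cover_conj cov) ?(cover_ntG Gx Cz) // (cover_eq cov Gx Cz).
Qed.

Lemma cclass_card x y : x \in G^# -> y \in cclass x -> #|C y| = #|C x|.
Proof. by move=> Gx /(cclassP Gx)[g _ ->]; rewrite cardJg. Qed.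

Lemma mem_cclass x y g : x \in G^# -> y \in G^# -> g \in G ->
  C y :=: C x :^ g -> y \in cclass x.
Proof.
move=> Gx Gy Gg eC; apply/imset2P; exists (y ^ g^-1) g => //; last by rewrite conjgKV.
have [ny _] := setD1P Gy.
by rewrite !inE conjg_eq1 ny -mem_conjg -eC (cover_id cov).
Qed.

Lemma cclass_id x : x \in G^# -> x \in cclass x.
Proof. by move=> Gx; apply: (mem_cclass (g:=1)); rewrite ?conjsg1. Qed.

Lemma cclass_disjoint x y : x \in G^# -> y \in G^# -> y \notin cclass x ->
  [disjoint cclass x & cclass y].
Proof.
move=> Gx Gy; apply: contraR => /pred0Pn[z /andP[/= xz yz]].
have [g Gg eg] := cclassP Gx xz; have [h Gh eh] := cclassP Gy yz.
apply: (mem_cclass (g := g * h^-1)); rewrite ?groupM ?groupV //.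
by rewrite conjsgM -eg eh conjsgK.
Qed.

End Cover.

(** * Arithmetic of the class equation *)

Lemma one_class_arith (b : bool) g n o : (b.+1 * n * o)%N = g ->
  1 < n -> 0 < o -> (n.-1 * o)%N = g.-1 -> o = 1%N /\ b = false.
Proof. by case: b => /=; nia. Qed.

(** With index 2 twice the sizes add up to g - o1 - o2 <= g - 2, with two self-normalizing groups to
    2g - o1 - o2 >= g. Neither is g - 1. *)
Lemma two_class_arith_eq (b1 b2 : bool) g n1 n2 o1 o2 :
  (b1.+1 * n1 * o1)%N = g -> (b2.+1 * n2 * o2)%N = g ->
  1 < n1 -> 1 < n2 -> 0 < o1 -> 0 < o2 ->
  (n1.-1 * o1 + n2.-1 * o2)%N = g.-1 -> b1 = ~~ b2.
Proof.
case: b1; case: b2 => //= e1 e2 n1P n2P o1P o2P s; exfalso.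
  have o1g : 2 * o1 * 2 <= g by nia.
  have o2g : 2 * o2 * 2 <= g by nia.
  have [h1 h2] : (n1.-1 * o1 + o1 = n1 * o1 /\ n2.-1 * o2 + o2 = n2 * o2)%N by nia.
  by nia.
have [h1 h2] : (n1.-1 * o1 + o1 = g /\ n2.-1 * o2 + o2 = g)%N by nia.
have o1g : 2 * o1 <= g by nia.
have o2g : 2 * o2 <= g by nia.
by nia.
Qed.

(** Divided by g, the count reads 1/n1 + 1/(2 n2) = 1/2 + 1/g. Here n1 = 2 forces g = 2 n2, n1 = 3
    forces n2 = 2 and g = 12, and n1 >= 4 leaves no n2 >= 2. *)
Lemma two_class_arith g n1 n2 o1 o2 :
  (n1 * o1)%N = g -> (2 * n2 * o2)%N = g ->
  1 < n1 -> 1 < n2 -> 0 < o1 -> 0 < o2 ->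
  (n1.-1 * o1 + n2.-1 * o2)%N = g.-1 ->
  o2 = 1%N \/ [/\ g = 12, n1 = 3, n2 = 2 & o1 = 4]%N.
Proof.
move=> e1 e2 n1P n2P o1P o2P s.
have h1 : (n1.-1 * o1 + o1 = g)%N by nia.
have h2 : (n2.-1 * o2 + o2 = n2 * o2)%N by nia.
have h : (o1 + o2 = n2 * o2 + 1)%N by nia.
have n1l : n1 < 4 by nia.
have [e|e] : n1 = 2%N \/ n1 = 3%N by lia.
  by subst n1; left; nia.
right; subst n1.
have o2l : (o2 * 3 = n2 * o2 + 3)%N by nia.
have n2l : n2 < 3 by nia.
have e : n2 = 2%N by lia.
by subst n2; split; lia.
Qed.

(** Since n - 1 >= n/2, a class takes up at least g/2 elements if its groups are self-normalizing
    and at least g/4 otherwise. A total of g - 1 has no room for four classes, nor for three of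
    which one is self-normalizing. *)
Lemma class_size_bound (b : bool) g n o : (b.+1 * n * o)%N = g -> 1 < n ->
  g <= b.+1 * (2 * (n.-1 * o)) .
Proof. by case: b => /=; nia. Qed.

(** This is the classical equation 1/n1 + 1/n2 + 1/n3 = 1 + 1/h with h = g/2; [o3 = 1] is its
    dihedral solution (2, 2, h). *)
Lemma three_class_arith h n1 n2 n3 o1 o2 o3 :
  (n1 * o1)%N = h -> (n2 * o2)%N = h -> (n3 * o3)%N = h ->
  1 < n1 -> n1 <= n2 -> n2 <= n3 -> (o1 + o2 + o3 = h.+1)%N ->
  [\/ o3 = 1%N,
      [/\ h = 6, n1 = 2, n2 = 3 & n3 = 3]%N,
      [/\ h = 12, n1 = 2, n2 = 3 & n3 = 4]%N |
      [/\ h = 30, n1 = 2, n2 = 3 & n3 = 5]%N].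
Proof.
move=> h1 h2 h3 n1P l12 l23 s.
have hP : 0 < h by nia.
have o12 : o2 <= o1 by nia.
have o23 : o3 <= o2 by nia.
have e1 : n1 = 2%N by nia.
subst n1; have n2P : n2 <= 3 by nia.
have [e2|e2] : n2 = 2%N \/ n2 = 3%N by lia.
  by subst n2; constructor 1; lia.
subst n2; have n3P : n3 < 6 by nia.
have [e3|[e3|e3]] : n3 = 3%N \/ n3 = 4%N \/ n3 = 5%N by lia.
- by subst n3; constructor 2; split; lia.
- by subst n3; constructor 3; split; lia.
by subst n3; constructor 4; split; lia.
Qed.
Lemma three_class_arith_double g n1 n2 n3 o1 o2 o3 : 0 < g ->
  (2 * n1 * o1)%N = g -> (2 * n2 * o2)%N = g -> (2 * n3 * o3)%N = g ->
  1 < n1 -> 1 < n2 -> 1 < n3 -> n1 <= n2 -> n2 <= n3 ->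
  (n1.-1 * o1 + n2.-1 * o2 + n3.-1 * o3)%N = g.-1 ->
  [\/ o3 = 1%N,
      [/\ g = 12, n1 = 2, n2 = 3 & n3 = 3]%N,
      [/\ g = 24, n1 = 2, n2 = 3 & n3 = 4]%N |
      [/\ g = 60, n1 = 2, n2 = 3 & n3 = 5]%N].
Proof.
move=> gP e1 e2 e3 n1P n2P n3P l12 l23 s.
move: gP; rewrite -e1 => gP; rewrite -e1 in s e2 e3 *; have h2 : (n2 * o2 = n1 * o1)%N by lia.
have h3 : (n3 * o3 = n1 * o1)%N by lia.
have pr n o : 1 < n -> (n.-1 * o + o = n * o)%N by case: n => // n _ /=; rewrite mulSn addnC.
have so : (o1 + o2 + o3 = (n1 * o1).+1)%N.
  have := pr _ o1 n1P; have := pr _ o2 n2P; have := pr _ o3 n3P.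
  by lia.
case: (three_class_arith erefl h2 h3 n1P l12 l23 so) => [o1'|[]|[]|[]]; first by constructor 1.
- by move=> e *; constructor 2; split; lia.
- by move=> e *; constructor 3; split; lia.
by move=> e *; constructor 4; split; lia.
Qed.

Lemma three_class_selfN (bx b_y bz : bool) g ux uy uz :
  g <= bx.+1 * (2 * ux) -> g <= b_y.+1 * (2 * uy) -> g <= bz.+1 * (2 * uz) ->
  0 < g -> ux + uy + uz <= g.-1 -> [&& bx, b_y & bz].
Proof. by case: bx; case: b_y; case: bz => //=; lia. Qed.

Lemma no_four_classes (bx b_y bz bw : bool) g ux uy uz uw :
  g <= bx.+1 * (2 * ux) -> g <= b_y.+1 * (2 * uy) -> g <= bz.+1 * (2 * uz) ->
  g <= bw.+1 * (2 * uw) -> 0 < g -> (ux + uy + uz + uw <= g.-1) = false.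
Proof. by case: bx; case: b_y; case: bz; case: bw => /=; lia. Qed.

(** * Counting elements class by class *)

Section Classes.
Variables (gT : finGroupType) (G : {group gT}) (C : gT -> {group gT}).
Hypothesis cov : fix_cover G C.

Let usize x : x \in G^# -> #|cclass G C x| = (#|C x|.-1 * cindex G C x)%N := card_cclass cov (x := x).

Lemma cover_classes : G :!=: 1 ->
  [\/ exists2 x, x \in G^# & #|C x| = #|G|,
      exists2 x, x \in G^# & (2 * #|C x|)%N = #|G|,
      #|G| = 12 /\ exists x y, [/\ x \in G^#, y \in G^# &
        [/\ #|C x| = 3, #|C y| = 2, C x :=: 'N_G(C x) &
            G^# \subset cclass G C x :|: cclass G C y]] |
      exists x y z, [/\ x \in G^#, y \in G^#, z \in G^# &
        [/\ #|C x| = 2, #|C y| = 3, #|G| = 24 /\ #|C z| = 4 \/ #|G| = 60 /\ #|C z| = 5,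
           [/\ C x != 'N_G(C x) :> {set gT}, C y != 'N_G(C y) :> {set gT}
            & C z != 'N_G(C z) :> {set gT}] &
            G^# \subset cclass G C x :|: cclass G C y :|: cclass G C z]]].
Proof.
case/trivgPn=> x Gx nx; have {nx}Gx : x \in G^# by rewrite !inE nx.
have cG : #|G^#| = #|G|.-1 by rewrite (cardsD1 1 G) group1.
have gP : 0 < #|G| by rewrite cardG_gt0.
have cI t : 0 < cindex G C t by rewrite /cindex indexg_gt0.
have sub1 := cclass_sub cov Gx.
have [[Dx nxP] ux] := ((cindexE cov Gx), (cover_card cov Gx), usize Gx).
have bx := class_size_bound Dx nxP.
have [eq1|] := boolP (G^# \subset cclass G C x).
  have s1 : (#|C x|.-1 * cindex G C x)%N = #|G|.-1.
    by rewrite -ux -cG; apply/eqP; rewrite eqn_leq !subset_leq_card.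
  have [o1 b1] := one_class_arith Dx nxP (cI x) s1.
  by constructor 1; exists x => //; rewrite -Dx o1 b1 mul1n muln1.
case/subsetPn=> y Gy xy; have dxy := cclass_disjoint cov Gx Gy xy.
have sub2 := cclass_sub cov Gy.
have [[Dy nyP] uy] := ((cindexE cov Gy), (cover_card cov Gy), usize Gy).
have by_ := class_size_bound Dy nyP.
have cxy : #|cclass G C x :|: cclass G C y| = (#|cclass G C x| + #|cclass G C y|)%N.
  by rewrite cardsU (disjoint_setI0 dxy) cards0 subn0.
have subxy : cclass G C x :|: cclass G C y \subset G^# by rewrite subUset sub1.
have [eq2|] := boolP (G^# \subset cclass G C x :|: cclass G C y).
  have s2 : (#|C x|.-1 * cindex G C x + #|C y|.-1 * cindex G C y)%N = #|G|.-1.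
    by rewrite -ux -uy -cxy -cG; apply/eqP; rewrite eqn_leq !subset_leq_card.
  have be := two_class_arith_eq Dx Dy nxP nyP (cI x) (cI y) s2.
  (* Exactly one of the two groups is self-normalizing; by symmetry it may be [C x]. *)
  wlog bF : x y Gx Gy Dx Dy nxP nyP s2 be eq2 {sub1 sub2 ux uy bx by_ xy dxy cxy subxy} /
      C y != 'N_G(C y) :> {set gT}.
    move=> IH; case: (boolP (C y != 'N_G(C y) :> {set gT})) => nb; first exact: (IH x y).
    apply: (IH y x) => //; [by rewrite addnC | by rewrite be negbK | by rewrite setUC |].
    by rewrite be.
  rewrite bF /= in be Dy; rewrite be mul1n in Dx.
  case: (two_class_arith Dx Dy nxP nyP (cI x) (cI y) s2) => [o2 | [g12 n3 n2 o4]].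
    by constructor 2; exists y => //; rewrite -Dy o2 muln1.
  constructor 3; split=> //; exists x, y; split=> //; split=> //.
  by apply/eqP; move/negbFE: be.
case/subsetPn=> z Gz; rewrite inE negb_or => /andP[xz yz].
have dxz := cclass_disjoint cov Gx Gz xz; have dyz := cclass_disjoint cov Gy Gz yz.
have sub3 := cclass_sub cov Gz.
have [[Dz nzP] uz] := ((cindexE cov Gz), (cover_card cov Gz), usize Gz).
have bz := class_size_bound Dz nzP.
pose V := cclass G C x :|: cclass G C y :|: cclass G C z.
have cxyz : #|V| = (#|cclass G C x| + #|cclass G C y| + #|cclass G C z|)%N.
  rewrite cardsU cxy setIUl (disjoint_setI0 dxz) (disjoint_setI0 dyz) setU0.
  by rewrite cards0 subn0.
have subV : V \subset G^# by rewrite subUset subxy.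
have le3 : (#|C x|.-1 * cindex G C x + #|C y|.-1 * cindex G C y +
    #|C z|.-1 * cindex G C z)%N <= #|G|.-1.
  by rewrite -ux -uy -uz -cxyz -cG subset_leq_card.
have eqV : G^# \subset V.
  apply: contraT => /subsetPn[w Gw]; rewrite !inE !negb_or => /andP[/andP[xw yw] zw].
  have dxw := cclass_disjoint cov Gx Gw xw; have dyw := cclass_disjoint cov Gy Gw yw.
  have dzw := cclass_disjoint cov Gz Gw zw.
  have bw := class_size_bound (cindexE cov Gw) (cover_card cov Gw).
  have cV : #|V :|: cclass G C w| = (#|V| + #|cclass G C w|)%N.
    rewrite cardsU !setIUl (disjoint_setI0 dxw) (disjoint_setI0 dyw).
    by rewrite (disjoint_setI0 dzw) !setU0 cards0 subn0.
  have : #|V :|: cclass G C w| <= #|G|.-1.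
    by rewrite -cG subset_leq_card // subUset subV cclass_sub.
  by rewrite cV cxyz (usize Gw) ux uy uz (no_four_classes bx by_ bz bw).
have s3 : (#|C x|.-1 * cindex G C x + #|C y|.-1 * cindex G C y +
    #|C z|.-1 * cindex G C z)%N = #|G|.-1.
  by rewrite -ux -uy -uz -cxyz -cG; apply/eqP; rewrite eqn_leq !subset_leq_card.
have [nx ny nz] : [/\ C x != 'N_G(C x) :> {set gT}, C y != 'N_G(C y) :> {set gT}
            & C z != 'N_G(C z) :> {set gT}].
  by have /and3P[] := three_class_selfN bx by_ bz gP le3.
rewrite /V in eqV; rewrite nx /= in Dx; rewrite ny /= in Dy; rewrite nz /= in Dz.
(* [tri] gathers the facts that are symmetric in the three classes, so that these can be sorted by
   the order of their groups. *)
pose tri a b c := [/\ a \in G^#, b \in G^#, c \in G^# &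
  [/\ (2 * #|C a| * cindex G C a = #|G|)%N, (2 * #|C b| * cindex G C b = #|G|)%N,
      (2 * #|C c| * cindex G C c = #|G|)%N,
      (#|C a|.-1 * cindex G C a + #|C b|.-1 * cindex G C b +
       #|C c|.-1 * cindex G C c)%N = #|G|.-1 &
  [/\ C a != 'N_G(C a) :> {set gT}, C b != 'N_G(C b) :> {set gT},
      C c != 'N_G(C c) :> {set gT},
      G^# \subset cclass G C a :|: cclass G C b :|: cclass G C c &
  [/\ [disjoint cclass G C a & cclass G C b], [disjoint cclass G C a & cclass G C c]
    & [disjoint cclass G C b & cclass G C c]]]]].
have tC a b c : tri a b c -> tri b a c.
  case=> ? ? ? [? ? ? e [? ? ? ? [? ? ?]]]; split=> //; split=> //.
    by rewrite -e [(_ + _ * cindex G C a)%N]addnC.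
  split=> //; first by rewrite [cclass G C b :|: _]setUC.
  by split=> //; rewrite disjoint_sym.
have tA a b c : tri a b c -> tri a c b.
  case=> ? ? ? [? ? ? e [? ? ? ? [? ? ?]]]; split=> //; split=> //.
    by rewrite -e addnAC.
  split=> //; first by rewrite setUAC.
  by split=> //; rewrite disjoint_sym.
have txyz : tri x y z by [].
have [a [b [c [abc ab bc]]]] : exists a b c, [/\ tri a b c, #|C a| <= #|C b| & #|C b| <= #|C c|].
  have [l1|/ltnW l1] := leqP #|C x| #|C y|; have [l2|/ltnW l2] := leqP #|C y| #|C z|;
  have [l3|/ltnW l3] := leqP #|C x| #|C z|.
  - by exists x, y, z.
  - by exists x, y, z.
  - by exists x, z, y; split=> //; apply: tA.
  - by exists z, x, y; split=> //; apply/tC/tA.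
  - by exists y, x, z; split=> //; apply: tC.
  - by exists y, z, x; split=> //; apply/tA/tC.
  - by exists z, y, x; split=> //; apply/tC/tA/tC.
  by exists z, y, x; split=> //; apply/tC/tA/tC.
case: abc => Ga Gb Gc [ea eb ec s [na nb nc eqG [_ _ dbc]]].
have [[na1 nb1] nc1] := (cover_card cov Ga, cover_card cov Gb, cover_card cov Gc).
clear - Ga Gb Gc ea eb ec s na nb nc eqG dbc na1 nb1 nc1 ab bc cov gP.
case: (three_class_arith_double gP ea eb ec na1 nb1 nc1 ab bc s) =>
  [o1 | [g12 a2 b3 c3] | [g24 a2 b3 c4] | [g60 a2 b3 c5]].
- by constructor 2; exists c => //; rewrite -ec o1 muln1.
(* In a group of order 12 the subgroups of order 3 are Sylow subgroups, hence conjugate, but the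
   classes of b and c are disjoint. *)
- exfalso.
  have syl t : t \in G^# -> #|C t| = 3 -> 3.-Sylow(G) (C t).
    move=> Gt ct; rewrite pHallE (cover_sub cov Gt) ct g12.
    by rewrite (_ : 12 = 3 * 4)%N // p_part lognM // (pfactorK 1) // (@lognE 3 4).
  have [g Gg eg] := Sylow_trans (syl b Gb b3) (syl c Gc c3).
  have := mem_cclass cov Gb Gc Gg eg.
  by rewrite (disjointFl dbc) // (cclass_id cov).
- by constructor 4; exists a, b, c; split=> //; split=> //; left.
by constructor 4; exists a, b, c; split=> //; split=> //; right.
Qed.
End Classes.

(** * Faithful conjugation actions and parity *)

Section ConjEmbed.
Variable gT : finGroupType.

Lemma conj_embed (G : {group gT}) (D : {set {set gT}}) k : #|D| = k ->
  {in D & G, forall A g, A :^ g \in D} ->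
  {in G, forall g, {in D, forall A : {set gT}, A :^ g = A} -> g = 1} ->
  exists f : {morphism G >-> {perm 'I_k}}, 'injm f.
Proof.
move=> <-{k} DG D1.
pose r g (i : 'I_#|D|) := enum_rank_in (enum_valP i) (enum_val i :^ g).
have rE g i : g \in G -> enum_val (r g i) = enum_val i :^ g.
  by move=> Gg; rewrite enum_rankK_in // DG // enum_valP.
have rI g : g \in G -> injective (r g).
  move=> Gg i j /(congr1 enum_val); rewrite !rE // => /conjsg_inj.
  exact: enum_val_inj.
(* Outside G the map [r g] may fail to be injective and [p g] is a dummy value; the morphism has
   domain G. *)
pose p g : {perm 'I_#|D|} := if injectiveP (r g) is ReflectT h then perm h else 1.
have pE g i : g \in G -> p g i = r g i.
  by move=> Gg; rewrite /p; case: injectiveP (rI _ Gg) => // h _; rewrite permE.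
have pM : {in G &, {morph p : x y / x * y}}.
  move=> g h Gg Gh; apply/permP=> i; rewrite permM !pE ?groupM //.
  by apply: enum_val_inj; rewrite !rE ?groupM // conjsgM.
exists (Morphism pM); apply/injmP=> g h Gg Gh /= pgh.
have gh1 : g * h^-1 = 1.
  apply: D1; first by rewrite groupM ?groupV.
  move=> A DA; have := congr1 (fun s : {perm _} => enum_val (s (enum_rank_in DA A))) pgh.
  by rewrite !pE // !rE // enum_rankK_in // conjsgM => ->; rewrite conjsgK.
by apply/eqP; rewrite eq_mulgV1 gh1.
Qed.

Lemma odd_order_even (T : finType) (s : {perm T}) : odd #[s] -> odd_perm s = false.
Proof.
move=> os; have : odd_perm (s ^+ #[s]) = odd_perm s.
  elim: #[s] os => // n IH; rewrite expgS odd_permM /=; move: IH.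
  have oX m : odd_perm (s ^+ m) = odd m && odd_perm s.
    elim: m => [|m IHm]; first by rewrite expg0 odd_perm1.
    by rewrite expgS odd_permM IHm /=; case: (odd m); case: (odd_perm s).
  by rewrite oX; case: (odd n); case: (odd_perm s).
by rewrite expg_order odd_perm1 => <-.
Qed.

(* A set of more than half of the elements generates, and odd-order
   permutations are even. *)
Lemma morphim_Alt (G : {group gT}) (T : finType) (f : {morphism G >-> {perm T}})
    (S : {set gT}) :
  S \subset G -> #|G| < 2 * #|S| -> {in S, forall x, odd #[x]} ->
  f @* G \subset 'Alt_T.
Proof.
move=> sSG ltS oS.
pose A := f @*^-1 'Alt_T.
have SA : S \subset A.
  apply/subsetP=> x Sx; have Gx := subsetP sSG x Sx.
  rewrite inE Gx inE Alt_even odd_order_even // (dvdn_odd _ (oS x Sx)) //.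
  exact: morph_order.
rewrite sub_morphim_pre //; suff eA : A :=: G by rewrite -/A eA.
have sAG : A \subset G by rewrite subsetIl.
apply/eqP; rewrite eqEsubset sAG /=; apply: contraT; rewrite -indexg_gt1.
move=> i1; have := subset_leq_card SA; have := Lagrange sAG.
by move: i1 ltS; set i := #|_ : _|; set a := #|A|; nia.
Qed.

End ConjEmbed.

(** * Identification of the exceptional groups *)

Section Exotic.
Variables (gT : finGroupType) (G : {group gT}) (C : gT -> {group gT}).
Hypothesis cov : fix_cover G C.

Lemma cclass_order x y : x \in G^# -> prime #|C x| -> y \in cclass G C x ->
  #[y] = #|C x|.
Proof.
move=> Gx px xy; have Gy := subsetP (cclass_sub cov Gx) y xy.
have [ny _] := setD1P Gy.
have dv : #[y] %| #|C x|.
  by rewrite -(cclass_card cov Gx xy) order_dvdG // (cover_id cov).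
by case/primeP: px => _ /(_ _ dv); rewrite order_eq1 (negPf ny) => /eqP.
Qed.

Lemma cclass_index x y : x \in G^# -> y \in cclass G C x ->
  cindex G C y = cindex G C x.
Proof.
move=> Gx /(cclassP cov Gx)[g Gg eg].
by rewrite /cindex eg -{2}(conjGid Gg) normJ -conjIg -{1}(conjGid Gg) indexJg.
Qed.

(** G acts on the four conjugates of [C x]. Each is its own normalizer, so an element normalizing
    all of them lies in all of them, and distinct ones meet trivially. Together with 1, the 8
    elements of order 3 are more than half of G, so the image is even. *)
Lemma tetra_Alt : #|G| = 12 -> forall x, x \in G^# -> #|C x| = 3 ->
  C x :=: 'N_G(C x) -> G \isog 'Alt_('I_4).
Proof.
move=> g12 x Gx x3 Nx.
have := cindexE cov Gx; rewrite -Nx eqxx /= mul1n x3 g12 => o4.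
have {}o4 : #|(C x : {set gT}) :^: G| = 4.
  by rewrite card_conjugates; change (cindex G C x = 4); move: o4; lia.
have conjN g : g \in G -> 'N_G(C x :^ g) = C x :^ g.
  by move=> Gg; rewrite {2}Nx conjIg normJ conjGid.
have [f injf] : exists f : {morphism G >-> {perm 'I_4}}, 'injm f.
  apply: (conj_embed o4) => [_ g /imsetP[h Gh ->] Gg|g Gg fixg].
    by rewrite -conjsgM; apply: imset_f; rewrite groupM.
  apply/eqP; apply: contraT => ng.
  have inall h : h \in G -> g \in C x :^ h.
    move=> Gh; rewrite -conjN // inE Gg; apply/normP/fixg.
    by apply: imset_f.
  have [h Gh nCh] : exists2 h, h \in G & C x :^ h != C x.
    apply/exists_inP; apply: contraT; rewrite negb_exists_in => /forall_inP hC.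
    move: o4; suff -> : (C x : {set gT}) :^: G = [set C x : {set gT}] by rewrite cards1.
    apply/setP=> A; rewrite inE; apply/imsetP/eqP => [[h Gh ->]|->].
      by apply/eqP; have := hC h Gh; rewrite negbK.
    by exists 1; rewrite ?conjsg1.
  have gC : g \in (C x)^# by rewrite !inE ng -[C x : {set gT}]conjsg1 inall.
  have := inall h Gh; rewrite -(cover_conj cov Gx Gh) => gCh.
  case/eqP: nCh; rewrite -(cover_conj cov Gx Gh) -(cover_eq cov Gx gC).
  by rewrite (cover_eq cov (conj_nt Gx Gh) (y := g)) // !inE ng.
have sAlt : f @* G \subset 'Alt_('I_4).
  apply: (@morphim_Alt _ _ _ _ (1 |: cclass G C x)).
  - by rewrite subUset sub1G (subset_trans (cclass_sub cov Gx)) ?subD1set.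
  - rewrite cardsU1 (card_cclass cov Gx) x3 g12.
    rewrite /cindex -card_conjugates o4 (contra (subsetP (cclass_sub cov Gx) 1)) //.
    by rewrite !inE eqxx.
  move=> y; rewrite !inE => /predU1P[->|xy]; first by rewrite order1.
  by rewrite (cclass_order Gx _ xy) x3.
have cA : #|'Alt_('I_4)| = 12.
  have := card_Alt (T := 'I_4); rewrite card_ord => /(_ isT).
  by move=> c; apply/eqP; rewrite -(eqn_pmul2l (m := 2)) // c.
have -> : 'Alt_('I_4) = f @* G.
  by apply/eqP; rewrite eq_sym eqEcard sAlt card_injm // cA g12.
exact: sub_isog.
Qed.

(** A nontrivial g in the kernel of the action on the four conjugates lies outside every one of
    them: inside one, its order would divide 3, and outside another one, 2. Two such elements
    therefore multiply into [C y], hence to 1, and the kernel has order at most 2. Being normal, it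
    then commutes with y; but g y also lies outside [C y] and squares to 1, so y^2 = 1 although y
    has order 3. *)
Lemma octa_Sym : #|G| = 24 -> forall y, y \in G^# -> #|C y| = 3 ->
  C y != 'N_G(C y) :> {set gT} -> G \isog 'Sym_('I_4).
Proof.
move=> g24 y Gy y3 Ny.
have := cindexE cov Gy; rewrite Ny /= y3 g24 => o4.
have {}o4 : #|(C y : {set gT}) :^: G| = 4.
  by rewrite card_conjugates; change (cindex G C y = 4); move: o4; lia.
have [f injf] : exists f : {morphism G >-> {perm 'I_4}}, 'injm f.
  apply: (conj_embed o4) => [_ g /imsetP[h Gh ->] Gg|g Gg fixg].
    by rewrite -conjsgM; apply: imset_f; rewrite groupM.
  apply/eqP; apply: contraT => ng.
  have outN k h : k \in G -> k != 1 ->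
      {in (C y : {set gT}) :^: G, forall A : {set gT}, A :^ k = A} -> h \in G ->
      k \in 'N_G(C (y ^ h)) :\: C (y ^ h).
    move=> Gk nk fixk Gh.
    have kN l : l \in G -> k \in 'N_G(C (y ^ l)).
      move=> Gl; rewrite inE Gk; apply/normP.
      by rewrite (cover_conj cov Gy Gl) fixk //; apply: imset_f.
    rewrite inE kN // andbT; apply/negP=> kC.
    have Gyh := conj_nt Gy Gh.
    have kC' : k \in (C (y ^ h))^# by rewrite !inE nk.
    have [l Gl nCl] : exists2 l, l \in G & C (y ^ l) != C (y ^ h) :> {set gT}.
      apply/exists_inP; apply: contraT; rewrite negb_exists_in => /forall_inP hC.
      move: o4; suff -> : (C y : {set gT}) :^: G = [set C (y ^ h) : {set gT}] by rewrite cards1.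
      apply/setP=> A; rewrite inE; apply/imsetP/eqP => [[l Gl ->]|->].
        by apply/eqP; have := hC l Gl; rewrite negbK (cover_conj cov Gy Gl).
      by exists h; rewrite // (cover_conj cov Gy).
    have Gyl := conj_nt Gy Gl.
    have kl : k \in 'N_G(C (y ^ l)) :\: C (y ^ l).
      rewrite inE kN // andbT; apply: contra nCl => kl.
      by rewrite -(cover_eq cov Gyl (y := k)) ?(cover_eq cov Gyh kC') // !inE nk.
    have := order_dvdG kC; rewrite (cover_conj cov Gy Gh) cardJg y3.
    have : #[k] %| 2 by rewrite order_dvdn (cover_sq cov Gyl kl).
    move=> k2 k3; have : #[k] %| gcdn 2 3 by rewrite dvdn_gcd k2.
    by rewrite dvdn1 order_eq1 (negPf nk).
  have uniqg k : k \in G -> k != 1 ->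
      {in (C y : {set gT}) :^: G, forall A : {set gT}, A :^ k = A} -> g * k = 1.
    move=> Gk nk fixk; apply/eqP; apply: contraT => ngk.
    have fixgk : {in (C y : {set gT}) :^: G, forall A : {set gT}, A :^ (g * k) = A}.
      by move=> A DA; rewrite conjsgM fixg ?fixk.
    have := outN _ 1 (groupM Gg Gk) ngk fixgk (group1 G).
    rewrite conjg1 inE (cover_mul cov Gy) //; first by move: (outN _ 1 Gg ng fixg (group1 G)); rewrite conjg1.
    by move: (outN _ 1 Gk nk fixk (group1 G)); rewrite conjg1.
  have g2 : g * g = 1 by apply: uniqg.
  have Gy' : y \in G by case/setD1P: Gy.
  have gy : g * g ^ y = 1.
    apply: uniqg; rewrite ?groupJ ?conjg_eq1 // => _ /imsetP[h Gh ->].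
    have Dy : (C y :^ h) :^ y^-1 \in (C y : {set gT}) :^: G.
      by rewrite -conjsgM; apply: imset_f; rewrite groupM ?groupV.
    by rewrite conjgE !conjsgM fixg // conjsgKV.
  have cgy : g ^ y = g by apply: (mulgI g); rewrite gy g2.
  have gN := outN _ 1 Gg ng fixg (group1 G); rewrite conjg1 in gN.
  have yC := cover_id cov Gy.
  have : g * y \in 'N_G(C y) :\: C y.
    by case/setDP: gN => gN gC; rewrite inE groupMr // gC groupM // (subsetP (cover_subN cov Gy)).
  move/(cover_sq cov Gy); rewrite expgMn; last exact/commgP/conjg_fixP.
  rewrite (expgS g 1) expg1 g2 mul1g => y2.
  have oy3 : #[y] %| 3 by rewrite -y3 order_dvdG.
  have oy2 : #[y] %| 2 by rewrite order_dvdn y2.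
  have : #[y] %| gcdn 2 3 by rewrite dvdn_gcd oy2.
  by rewrite dvdn1 order_eq1; have [/negPf->] := setD1P Gy.
have sAll : f @* G \subset 'Sym_('I_4) by apply/subsetP=> s _; rewrite inE.
have -> : 'Sym_('I_4) = f @* G.
  by apply/eqP; rewrite eq_sym eqEcard sAll card_injm // card_Sym card_ord g24.
exact: sub_isog.
Qed.

(** A Sylow 2-subgroup P has order 4 and equals the normalizer of [C t] for each of its involutions
    t. So distinct Sylow 2-subgroups meet trivially, and the 15 involutions are spread over five of
    them. If g != 1 normalized all five, its whole class, of at least 15 elements, would lie in the
    normalizer of P, which has order 12. The 44 elements of order 3 or 5 make the image even. *)
Lemma icosa_Alt : #|G| = 60 -> forall x y z, x \in G^# -> y \in G^# -> z \in G^# ->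
  #|C x| = 2 -> #|C y| = 3 -> #|C z| = 5 ->
  C x != 'N_G(C x) :> {set gT} -> C y != 'N_G(C y) :> {set gT} ->
  C z != 'N_G(C z) :> {set gT} ->
  G^# \subset cclass G C x :|: cclass G C y :|: cclass G C z ->
  G \isog 'Alt_('I_5).
Proof.
move=> g60 x y z Gx Gy Gz x2 y3 z5 Nx Ny Nz sG.
have ox : cindex G C x = 15 by have := cindexE cov Gx; rewrite Nx x2 g60 /=; lia.
have oy : cindex G C y = 10 by have := cindexE cov Gy; rewrite Ny y3 g60 /=; lia.
have oz : cindex G C z = 6 by have := cindexE cov Gz; rewrite Nz z5 g60 /=; lia.
have ux : #|cclass G C x| = 15 by rewrite card_cclass // x2 ox.
have uy : #|cclass G C y| = 20 by rewrite card_cclass // y3 oy.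
have uz : #|cclass G C z| = 24 by rewrite card_cclass // z5 oz.
have pr t : t \in G^# -> prime #|C t| /\ 15 <= #|cclass G C t|.
  move=> Gt; have cl s : s \in G^# -> t \in cclass G C s ->
      #|C t| = #|C s| /\ #|cclass G C t| = #|cclass G C s|.
    move=> Gs st; rewrite !card_cclass //.
    by rewrite (cclass_index Gs st) (cclass_card cov Gs st).
  by have := subsetP sG t Gt; rewrite !inE => /orP[/orP[]|] /cl[] // -> ->;
     rewrite ?x2 ?y3 ?z5 ?ux ?uy ?uz.
have [P sylP] := Sylow_exists 2 G.
have sPG := pHall_sub sylP.
have P4 : #|P| = 4.
  by rewrite (card_Hall sylP) g60 (_ : 60 = 4 * 15)%N // p_part lognM // (@lognX 2 2).
have inv t : t \in P^# -> t \in cclass G C x.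
  move=> Pt; have Gt := subsetP (setSD 1 sPG) t Pt; have [nt P't] := setD1P Pt.
  have := order_dvdG P't; rewrite P4.
  have := subsetP sG t Gt; rewrite !inE => /orP[/orP[//|]|] /cclass_order ->;
    by rewrite ?y3 ?z5.
have PN t : t \in P^# -> P :=: 'N_G(C t).
  move=> Pt; have Gt := subsetP (setSD 1 sPG) t Pt.
  have xt := inv t Pt; have ct := cclass_card cov Gx xt.
  have ot := cclass_order Gx (proj1 (pr x Gx)) xt.
  have eC : C t :=: <[t]>.
    by apply/eqP; rewrite eq_sym eqEcard cycle_subG (cover_id cov Gt) /= ct -ot.
  have NC : #|'N_G(C t)| = 4.
    have := cover_ratio cov Gt; rewrite ct x2 => ->.
    have := cindexE cov Gt; rewrite ct x2 g60.
    by rewrite (cclass_index Gx xt) ox; case: (_ != _).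
  apply/eqP; rewrite eqEcard NC P4 andbT subsetI sPG eC cents_norm //.
  have aP : abelian P by apply: (@card_p2group_abelian _ 2).
  by rewrite (subset_trans aP) // centS // cycle_subG; case/setD1P: Pt.
have P3 : #|P^#| = 3 by have := cardsD1 1 P; rewrite group1 P4 add1n => -[->].
have tiP : normedTI P^# G 'N_G(P).
  apply/normedTI_P; split.
  - by rewrite -card_gt0 P3.
  - by apply/subsetP=> g /setIP[Gg ng]; rewrite inE Gg normD1.
  move=> g Gg /pred0Pn[t /andP[/= Pt Ptg]]; rewrite inE Gg; apply/normP.
  have Ptg' : t ^ g^-1 \in P^# by rewrite -mem_conjg.
  have Gt' := subsetP (setSD 1 sPG) _ Ptg'.
  rewrite {1}(PN _ Ptg') conjIg conjGid // -normJ -(cover_conj cov Gt' Gg) conjgKV.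
  by rewrite [RHS](PN t Pt).
have supP : class_support P^# G = cclass G C x.
  apply/eqP; rewrite eqEsubset; apply/andP; split.
    rewrite class_supportEr; apply/bigcupsP=> g Gg.
    by rewrite /cclass -(class_supportGidr (C x)^# Gg) conjSg; apply/subsetP.
  rewrite /cclass class_supportEr; apply/bigcupsP=> g Gg; rewrite class_supportEr.
  have p2C : 2.-group (C x) by rewrite /pgroup x2.
  have [h Gh sub] := Sylow_subJ sylP (cover_sub cov Gx) p2C.
  rewrite (bigcup_max (h * g)) ?groupM // conjsgM conjSg conjD1g setSD //.
have cD : #|(P : {set gT}) :^: G| = 5.
  have := card_support_normedTI tiP; rewrite supP ux card_conjugates P3.
  by move/eqP; rewrite (eqn_pmul2l (n1 := 5) (m := 3)) // => /eqP.
have NP : #|'N_G(P)| = 12.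
  apply/eqP; rewrite -(eqn_pmul2r (m := 5)) // -{1}cD card_conjugates.
  by rewrite Lagrange ?subsetIl // g60.
have [f injf] : exists f : {morphism G >-> {perm 'I_5}}, 'injm f.
  apply: (conj_embed cD) => [_ g /imsetP[h Gh ->] Gg|g Gg fixg].
    by rewrite -conjsgM; apply: imset_f; rewrite groupM.
  apply/eqP; apply: contraT => ng.
  have Gg' : g \in G^# by rewrite !inE ng.
  have [prg] := pr g Gg'; rewrite leqNgt => /negP[].
  have : #|'N_G(P)| < 15 by rewrite NP.
  apply: leq_ltn_trans; apply: subset_leq_card.
  have eC : C g :=: <[g]>.
    apply/eqP; rewrite eq_sym eqEcard cycle_subG (cover_id cov Gg') /=.
    by rewrite -(cclass_order Gg' prg (cclass_id cov Gg')).
  apply/subsetP=> w wg; have Gw := subsetP (cclass_sub cov Gg') w wg.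
  case/imset2P: wg => t k; rewrite eC => /setD1P[_ /cycleP[i ->]] Gk ->.
  rewrite inE groupJ ?groupX //=; apply/normP.
  have DP h : h \in G -> (P :^ h) :^ g = P :^ h by move=> Gh; apply/fixg/imset_f.
  have DPi : (P :^ k^-1) :^ (g ^+ i) = P :^ k^-1.
    elim: i => [|i IH]; first by rewrite expg0 conjsg1.
    by rewrite expgSr conjsgM IH DP ?groupV.
  by rewrite conjgE !conjsgM DPi conjsgKV.
have sAlt : f @* G \subset 'Alt_('I_5).
  apply: (@morphim_Alt _ _ _ _ (cclass G C y :|: cclass G C z)).
  - by rewrite subUset !(subset_trans (cclass_sub cov _)) ?subD1set.
  - have yz : z \notin cclass G C y.
      by apply/negP=> /(cclass_card cov Gy); rewrite y3 z5.
    by rewrite cardsU (disjoint_setI0 (cclass_disjoint cov Gy Gz yz)) cards0 uy uz g60.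
  by move=> t; rewrite !inE => /orP[] /cclass_order ->; rewrite ?y3 ?z5.
have cA : #|'Alt_('I_5)| = 60.
  have := card_Alt (T := 'I_5); rewrite card_ord => /(_ isT).
  by move=> c; apply/eqP; rewrite -(eqn_pmul2l (m := 2)) // c.
have -> : 'Alt_('I_5) = f @* G.
  by apply/eqP; rewrite eq_sym eqEcard sAlt card_injm // cA g60.
exact: sub_isog.
Qed.

End Exotic.

(** * Cyclic, dihedral or exceptional *)

Section CoverTypes.
Variables (gT : finGroupType) (G : {group gT}) (C : gT -> {group gT}).
Hypothesis cov : fix_cover G C.

Definition has_rotation_subgroup :=
  exists K : {group gT}, [/\ K \subset G, cyclic K, (2 * #|K|)%N = #|G| &
    {in G :\: K, forall y, y ^+ 2 = 1}].

(** The bounds on orders and, for the octahedron, the rotation swapping the fixed points of x are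
    kept beside the isomorphism because the realizations use them to exclude these groups or to tell
    them apart. *)
Definition tetrahedral := G \isog 'Alt_('I_4) /\ {in G, forall x, #[x] <= 3}.

Definition octahedral :=
  [/\ G \isog 'Sym_('I_4), {in G, forall x, #[x] <= 4} &
      exists x y, [/\ x \in G^#, #|C x| = 3 & y \in 'N_G(C x) :\: C x]].

Definition icosahedral :=
  G \isog 'Alt_('I_5) /\ {in G, forall x, #[x] \in [:: 1; 2; 3; 5]%N}.

Definition exotic := [\/ tetrahedral, octahedral | icosahedral].

Lemma order_cover (s : seq nat) : 1%N \in s ->
  {in G^#, forall x, {subset divisors #|C x| <= s}} -> {in G, forall x, #[x] \in s}.
Proof.
move=> s1 sC x Gx; have [-> | nx] := eqVneq x 1; first by rewrite order1.
have Gx' : x \in G^# by rewrite !inE nx.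
by apply: (sC x Gx'); rewrite -dvdn_divisors ?cardG_gt0 // order_dvdG // (cover_id cov).
Qed.

Lemma classes_order (s : seq nat) (A : {set gT}) : G^# \subset A ->
  {in A, forall x, x \in G^# -> {subset divisors #|C x| <= s}} ->
  1%N \in s -> {in G, forall x, #[x] \in s}.
Proof. by move=> sA sC s1; apply: (order_cover s1) => x Gx; apply: (sC x (subsetP sA x Gx) Gx). Qed.

Theorem cover_classification :
  [\/ cyclic G, has_rotation_subgroup | exotic].
Proof.
have [G1 | ntG] := eqVneq (G : {set gT}) 1; first by constructor 1; rewrite G1 cyclic1.
have ncard x y : x \in G^# -> y \in cclass G C x -> #|C y| = #|C x| by move=> Gx; apply: cclass_card.
case: (cover_classes cov ntG) => [[x Gx cx] | [x Gx cx] | [g12 [x [y [Gx Gy [x3 y2 Nx sG]]]]] |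
  [x [y [z [Gx Gy Gz [x2 y3 zG [Nx Ny Nz] sG]]]]]].
- constructor 1; suff <- : C x :=: G by apply: (cover_cyclic cov).
  by apply/eqP; rewrite eqEcard (cover_sub cov) // cx leqnn.
- constructor 2; exists (C x); split; [exact: cover_sub Gx | exact: cover_cyclic Gx | by [] |].
  move=> y /setDP[Gy nCy]; apply: (cover_sq cov Gx).
  rewrite inE nCy inE Gy /=; apply: (subsetP (normal_norm _)) Gy.
  have sC := cover_sub cov Gx; apply: index2_normal => //.
  by apply/eqP; rewrite -(eqn_pmul2l (cardG_gt0 (C x))) Lagrange // -cx mulnC.
- constructor 3; constructor 1; split; first exact: (tetra_Alt cov g12 Gx).
  move=> t Gt; suff : #[t] \in [:: 1; 2; 3]%N by rewrite !inE => /or3P[]/eqP->.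
  apply: (classes_order sG _ _ Gt) => //.
  by move=> u; rewrite inE => /orP[] /ncard e _; rewrite e // ?x3 ?y2 => k; rewrite !inE => /orP[]/eqP->.
- case: zG => [[g24 z4] | [g60 z5]].
    constructor 3; constructor 2; split; first exact: (octa_Sym cov g24 Gy).
      move=> t Gt; suff : #[t] \in [:: 1; 2; 3; 4]%N by rewrite !inE => /or4P[]/eqP->.
      apply: (classes_order sG _ _ Gt) => //.
      move=> u; rewrite !inE => /orP[/orP[]|] /ncard e _; rewrite e // ?x2 ?y3 ?z4 => k;
        rewrite !inE; by do ?case/orP; move/eqP->.
    have /properP[_ [t Nt Ct]] : C y \proper 'N_G(C y) by rewrite properEneq Ny (cover_subN cov).
    by exists y, t; split=> //; rewrite inE Ct.
  constructor 3; constructor 3; split; first exact: (icosa_Alt cov g60 Gx Gy Gz).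
  apply: (classes_order sG) => //.
  move=> t; rewrite !inE => /orP[/orP[]|] /ncard e _; rewrite e // ?x2 ?y3 ?z5 => k;
    rewrite !inE; by do ?case/orP; move/eqP->.
Qed.

(** The congruence says that 2^m is the exact power of 2 dividing |G|, so a cyclic Sylow 2-subgroup
    would contain an element of that order. *)
Lemma noncyclic_2subgroup m : #|G| %% 2 ^ m.+1 = (2 ^ m)%N -> {in G, forall x, #[x] != (2 ^ m)%N} ->
  exists P : {group gT}, [/\ P \subset G, 2.-group P & ~~ cyclic P].
Proof.
move=> gm no; have [P sylP] := Sylow_exists 2 G; exists P; split.
- exact: pHall_sub sylP.
- exact: pHall_pgroup sylP.
have oP : #|P| = (2 ^ m)%N.
  rewrite (card_Hall sylP) p_part; congr (2 ^ _)%N.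
  have e : #|G| = (2 ^ m * ((#|G| %/ 2 ^ m.+1).*2.+1))%N.
    by rewrite {1}(divn_eq #|G| (2 ^ m.+1)%N) gm expnS; lia.
  rewrite e lognM ?expn_gt0 // (pfactorK m) // logn_coprime ?addn0 //.
  by rewrite coprime2n /= odd_double.
apply/negP=> /cyclicP[x ex]; have Px : x \in P by rewrite ex cycle_id.
have := no x (subsetP (pHall_sub sylP) x Px).
by rewrite -oP ex eqxx.
Qed.

Lemma exotic_2subgroup : exotic ->
  exists P : {group gT}, [/\ P \subset G, 2.-group P & ~~ cyclic P].
Proof.
have c4 : #|'Alt_('I_4)| = 12.
  have := card_Alt (T := 'I_4); rewrite card_ord => /(_ isT) c.
  by apply/eqP; rewrite -(eqn_pmul2l (m := 2)) // c.
have c5 : #|'Alt_('I_5)| = 60.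
  have := card_Alt (T := 'I_5); rewrite card_ord => /(_ isT) c.
  by apply/eqP; rewrite -(eqn_pmul2l (m := 2)) // c.
case=> [[i o] | [i o _] | [i o]].
- apply: (@noncyclic_2subgroup 2); first by rewrite (card_isog i) c4.
  by move=> x /o; apply: contraTneq => ->.
- apply: (@noncyclic_2subgroup 3); first by rewrite (card_isog i) card_Sym card_ord.
  by move=> x /o; apply: contraTneq => ->.
apply: (@noncyclic_2subgroup 2); first by rewrite (card_isog i) c5.
by move=> x /o; apply: contraTneq => ->.
Qed.

End CoverTypes.

(** * Group isomorphisms and presentations *)

(** A relation is convenient here because both directions of the correspondence between Lie
    automorphisms and permutations are existence statements. *)
Lemma group_iso_of_rel (L H : groupType) (rho : L -> H -> Prop) :
  (forall x, exists s, rho x s) -> (forall s, exists x, rho x s) ->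
  (forall x s t, rho x s -> rho x t -> s = t) ->
  (forall x y s, rho x s -> rho y s -> x = y) ->
  (forall x y s t, rho x s -> rho y t -> rho (x * y) (s * t)) ->
  group_iso L H.
Proof.
move=> totl totr fun_ inj mul.
pose f x := projT1 (cid (totl x)); have fP x : rho x (f x) by rewrite /f; case: cid.
pose g s := projT1 (cid (totr s)); have gP s : rho (g s) s by rewrite /g; case: cid.
have fM : {morph f : x y / x * y} by move=> x y; apply: fun_ (fP _) (mul _ _ _ _ (fP x) (fP y)).
pose fm := isMultiplicative.Build L H f fM.
pose F : {multiplicative L -> H} := HB.pack f fm.
by exists F; exists g => [x|s]; [apply: inj (gP _) (fP x) | apply: fun_ (fP _) (gP s)].
Qed.

Lemma group_iso_isog (L : groupType) (gT rT : finGroupType) (H : {group gT}) (K : {group rT}) :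
  group_iso L [subg H]%type -> H \isog K -> group_iso L [subg K]%type.
Proof.
case=> f [g fK gK] /isogP[h injh hH].
have hP x : x \in H -> h x \in K by move=> Hx; rewrite -hH mem_morphim.
apply: (group_iso_of_rel (rho := fun (x : L) (k : [subg K]%type) => sgval k = h (sgval (f x)))).
- move=> x; have Kx := hP _ (subgP (f x)).
  by exists (subg K (h (sgval (f x)))); rewrite subgK.
- move=> k; have := subgP k; rewrite -{1}hH => /morphimP[u _ Hu e].
  by exists (g (subg H u)); rewrite gK subgK.
- by move=> x s t e1 e2; apply: val_inj; rewrite /= e1 -e2.
- move=> x y s e1; rewrite e1 => /(injmP injh) e.
  by apply: (can_inj fK); apply: val_inj; apply: e; apply: subgP.
move=> x y s t e1 e2; rewrite gmulfM /= -[RHS]/(h (sgval (f x) * sgval (f y))).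
by rewrite morphM ?subgP // -e1 -e2.
Qed.

Lemma isoGrp_cyclic (gT : finGroupType) (H : {group gT}) : cyclic H ->
  H \isog Grp (s : s ^+ #|H|).
Proof.
case/cyclicP=> x Hx; apply: intro_isoGrp => [|rT K].
  by apply/existsP; exists x; rewrite /= !xpair_eqE /= -Hx eqxx Hx expg_order eqxx.
case/existsP=> y /=; rewrite !xpair_eqE /= => /andP[/eqP <-]; rewrite {1}Hx -orderE -order_dvdn => dv.
by rewrite Hx -(im_eltm dv) morphim_homg.
Qed.

Lemma isoGrp_dihedral (gT : finGroupType) (H : {group gT}) (x y : gT) :
  H :=: <[x]> <*> <[y]> -> y ^+ 2 = 1 -> y * x * y = x^-1 -> #|H| = (2 * #[x])%N ->
  H \isog Grp (s : t : s ^+ #[x], t ^+ 2, t * s * t = s^-1).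
Proof.
move=> defH y2 yxy cH.
(* For order one, D_1 is cyclic of order 2; otherwise the comparison is with ['D_(#[x].*2)], whose
   relation x ^ y = x^-1 reads y x y = x^-1 since y^2 = 1. *)
have [x1 | x1] := leqP #[x] 1.
  have {}x1 : x = 1 by apply/eqP; rewrite -order_eq1 eqn_leq x1 order_gt0.
  rewrite x1 order1 in cH *.
  have Hy : H :=: <[y]> by rewrite defH x1 cycle1 joing1G.
  have cyH : cyclic H by rewrite Hy cycle_cyclic.
  move=> rT K; have := isoGrp_cyclic cyH; rewrite cH => -> /=.
  apply/existsP/existsP => [[v]|[[u v]]] /=; rewrite !xpair_eqE /=.
    case/andP=> /eqP <- /eqP v2; exists (1, v); rewrite !xpair_eqE /=.
    by rewrite cycle1 joing1G expg1n mulg1 invg1 -(expgS v 1) v2 !eqxx.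
  case/and4P=> /eqP <- /eqP; rewrite expg1 => -> v2 _; exists v.
  by rewrite !xpair_eqE /= cycle1 joing1G eqxx.
have rel (rT : finGroupType) (u v : rT) : v ^+ 2 = 1 -> (v * u * v == u^-1) = (u ^ v == u^-1).
  by rewrite expgS expg1 => v2; rewrite conjgE (_ : v^-1 = v) ?mulgA //; apply/eqP; rewrite eq_invg_mul v2.
have eqG : forall rT (K : {group rT}), (K \homg 'D_(#[x].*2)) =
    (K \homg Grp (s : t : s ^+ #[x], t ^+ 2, t * s * t = s^-1)).
  move=> rT K; rewrite (Grp_dihedral x1); apply: eq_existsb => -[u v] /=.
  rewrite !xpair_eqE /=; congr (_ && _); apply: andb_id2l => _.
  by apply: andb_id2l => /eqP v2; rewrite rel.
have isoH : H \isog 'D_(#[x].*2).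
  rewrite isogEcard eqG card_dihedral // cH mul2n leqnn andbT.
  apply/existsP; exists (x, y); rewrite /= !xpair_eqE /= -defH expg_order y2 yxy.
  by rewrite !eqxx.
by move=> rT K; rewrite -eqG; apply: eq_homgr.
Qed.

Lemma cyclic_iso_cyclic (L : groupType) (gT : finGroupType) (H : {group gT}) :
  group_iso L [subg H]%type -> cyclic H -> iso_cyclic L #|H|.
Proof. by move=> iL cH; exists gT, H; split=> //; apply: isoGrp_cyclic. Qed.

Lemma rotation_iso_dihedral (L : groupType) (gT : finGroupType) (H K : {group gT}) :
  group_iso L [subg H]%type -> K \subset H -> cyclic K -> (2 * #|K|)%N = #|H| ->
  {in H :\: K, forall y, y ^+ 2 = 1} -> iso_dihedral L #|K|.
Proof.
move=> iL sKH /cyclicP[x Kx] cH inv; exists gT, H; split=> //.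
have ltKH : #|K| < #|H| by rewrite -cH mul2n -addnn -{1}[#|K|]add0n ltn_add2r cardG_gt0.
have [y Hy Ky] : exists2 y, y \in H & y \notin K.
  by apply/subsetPn; apply: contraL ltKH => /subset_leq_card; rewrite leqNgt.
have xK : x \in K by rewrite Kx cycle_id.
have y2 : y ^+ 2 = 1 by apply: inv; rewrite inE Ky.
(* With y, also y x lies outside K, and (y x)^2 = 1 is the missing relation. *)
have : (y * x) ^+ 2 = 1 by apply: inv; rewrite inE groupMr ?Ky ?groupM // (subsetP sKH).
rewrite expgS expg1 mulgA => /eqP; rewrite -eq_invg_mul => /eqP yxy.
rewrite Kx -orderE; apply: (isoGrp_dihedral (y := y)) => //.
- apply/eqP; rewrite eq_sym eqEcard join_subG !cycle_subG Hy (subsetP sKH) //= -cH.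
  rewrite mulnC Kx -(Lagrange (joing_subl <[x]> <[y]>)) leq_pmul2l ?cardG_gt0 // indexg_gt1.
  by apply: contra Ky => /subsetP; rewrite Kx; apply; rewrite mem_gen // inE cycle_id orbT.
- by rewrite -[LHS]invgK yxy.
by rewrite -cH Kx.
Qed.
Local Close Scope group_scope.
Local Open Scope ring_scope.

(** * Moebius maps *)

Section Moebius.
Variable K : numClosedFieldType.
Implicit Types (a b c d z w : K) (p q r : option K) (f g : option K -> option K).

(* The point [u : v] of the projective line, [None] being the point at infinity. *)
Definition proj_point (u v : K) : option K := if v == 0 then None else Some (u / v).

Definition mob a b c d p : option K :=
  if p is Some z then proj_point (a * z + b) (c * z + d) else proj_point a c.

Lemma proj_pointZ k u v : k != 0 -> proj_point (k * u) (k * v) = proj_point u v.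
Proof.
move=> k0; rewrite /proj_point mulf_eq0 (negPf k0) /=; case: eqP => // /eqP v0.
by congr Some; field; rewrite k0 v0.
Qed.

Lemma mob_proj a b c d u v : (u != 0) || (v != 0) ->
  mob a b c d (proj_point u v) = proj_point (a * u + b * v) (c * u + d * v).
Proof.
rewrite {1}/proj_point; have [-> | v0 _] := eqVneq v 0.
  by rewrite orbF => u0 /=; rewrite !mulr0 !addr0 ![_ * u]mulrC proj_pointZ.
by rewrite /= -(proj_pointZ _ _ v0); congr proj_point; field.
Qed.

Lemma mob_nz a b c d z : a * d != b * c -> (a * z + b != 0) || (c * z + d != 0).
Proof.
apply: contraR; rewrite negb_or !negbK => /andP[/eqP h1 /eqP h2].
have -> : b = - (a * z) by apply/eqP; rewrite -addr_eq0 addrC h1.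
have -> : d = - (c * z) by apply/eqP; rewrite -addr_eq0 addrC h2.
by apply/eqP; ring.
Qed.

Lemma mob_nz_oo a b c d : a * d != b * c -> (a != 0) || (c != 0).
Proof.
by apply: contraR; rewrite negb_or !negbK => /andP[/eqP-> /eqP->]; rewrite mul0r mulr0.
Qed.

Lemma mob_comp a b c d a' b' c' d' p : a' * d' != b' * c' ->
  mob a b c d (mob a' b' c' d' p) =
  mob (a * a' + b * c') (a * b' + b * d') (c * a' + d * c') (c * b' + d * d') p.
Proof.
move=> nz; case: p => [z|] /=; rewrite mob_proj ?mob_nz ?(mob_nz_oo nz) //.
by congr proj_point; ring.
Qed.

Lemma mob_scalar k p : k != 0 -> mob k 0 0 k p = p.
Proof.
move=> k0; case: p => [z|] /=; rewrite /proj_point ?eqxx //.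
by rewrite mul0r add0r (negPf k0) addr0; congr Some; field.
Qed.

Definition moebius f := exists a b c d, a * d != b * c /\ f =1 mob a b c d.

Lemma moebius_mob a b c d : a * d != b * c -> moebius (mob a b c d).
Proof. by move=> nz; exists a, b, c, d. Qed.

Lemma eq_moebius f g : f =1 g -> moebius f -> moebius g.
Proof.
by move=> fg [a [b [c [d [nz E]]]]]; exists a, b, c, d; split=> // x; rewrite -fg.
Qed.

Lemma moebius_id : moebius id.
Proof.
exists 1, 0, 0, 1; split; first by rewrite mulr1 mulr0 oner_neq0.
by move=> x; rewrite mob_scalar ?oner_neq0.
Qed.

Lemma moebius_comp f g : moebius f -> moebius g -> moebius (f \o g).
Proof.
move=> [a [b [c [d [nz E]]]]] [a' [b' [c' [d' [nz' E']]]]].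
do 4 eexists; split; last by move=> p; rewrite /= E E' mob_comp.
suff -> : (a * a' + b * c') * (c * b' + d * d') == (a * b' + b * d') * (c * a' + d * c')
  = ((a * d - b * c) * (a' * d' - b' * c') == 0).
  by rewrite mulf_eq0 !subr_eq0 negb_or nz.
by rewrite -subr_eq0; congr (_ == 0); ring.
Qed.

Lemma mobK a b c d : a * d != b * c -> cancel (mob a b c d) (mob d (- b) (- c) a).
Proof.
move=> nz p; rewrite mob_comp // -{2}(@mob_scalar (a * d - b * c) p) ?subr_eq0 //.
by congr mob; ring.
Qed.

Lemma moebius_inv f : moebius f -> exists g, [/\ moebius g, cancel f g & cancel g f].
Proof.
move=> [a [b [c [d [nz E]]]]]; have nz' : d * a != - b * - c by rewrite mulrNN mulrC.
exists (mob d (- b) (- c) a); split; first exact: moebius_mob.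
  by move=> p; rewrite E mobK.
by move=> p; rewrite E; have := mobK nz' p; rewrite !opprK.
Qed.

Lemma moebius_inj f : moebius f -> injective f.
Proof. by case/moebius_inv=> g [_ fK _]; apply: can_inj fK. Qed.

(** The chart w -> 1 / (w - p) and its inverse; in this chart a map fixing p becomes affine. *)
Definition to_oo p : option K -> option K := if p is Some z then mob 0 1 1 (- z) else id.
Definition of_oo p : option K -> option K := if p is Some z then mob z 1 1 0 else id.

Lemma to_ooP p : [/\ moebius (to_oo p), moebius (of_oo p), cancel (to_oo p) (of_oo p),
  cancel (of_oo p) (to_oo p) & to_oo p p = None].
Proof.
case: p => [z|] /=; last by split=> //; apply: moebius_id.
have nz1 : 0 * (- z) != 1 * 1 :> K by rewrite mul0r mulr1 eq_sym oner_neq0.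
have nz2 : z * 0 != 1 * 1 :> K by rewrite mulr0 mulr1 eq_sym oner_neq0.
split; [exact: moebius_mob | exact: moebius_mob | | |].
- move=> p; rewrite mob_comp //.
  by rewrite -{2}(@mob_scalar 1 p) ?oner_neq0 //; congr mob; ring.
- move=> p; rewrite mob_comp //.
  by rewrite -{2}(@mob_scalar 1 p) ?oner_neq0 //; congr mob; ring.
by rewrite /proj_point mul1r subrr eqxx.
Qed.

Lemma moebius_affine f : moebius f -> f None = None ->
  exists k l, k != 0 /\ forall z, f (Some z) = Some (k * z + l).
Proof.
move=> [a [b [c [d [nz E]]]]]; rewrite E /= /proj_point; case: eqP => // c0 _.
rewrite c0 mulr0 mulf_eq0 negb_or in nz; have /andP[a0 d0] := nz.
exists (a / d), (b / d); split; first by rewrite mulf_neq0 ?invr_neq0.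
move=> z; rewrite E /= /proj_point c0 mul0r add0r (negPf d0); congr Some.
by field.
Qed.

Lemma moebius_conj f p : moebius f -> f p = p ->
  exists k l, k != 0 /\ forall z, to_oo p (f (of_oo p (Some z))) = Some (k * z + l).
Proof.
move=> mf fp; have [mt mo tK oK tp] := to_ooP p.
apply: (@moebius_affine (to_oo p \o (f \o of_oo p))).
  by apply: moebius_comp mt (moebius_comp mf mo).
by rewrite /= -tp tK fp tp.
Qed.

Lemma to_oo_fin p q : q != p -> exists z, to_oo p q = Some z.
Proof.
have [mt mo tK oK tp] := to_ooP p => qp.
case e: (to_oo p q) => [z|]; first by exists z.
by case/eqP: qp; apply: (can_inj tK); rewrite e tp.
Qed.

(** With p moved to infinity, f is affine, and an affine map with two fixed points is the
    identity. *)
Lemma moebius_fix3 f p q r : moebius f -> p != q -> p != r -> q != r ->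
  f p = p -> f q = q -> f r = r -> f =1 id.
Proof.
move=> mf pq pr qr fp fq fr; have [mt mo tK oK tp] := to_ooP p.
have [k [l [k0 E]]] := moebius_conj mf fp.
have [z ez] : exists z, to_oo p q = Some z by apply: to_oo_fin; rewrite eq_sym.
have [w ew] : exists w, to_oo p r = Some w by apply: to_oo_fin; rewrite eq_sym.
have zw : z - w != 0.
  by rewrite subr_eq0; apply: contra qr => /eqP zw; rewrite -(inj_eq (can_inj tK)) ez ew zw.
have [ez'] : Some (k * z + l) = Some z by rewrite -E -ez tK fq ez.
have [ew'] : Some (k * w + l) = Some w by rewrite -E -ew tK fr ew.
have k1 : k = 1 by apply: (mulIf zw); rewrite mul1r -{2}ez' -{2}ew'; ring.
have l0 : l = 0 by rewrite -[RHS](subrr z) -{1}ez' k1; ring.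
move=> x; apply: (can_inj tK); rewrite -{1}(tK x).
case: (to_oo p x) => [y|]; first by rewrite E k1 l0 mul1r addr0.
by rewrite -tp tK fp.
Qed.

Lemma moebius_eq3 f g p q r : moebius f -> moebius g -> p != q -> p != r -> q != r ->
  f p = g p -> f q = g q -> f r = g r -> f =1 g.
Proof.
move=> mf mg pq pr qr ep eq er; have [h [mh gK hK]] := moebius_inv mg.
have E : h \o f =1 id.
  by apply: (moebius_fix3 (moebius_comp mh mf) pq pr qr) => /=; rewrite ?ep ?eq ?er gK.
by move=> x; rewrite -{1}(hK (f x)) -[h (f x)]/((h \o f) x) E.
Qed.

Lemma moebius_fixpoint f : moebius f -> exists p, f p = p.
Proof.
move=> [a [b [c [d [nz E]]]]].
have [c0|c0] := eqVneq c 0; first by exists None; rewrite E /= /proj_point c0 eqxx.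
(* A finite fixed point is a root of c z^2 + (d - a) z - b. *)
have [z /eqP ez] := solve_monicpoly (n := 2) (fun i => if i == 0 then b / c else (a - d) / c) isT.
have ez' : c * z ^+ 2 = b + (a - d) * z.
  by move/eqP: ez; rewrite !big_ord_recr big_ord0 /= => ->; field.
have nzd : c * z + d != 0.
  have := mob_nz z nz; case: (eqVneq (c * z + d) 0) => //= e; rewrite orbF.
  have ed : d = - (c * z) by apply/eqP; rewrite -addr_eq0 addrC e.
  have eb : b = c * z ^+ 2 - (a - d) * z by rewrite ez'; ring.
  by move/negP; case; rewrite eb ed; apply/eqP; ring.
exists (Some z); rewrite E /= /proj_point (negPf nzd); congr Some.
apply: (mulIf nzd); rewrite divfK //.
have -> : z * (c * z + d) = c * z ^+ 2 + d * z by ring.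
by rewrite ez'; ring.
Qed.

Lemma moebius_fix2 f p n : moebius f -> f p = p -> (0 < n)%N -> iter n f =1 id ->
  ~ f =1 id -> exists2 q, q != p & forall x, f x = x <-> x = p \/ x = q.
Proof.
move=> mf fp n0 fn nid; have [mt mo tK oK tp] := to_ooP p.
have [k [l [k0 E]]] := moebius_conj mf fp.
have fE z : f (of_oo p (Some z)) = of_oo p (Some (k * z + l)) by rewrite -E tK.
(* Otherwise f is the translation by l, whose m-th iterate moves 0 to m l; finite order then gives l
   = 0. *)
have k1 : k != 1.
  apply/eqP=> k1; have it m : iter m f (of_oo p (Some 0)) = of_oo p (Some (m%:R * l)).
    elim: m => [|m IH]; first by rewrite mul0r.
    by rewrite iterS IH fE k1; congr (of_oo p (Some _)); rewrite -natr1; ring.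
  have := fn (of_oo p (Some 0)); rewrite it => /(can_inj oK) [/eqP].
  rewrite mulf_eq0 pnatr_eq0 -leqn0 leqNgt n0 /= => /eqP l0; case: nid => x.
  apply: (can_inj tK); rewrite -{1}(tK x); case: (to_oo p x) => [y|].
    by rewrite E k1 l0 mul1r addr0.
  by rewrite -tp tK fp.
have k1' : 1 - k != 0 by rewrite subr_eq0 eq_sym.
pose q := of_oo p (Some (l / (1 - k))).
have fq : f q = q by rewrite fE; congr (of_oo p (Some _)); field.
have qp : q != p by apply/eqP=> /(congr1 (to_oo p)); rewrite oK tp.
exists q => // x; split=> [fx | [->|->] //].
have [->|xp] := eqVneq x p; first by left.
have [->|xq] := eqVneq x q; first by right.
by case: nid; apply: (moebius_fix3 mf qp _ _ fq fp fx); rewrite eq_sym.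
Qed.

(** f has a fixed point, necessarily different from p and q, so f o f fixes three points. *)
Lemma moebius_swap f p q : moebius f -> p != q -> f p = q -> f q = p -> f \o f =1 id.
Proof.
move=> mf pq fp fq; have [r fr] := moebius_fixpoint mf.
have rp : p != r by apply: contraNneq pq => e; rewrite -fp e fr.
have rq : q != r by apply: contraNneq pq => e; rewrite -fq e fr.
by apply: (moebius_fix3 (moebius_comp mf mf) pq rp rq); rewrite /= ?fp ?fq ?fr.
Qed.

(* The linear coefficient of the affine map obtained by moving the fixed point [p] to
   infinity. *)
Definition multiplier p f :=
  odflt 0 (to_oo p (f (of_oo p (Some 1)))) - odflt 0 (to_oo p (f (of_oo p (Some 0)))).

Lemma multiplierP p f : moebius f -> f p = p -> exists l,
  forall z, f (of_oo p (Some z)) = of_oo p (Some (multiplier p f * z + l)).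
Proof.
move=> mf fp; have [mt mo tK oK tp] := to_ooP p.
have [k [l [k0 E]]] := moebius_conj mf fp; exists l => z.
by rewrite -[LHS]tK /multiplier !E /=; congr (of_oo p (Some _)); ring.
Qed.

Lemma multiplierM p f g : moebius f -> moebius g -> f p = p -> g p = p ->
  multiplier p (f \o g) = multiplier p f * multiplier p g.
Proof.
move=> mf mg fp gp; have [mt mo tK oK tp] := to_ooP p.
have [l E] := multiplierP mf fp; have [m F] := multiplierP mg gp.
by rewrite {1}/multiplier /= !F !E !oK /=; ring.
Qed.

Lemma multiplier1 p f n : moebius f -> f p = p -> (0 < n)%N -> iter n f =1 id ->
  multiplier p f = 1 -> f =1 id.
Proof.
move=> mf fp n0 fn m1; have [mt mo tK oK tp] := to_ooP p.
have [l E] := multiplierP mf fp; move: E; rewrite m1 => E.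
have it m : iter m f (of_oo p (Some 0)) = of_oo p (Some (m%:R * l)).
  elim: m => [|m IH]; first by rewrite mul0r.
  by rewrite iterS IH E; congr (of_oo p (Some _)); rewrite -natr1; ring.
have := fn (of_oo p (Some 0)); rewrite it => /(can_inj oK) [/eqP].
rewrite mulf_eq0 pnatr_eq0 -leqn0 leqNgt n0 /= => /eqP l0 x.
rewrite -(tK x); case: (to_oo p x) => [y|]; first by rewrite E l0 mul1r addr0.
by rewrite -tp tK fp.
Qed.

Lemma multiplier_id p f : f =1 id -> multiplier p f = 1.
Proof.
by move=> E; have [mt mo tK oK tp] := to_ooP p; rewrite /multiplier !E !oK /= subr0.
Qed.

End Moebius.
Local Close Scope ring_scope.
Local Open Scope group_scope.

(** * Stabilizers of finite sets of points *)

Section Stabilizer.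
Variables (K : numClosedFieldType) (m : nat) (pts : 'I_m -> option K).
Hypotheses (pts_inj : injective pts) (m_gt2 : 2 < m).
Implicit Types (s t u : 'S_m) (f g : option K -> option K).

Definition realizes f s := moebius f /\ forall i, f (pts i) = pts (s i).

Definition mob_perms := [set s : 'S_m | `[< exists f, realizes f s >]].

Lemma realizes_uniq f g s : realizes f s -> realizes g s -> f =1 g.
Proof.
move=> [mf fs] [mg gs].
pose j k (hk : k < 3) : 'I_m := Ordinal (leq_trans hk m_gt2).
have ne k l hk hl : k != l -> pts (@j k hk) != pts (@j l hl).
  by rewrite (inj_eq pts_inj).
apply: (moebius_eq3 mf mg (ne 0 1 isT isT isT)%N (ne 0 2 isT isT isT)%N (ne 1 2 isT isT isT)%N);
  by rewrite fs gs.
Qed.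

Lemma realizesM f g s t : realizes f s -> realizes g t -> realizes (g \o f) (s * t).
Proof.
move=> [mf fs] [mg gs]; split; first exact: moebius_comp.
by move=> i; rewrite /= fs gs permM.
Qed.

Lemma realizes1 : realizes id 1.
Proof. by split=> [|i]; [apply: moebius_id | rewrite perm1]. Qed.

Lemma mob_perms_group_set : group_set mob_perms.
Proof.
apply/group_setP; split; first by rewrite inE; apply/asboolP; exists id; apply: realizes1.
move=> s t; rewrite !inE => /asboolP[f fs] /asboolP[g gt]; apply/asboolP.
by exists (g \o f); apply: realizesM.
Qed.
Canonical mob_perms_group := Group mob_perms_group_set.
Local Notation H := mob_perms_group.

Definition mob_of s : option K -> option K :=
  if pselect (exists f, realizes f s) is left e then projT1 (cid e) else id.

Lemma mob_ofP s : s \in H -> realizes (mob_of s) s.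
Proof.
rewrite inE => /asboolP e; rewrite /mob_of; case: pselect => // e'.
by case: (cid e').
Qed.

Lemma mob_of_moebius s : s \in H -> moebius (mob_of s).
Proof. by case/mob_ofP. Qed.

Lemma realizes_mob_of f s : realizes f s -> s \in H /\ f =1 mob_of s.
Proof.
move=> fs; have Hs : s \in H by rewrite inE; apply/asboolP; exists f.
by split=> //; apply: realizes_uniq fs (mob_ofP Hs).
Qed.

Lemma mob_ofM s t : s \in H -> t \in H -> mob_of (s * t) =1 mob_of t \o mob_of s.
Proof.
move=> Hs Ht; have [_ E] := realizes_mob_of (realizesM (mob_ofP Hs) (mob_ofP Ht)).
by move=> x; rewrite -E.
Qed.

Lemma mob_of1 : mob_of 1 =1 id.
Proof. by have [_ E] := realizes_mob_of realizes1; move=> x; rewrite -E. Qed.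

Lemma mob_of_id s : s \in H -> mob_of s =1 id -> s = 1.
Proof.
move=> Hs E; have [_ fs] := mob_ofP Hs; apply/permP=> i; apply: pts_inj.
by rewrite -fs E perm1.
Qed.

Lemma mob_of_inj s t : s \in H -> t \in H -> mob_of s =1 mob_of t -> s = t.
Proof.
move=> Hs Ht E; have [_ fs] := mob_ofP Hs; have [_ ft] := mob_ofP Ht.
by apply/permP=> i; apply: pts_inj; rewrite -fs -ft E.
Qed.

Lemma mob_of_iter s k : s \in H -> mob_of (s ^+ k) =1 iter k (mob_of s).
Proof.
move=> Hs; elim: k => [|k IH] x; first exact: mob_of1.
by rewrite expgSr mob_ofM ?groupX //= IH.
Qed.

Lemma mob_of_torsion s : s \in H -> iter #[s] (mob_of s) =1 id.
Proof. by move=> Hs x; rewrite -mob_of_iter // expg_order mob_of1. Qed.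

Lemma mob_ofJ s t x : s \in H -> t \in H ->
  mob_of (s ^ t) (mob_of t x) = mob_of t (mob_of s x).
Proof.
move=> Hs Ht; have <- : mob_of (t * s ^ t) x = mob_of (s ^ t) (mob_of t x).
  by rewrite mob_ofM ?groupJ.
by rewrite -conjgC mob_ofM.
Qed.

Lemma mob_ofVK s x : s \in H -> mob_of s (mob_of s^-1 x) = x.
Proof.
move=> Hs; have <- : mob_of (s^-1 * s) x = mob_of s (mob_of s^-1 x).
  by rewrite mob_ofM ?groupV.
by rewrite mulVg mob_of1.
Qed.

Lemma fix_pair s : s \in H^# -> exists p q, p != q /\
  forall x, mob_of s x = x <-> x = p \/ x = q.
Proof.
move=> /setD1P[ns Hs]; have mf := mob_of_moebius Hs.
have [p fp] := moebius_fixpoint mf.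
have nid : ~ mob_of s =1 id by move/(mob_of_id Hs) => e; rewrite e eqxx in ns.
have [q qp E] := moebius_fix2 mf fp (order_gt0 s) (mob_of_torsion Hs) nid.
by exists p, q; rewrite eq_sym.
Qed.

(** The multiplier at p maps A to the multiplicative group of K, injectively because a torsion
    element of multiplier 1 is trivial; finite subgroups of that group are cyclic. *)
Lemma point_stab_cyclic (A : {group 'S_m}) p : A \subset H ->
  {in A, forall s, mob_of s p = p} -> cyclic A.
Proof.
move=> /subsetP sAH fixA.
apply: (@field_mul_group_cyclic _ _ K (fun s => multiplier p (mob_of s))).
  move=> s t As At; have [Hs Ht] := (sAH s As, sAH t At).
  rewrite GRing.mulrC -(multiplierM (mob_of_moebius Ht) (mob_of_moebius Hs)) ?fixA //.
  by rewrite /multiplier !mob_ofM.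
move=> s As; have Hs := sAH s As; split=> [m1|->].
  apply: mob_of_id => //.
  exact: multiplier1 (mob_of_moebius Hs) (fixA s As) (order_gt0 s) (mob_of_torsion Hs) m1.
exact: multiplier_id mob_of1.
Qed.

Definition fixer s := [set t in H | `[< forall x, mob_of s x = x -> mob_of t x = x >]].

Lemma fixerP s t : reflect (t \in H /\ forall x, mob_of s x = x -> mob_of t x = x) (t \in fixer s).
Proof.
rewrite [X in reflect _ X]in_set; apply: (iffP andP) => -[Ht /asboolP E]; split=> //.
Qed.

Lemma fixer_group_set s : group_set (fixer s).
Proof.
apply/group_setP; split; first by apply/fixerP; split=> // x _; apply: mob_of1.
move=> t u /fixerP[Ht Et] /fixerP[Hu Eu]; apply/fixerP; rewrite groupM //; split=> // x fx.
by rewrite mob_ofM //= Et // Eu.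
Qed.
Canonical fixer_group s := Group (fixer_group_set s).

Lemma fixer_sub s : fixer s \subset H.
Proof. by apply/subsetP=> t /fixerP[]. Qed.

(** Both maps have exactly two fixed points, and those of s are fixed by t. *)
Lemma fixer_eq s t : s \in H^# -> t \in (fixer s)^# -> 
  forall x, mob_of t x = x <-> mob_of s x = x.
Proof.
move=> Hs /setD1P[nt /fixerP[Ht Et]].
have Ht' : t \in H^# by rewrite !inE nt; move: Ht; rewrite inE.
have [p [q [pq Es]]] := fix_pair Hs; have [p' [q' [pq' Et']]] := fix_pair Ht'.
move=> x; rewrite Es Et'.
have /Et' ep : mob_of t p = p by apply/Et/Es; left.
have /Et' eq : mob_of t q = q by apply/Et/Es; right.
by case: ep eq pq pq' => -> [] ->; rewrite ?eqxx // => _ _; split=> -[]; tauto.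
Qed.

(** An element of the normalizer permutes {p, q}, and outside the fixer it does not fix both. *)
Lemma fixer_swap s t p q : s \in H^# -> t \in 'N_H(fixer s) :\: fixer s -> p != q ->
  (forall x, mob_of s x = x <-> x = p \/ x = q) -> mob_of t p = q /\ mob_of t q = p.
Proof.
move=> Hs' /setDP[/setIP[Ht Nt] Ct] pq E; have [ns Hs] := setD1P Hs'.
have Csn : s ^ t \in (fixer s)^#.
  by rewrite in_setD1 conjg_eq1 ns memJ_norm //; apply/fixerP.
have im x : mob_of s x = x -> mob_of s (mob_of t x) = mob_of t x.
  by move=> fx; apply/(fixer_eq Hs' Csn); rewrite mob_ofJ // fx.
have inj := moebius_inj (mob_of_moebius Ht).
have /im/E tp : mob_of s p = p by apply/E; left.
have /im/E tq : mob_of s q = q by apply/E; right.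
case: tp tq => [tp [tq|tq]|tp [tq|tq]] //.
- by case/eqP: pq; apply: inj; rewrite tp.
- by case/negP: Ct; apply/fixerP; split=> // x /E[] ->.
- by case/eqP: pq; apply: inj; rewrite tp.
Qed.

Lemma mob_perms_cover : fix_cover H fixer_group.
Proof.
split=> [s _|s Hs|s /setD1P[_ Hs]|s t Hs Ct|s g /setD1P[_ Hs] Hg|s t u Hs Nt Nu|s t Hs Nt].
- exact: fixer_sub.
- have [p [q [pq E]]] := fix_pair Hs.
  apply: (@point_stab_cyclic _ p); first exact: fixer_sub.
  by move=> t /fixerP[_]; apply; apply/E; left.
- by apply/fixerP.
- apply/setP=> u; apply/fixerP/fixerP=> -[Hu Eu]; split=> // x;
    by move/(fixer_eq Hs Ct); apply: Eu.
- apply/setP=> t; rewrite mem_conjg; apply/fixerP/fixerP=> -[Ht Et].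
    rewrite groupJ ?groupV //; split=> // x fx.
    apply: (moebius_inj (mob_of_moebius Hg)); rewrite -mob_ofJ ?groupJ ?groupV // conjgKV.
    by apply: Et; rewrite mob_ofJ // fx.
  have Ht' : t \in H by rewrite -(conjgKV g t) groupJ.
  split=> // x; rewrite -(mob_ofVK x Hg) mob_ofJ // => /(moebius_inj (mob_of_moebius Hg)) /Et fx.
  by rewrite -{1}(conjgKV g t) mob_ofJ // fx.
- have [p [q [pq E]]] := fix_pair Hs.
  have [tp tq] := fixer_swap Hs Nt pq E; have [up uq] := fixer_swap Hs Nu pq E.
  have /setDP[/setIP[Ht _] _] := Nt; have /setDP[/setIP[Hu _] _] := Nu.
  apply/fixerP; rewrite groupM //; split=> // x /E[]->; rewrite mob_ofM //=.
    by rewrite tp uq.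
  by rewrite tq up.
have [p [q [pq E]]] := fix_pair Hs.
have [tp tq] := fixer_swap Hs Nt pq E; have /setDP[/setIP[Ht _] _] := Nt.
apply: mob_of_id; first exact: groupX.
move=> x; rewrite mob_of_iter //=.
exact: (moebius_swap (mob_of_moebius Ht) pq tp tq).
Qed.

End Stabilizer.

(** * Tests for the exceptional groups *)

Section Counting.
Variables (K : numClosedFieldType) (m : nat) (pts : 'I_m -> option K).
Hypotheses (pts_inj : injective pts) (m_gt2 : 2 < m).
Local Notation H := (mob_perms_group pts).
Local Notation mob_of := (mob_of pts).
Local Notation fixer := (fixer_group pts_inj m_gt2).

Let cov := mob_perms_cover pts_inj m_gt2.

Lemma mob_perms_classification :
  [\/ cyclic H, has_rotation_subgroup H | exotic H fixer].
Proof. exact: cover_classification cov. Qed.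

(* A noncyclic 2-group of Moebius maps fixes no point. *)
Lemma exotic_even : exotic H fixer -> ~~ odd m.
Proof.
case/exotic_2subgroup=> P [sPH p2P ncP].
have actP : [acts P, on [set: 'I_m] | 'P] by apply/actsP=> s _ i; rewrite !inE.
have := pgroup_fix_mod p2P actP; rewrite cardsT card_ord.
suff -> : #|'Fix_([set: 'I_m] | 'P)(P)| = 0 by rewrite -dvdn2 /dvdn => ->.
apply/eqP; rewrite cards_eq0; apply/eqP/setP=> i; rewrite in_set0 in_setI in_setT /=.
apply: contraNF ncP => /afixP fixi.
apply: (@point_stab_cyclic _ _ _ pts_inj m_gt2 _ (pts i) sPH) => s Ps.
by have [_ ->] := mob_ofP (subsetP sPH s Ps); have /= := fixi s Ps; rewrite apermE => ->.
Qed.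

(* The two fixed points of a rotation of order 3 are swapped by its normalizer, so both
   or neither are among the points. *)
Lemma octahedral_mod3 : octahedral H fixer -> m %% 3 != 1%N.
Proof.
case=> _ _ [x [y [Hx cx Ny]]].
have p3C : 3.-group (fixer x) by rewrite /pgroup cx.
have actC : [acts fixer x, on [set: 'I_m] | 'P] by apply/actsP=> s _ i; rewrite !inE.
have := pgroup_fix_mod p3C actC; rewrite cardsT card_ord => ->.
have [p [q [pq E]]] := fix_pair pts_inj m_gt2 Hx.
have [yp yq] := fixer_swap pts_inj m_gt2 Hx Ny pq E.
have /setDP[/setIP[Hy _] _] := Ny; have /setD1P[_ Hx'] := Hx.
have fixE i : (i \in 'Fix_([set: 'I_m] | 'P)(fixer x)) <-> pts i = p \/ pts i = q.
  rewrite in_setI in_setT /= -E; split=> [/afixP fixi | fi].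
    have Cx : x \in fixer x by apply: cover_id cov _ Hx.
    by have [_ ->] := mob_ofP Hx'; have /= := fixi x Cx; rewrite apermE => ->.
  apply/afixP=> s /fixerP[Hs Es] /=; rewrite apermE; apply: pts_inj.
  by have [_ <-] := mob_ofP Hs; apply: Es.
have [-> | [i Fi]] := set_0Vmem 'Fix_([set: 'I_m] | 'P)(fixer x); first by rewrite cards0.
suff -> : 'Fix_([set: 'I_m] | 'P)(fixer x) = [set i; y i].
  suff niy : i != y i by rewrite cards2 niy.
  apply: contra pq => /eqP iy; have [_ ey] := mob_ofP Hy; have := ey i; rewrite -iy.
  by case/fixE: Fi => ->; rewrite ?yp ?yq => ->.
apply/setP=> j; rewrite in_set2.
have [_ ey] := mob_ofP Hy; have := ey i.
move=> eyi; rewrite -!(inj_eq pts_inj) -eyi.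
apply/idP/orP => [/fixE Fj | Fj]; last apply/fixE.
  by case/fixE: Fi Fj => -> [] ->; rewrite ?yp ?yq ?eqxx; [left|right|right|left].
by case/fixE: Fi Fj => -> [] /eqP ->; rewrite ?yp ?yq; [left|right|right|left].
Qed.

(** An element of order greater than 2 is a rotation, and it generates a normal subgroup because
    subgroups of a cyclic group are characteristic. Conjugates of x are then powers of x, so y
    carries fixed points of x to fixed points of x. *)
Lemma fix_preserved x y p : cyclic H \/ has_rotation_subgroup H ->
  x \in H -> 2 < #[x] -> y \in H -> mob_of x p = p ->
  mob_of x (mob_of y p) = mob_of y p.
Proof.
move=> rot Hx x3 Hy xp.
suff /cycleP[k ek] : x ^ y^-1 \in <[x]>.
  rewrite -{1}(conjgKV y x) mob_ofJ ?groupJ ?groupV // ek mob_of_iter //.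
  by congr (mob_of y _); elim: k {ek} => //= k ->.
case: rot => [cH | [R [sRH cR oR inv]]].
  suff -> : x ^ y^-1 = x by rewrite cycle_id.
  apply/conjg_fixP/commgP.
  exact: (centsP (cyclic_abelian cH) x Hx y^-1 (groupVr Hy)).
have Rx : x \in R.
  apply: contraT => nRx; have x2 : x ^+ 2 = 1 by apply: inv; rewrite inE nRx.
  by move: x3; rewrite ltnNge dvdn_leq // order_dvdn x2.
have nR : R <| H.
  apply: index2_normal => //.
  by apply/eqP; rewrite -(eqn_pmul2l (cardG_gt0 R)) Lagrange // -oR mulnC.
have chx : <[x]> \char R by rewrite sub_cyclic_char ?cycle_subG.
have /normalP[_ nx] := char_normal_trans chx nR.
by rewrite -mem_conjg nx ?cycle_id.
Qed.

Lemma exotic_of_move x y p : x \in H -> 2 < #[x] -> y \in H -> mob_of x p = p ->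
  mob_of x (mob_of y p) <> mob_of y p -> exotic H fixer.
Proof.
move=> Hx x3 Hy xp nyp; case: mob_perms_classification => // rot; case: nyp.
  by apply: fix_preserved => //; left.
by apply: fix_preserved => //; right.
Qed.

End Counting.
Local Close Scope group_scope.
Local Open Scope ring_scope.

(** * Rational functions *)

Section Fractions.
Variable K : fieldType.
Implicit Types (p q : {poly K}) (x y : ratfun K).

(** A copy of [tofrac] with values in [ratfun], so that it can carry the K-linear structure as
    well. *)
Definition rfrac p : ratfun K := tofrac p.

Fact rfrac_zmod_morphism : zmod_morphism rfrac.
Proof. exact: (rmorphB (@tofrac {poly K})). Qed.
HB.instance Definition _ := GRing.isZmodMorphism.Build _ _ rfrac rfrac_zmod_morphism.
Fact rfrac_monoid_morphism : monoid_morphism rfrac.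
Proof. by split; [exact: (rmorph1 (@tofrac {poly K})) | exact: (rmorphM (@tofrac {poly K}))]. Qed.
HB.instance Definition _ := GRing.isMonoidMorphism.Build _ _ rfrac rfrac_monoid_morphism.
Fact rfrac_scalable : scalable rfrac.
Proof. by move=> c p; rewrite -mul_polyC rmorphM. Qed.
HB.instance Definition _ := GRing.isScalable.Build _ _ _ _ rfrac rfrac_scalable.

Lemma rfrac_inj : injective rfrac.
Proof. by move=> p q /eqP; rewrite /rfrac tofrac_eq => /eqP. Qed.

Lemma rfrac_eq0 q : (rfrac q == 0) = (q == 0).
Proof. by rewrite -(rmorph0 rfrac) (inj_eq rfrac_inj). Qed.

Lemma ratfun_frac x : exists p q, q != 0 /\ x = rfrac p / rfrac q.
Proof.
suff [p [q [q0 e]]] : exists p q, q != 0 /\ x * rfrac q = rfrac p.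
  by exists p, q; split=> //; rewrite -e mulfK // rfrac_eq0.
elim/quotW: x => r; exists (\n_r), (\d_r); split; first exact: denom_ratioP.
rewrite /rfrac; unlock tofrac; rewrite [X in X = _]/GRing.mul /=.
rewrite -[LHS]FracField.pi_mul; apply/eqmodP => /=.
rewrite /FracField.mulf /= FracField.equivfE !numden_Ratio ?mulf_neq0 ?oner_neq0 ?denom_ratioP //.
by rewrite !mulr1 mulrC.
Qed.

Lemma ratfun_coprime x : exists p q, [/\ q != 0, coprimep p q & x = rfrac p / rfrac q].
Proof.
have [p [q [q0 ->]]] := ratfun_frac x.
have g0 : gcdp p q != 0 by rewrite gcdp_eq0 negb_and q0 orbT.
exists (p %/ gcdp p q), (q %/ gcdp p q).
have eq : q = q %/ gcdp p q * gcdp p q by rewrite divpK ?dvdp_gcdr.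
have ep : p = p %/ gcdp p q * gcdp p q by rewrite divpK ?dvdp_gcdl.
have q0' : q %/ gcdp p q != 0 by apply: contraNneq q0 => e; rewrite eq e mul0r.
split=> //; first by rewrite coprimep_div_gcd // q0 orbT.
have red p' q' g : g != 0 -> rfrac (p' * g) / rfrac (q' * g) = rfrac p' / rfrac q'.
  by move=> gn0; rewrite !rmorphM /= -mulf_div divff ?mulr1 // rfrac_eq0.
by rewrite -[RHS](red _ _ _ g0) -ep -eq.
Qed.

Lemma rfrac_div_eq p q p' q' : q != 0 -> q' != 0 ->
  rfrac p / rfrac q = rfrac p' / rfrac q' <-> p * q' = p' * q.
Proof.
move=> q0 q0'; split=> [/eqP|e].
  by rewrite eqr_div ?rfrac_eq0 // -!rmorphM => /eqP /rfrac_inj.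
by apply/eqP; rewrite eqr_div ?rfrac_eq0 // -!rmorphM e.
Qed.

Fact num_den_ex x : {pq : {poly K} * {poly K} | pq.2 != 0 & x = rfrac pq.1 / rfrac pq.2}.
Proof. by apply/cid2; have [p [q [q0 e]]] := ratfun_frac x; exists (p, q). Qed.

Definition num x : {poly K} := (s2val (num_den_ex x)).1.
Definition den x : {poly K} := (s2val (num_den_ex x)).2.

Lemma den_nz x : den x != 0.
Proof. exact: s2valP (num_den_ex x). Qed.

Lemma num_den x : x = rfrac (num x) / rfrac (den x).
Proof. exact: s2valP' (num_den_ex x). Qed.

(** The quotient rule on a chosen representative; [rderiv_frac] removes the dependence on the
    choice. *)
Definition rderiv x : ratfun K :=
  rfrac ((num x)^`() * den x - num x * (den x)^`()) / rfrac (den x) ^+ 2.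

Lemma rderiv_frac p q : q != 0 ->
  rderiv (rfrac p / rfrac q) = rfrac (p^`() * q - p * q^`()) / rfrac q ^+ 2.
Proof.
move=> q0; rewrite /rderiv; set x := rfrac p / rfrac q.
have d0 := den_nz x; have e := num_den x; rewrite /x rfrac_div_eq // in e.
move: (num x) (den x) d0 e => n d d0 e; clear x.
have e' : p^`() * d + p * d^`() = n^`() * q + n * q^`() by rewrite -!derivM e.
rewrite -!rmorphXn /=; apply/rfrac_div_eq; rewrite ?expf_neq0 //.
transitivity (n^`() * q * (d * q) - n * q * (d^`() * q)); first by ring.
have -> : n^`() * q = p^`() * d + p * d^`() - n * q^`() by rewrite e' addrK.
by rewrite -e; apply/eqP; rewrite -subr_eq0; apply/eqP;
   transitivity (q^`() * d * (p * d - n * q)); [ring | rewrite e subrr mulr0].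
Qed.

End Fractions.

(** * The derivation d/dt of the field of rational functions *)

Section QuotientRule.
Variables (F : fieldType) (c p q p' q' dp dq dp' dq' : F).
Hypotheses (q0 : q != 0) (q0' : q' != 0).

Lemma frac_lincomb : c * (p / q) + p' / q' = (c * p * q' + p' * q) / (q * q').
Proof. by field; rewrite q0 q0'. Qed.

Lemma quotient_rule_lincomb :
  ((c * dp * q' + c * p * dq' + (dp' * q + p' * dq)) * (q * q') -
   (c * p * q' + p' * q) * (dq * q' + q * dq')) / (q * q') ^+ 2 =
  c * ((dp * q - p * dq) / q ^+ 2) + (dp' * q' - p' * dq') / q' ^+ 2.
Proof. by field; rewrite q0 q0'. Qed.

Lemma quotient_rule_mul :
  ((dp * p' + p * dp') * (q * q') - p * p' * (dq * q' + q * dq')) / (q * q') ^+ 2 =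
  (dp * q - p * dq) / q ^+ 2 * (p' / q') + p / q * ((dp' * q' - p' * dq') / q' ^+ 2).
Proof. by field; rewrite q0 q0'. Qed.

End QuotientRule.

Section RDeriv.
Variable K : fieldType.
Implicit Types (p q : {poly K}) (x y : ratfun K).

Lemma rderiv_lincomb c x y :
  rderiv (rfrac c%:P * x + y) = rfrac c%:P * rderiv x + rderiv y.
Proof.
have [p [q [q0 ->]]] := ratfun_frac x; have [p' [q' [q0' ->]]] := ratfun_frac y.
have [Fq Fq'] : rfrac q != 0 /\ rfrac q' != 0 by rewrite !rfrac_eq0.
rewrite (frac_lincomb (rfrac c%:P) (rfrac p) (rfrac p') Fq Fq').
rewrite -!(rmorphM (@rfrac K)).
rewrite -(rmorphD (@rfrac K)).
rewrite !rderiv_frac ?mulf_neq0 // !(derivM, derivD, derivC) mul0r add0r.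
rewrite !(rmorphB, rmorphD, rmorphM) /=; apply: quotient_rule_lincomb; [exact: Fq | exact: Fq'].
Qed.

Lemma rderiv_linear : linear (@rderiv K).
Proof. exact: rderiv_lincomb. Qed.

Lemma rderivM x y : rderiv (x * y) = rderiv x * y + x * rderiv y.
Proof.
have [p [q [q0 ->]]] := ratfun_frac x; have [p' [q' [q0' ->]]] := ratfun_frac y.
have [Fq Fq'] : rfrac q != 0 /\ rfrac q' != 0 by rewrite !rfrac_eq0.
rewrite mulf_div -!(rmorphM (@rfrac K)) !rderiv_frac ?mulf_neq0 //.
by rewrite !derivM !(rmorphB, rmorphD, rmorphM) /=; apply: quotient_rule_mul; [exact: Fq | exact: Fq'].
Qed.

Lemma rderivX : rderiv (ratfunX K) = 1.
Proof.
have -> : ratfunX K = rfrac 'X / rfrac 1 by rewrite rmorph1 divr1.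
rewrite rderiv_frac ?oner_neq0 // derivX derivC mulr0 subr0 mulr1 rmorph1.
by rewrite expr1n divr1.
Qed.

End RDeriv.

(** * Induction in R_a, and d/dt on R_a *)

Section GenSubalg.
Variables (K : fieldType) (A : comAlgType K) (S : classical_sets.set A).

Lemma mem_gen_subalg y : S y -> y \in gen_subalg_pred S.
Proof. by move=> Sy; apply/asboolP => B _; apply. Qed.

Lemma gen_subalg_rec (P : A -> Prop) :
  P 1 -> (forall c x y, P x -> P y -> P (c *: x + y)) ->
  (forall x y, P x -> P y -> P (x * y)) -> (forall y, S y -> P y) ->
  forall x, x \in gen_subalg_pred S -> P x.
Proof.
move=> P1 PZ PM PS x /asboolP /(_ (fun y => `[< P y >])) xP; apply/asboolP/xP.
  split=> [|c u v /asboolP Pu /asboolP Pv|u v /asboolP Pu /asboolP Pv]; apply/asboolP => //.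
    exact: PZ.
  exact: PM.
by move=> y /PS Py; apply/asboolP.
Qed.

Lemma gen_subalg_ind (P : gen_subalg S -> Prop) :
  P 1 -> (forall c x y, P x -> P y -> P (c *: x + y)) ->
  (forall x y, P x -> P y -> P (x * y)) ->
  (forall y (Sy : S y), P (MkGenSubalg (mem_gen_subalg Sy))) ->
  forall x, P x.
Proof.
move=> P1 PZ PM PS [x xS].
(* The membership proof is quantified existentially, to allow induction on the bare element x; proof
   irrelevance restores the given one. *)
suff [xS' Px] : exists xS', P (MkGenSubalg (S := S) (gen_subalg_val := x) xS').
  by rewrite (_ : MkGenSubalg xS = MkGenSubalg xS') //; apply: val_inj.
have key (z : gen_subalg S) : P z -> exists zS, P (MkGenSubalg (S := S) (gen_subalg_val := val z) zS).
  by case: z => z zS Pz; exists zS.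
move: x {xS}(xS); apply: gen_subalg_rec.
- exact: key P1.
- by move=> c x y [xS Px] [yS Py]; exact: key (PZ c _ _ Px Py).
- by move=> x y [xS Px] [yS Py]; exact: key (PM _ _ Px Py).
by move=> y Sy; exists (mem_gen_subalg Sy).
Qed.

End GenSubalg.

Section RaBasics.
Variables (K : fieldType) (n : nat) (a : n.-tuple K).
Local Notation R := (Ra a).

Lemma mem_X : ratfunX K \in gen_subalg_pred (Ra_gens a).
Proof. by apply: mem_gen_subalg; left. Qed.
Lemma mem_inv i : (ratfunX K - ratfunC (tnth a i))^-1 \in gen_subalg_pred (Ra_gens a).
Proof. by apply: mem_gen_subalg; right; exists i. Qed.

Definition RaX : R := MkGenSubalg mem_X.
Definition RaV i : R := MkGenSubalg (mem_inv i).

Lemma Xsub_nz c : ratfunX K - ratfunC c != 0.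
Proof. by rewrite -[_ - _]/(rfrac 'X - rfrac c%:P) -rmorphB /= rfrac_eq0 polyXsubC_eq0. Qed.

Lemma RaVK i : (RaX - (tnth a i)%:A) * RaV i = 1.
Proof.
apply: val_inj.
rewrite /= -[LHS]/((ratfunX K - ratfunC (tnth a i) * 1) * (ratfunX K - ratfunC (tnth a i))^-1).
by rewrite mulr1 divff ?Xsub_nz.
Qed.

Lemma Ra_ind (P : R -> Prop) :
  P 1 -> (forall c x y, P x -> P y -> P (c *: x + y)) ->
  (forall x y, P x -> P y -> P (x * y)) -> P RaX -> (forall i, P (RaV i)) ->
  forall x, P x.
Proof.
move=> P1 PZ PM PX PV; apply: gen_subalg_ind => // y Sy; have [e | [i e]] := Sy.
  by rewrite (_ : MkGenSubalg _ = RaX) //; apply: val_inj.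
by rewrite (_ : MkGenSubalg _ = RaV i) //; apply: val_inj.
Qed.

Lemma rderiv_Ra x : x \in gen_subalg_pred (Ra_gens a) -> rderiv x \in gen_subalg_pred (Ra_gens a).
Proof.
(* Membership of x itself is carried along, since the product rule involves x beside its
   derivative. *)
suff : x \in gen_subalg_pred (Ra_gens a) ->
  x \in gen_subalg_pred (Ra_gens a) /\ rderiv x \in gen_subalg_pred (Ra_gens a) by move=> h /h[].
have D1 : rderiv (1 : ratfun K) = 0.
  have := rderivM (1 : ratfun K) 1; rewrite !mulr1 !mul1r => /eqP.
  by rewrite -subr_eq0 opprD addNKr oppr_eq0 => /eqP.
move: x; apply: gen_subalg_rec => [|c x y [xG dx] [yG dy]|x y [xG dx] [yG dy]|y [->|[i ->]]].
- by rewrite D1; split; [exact: rpred1 | exact: rpred0].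
- rewrite rderiv_linear; by split; apply: rpredD => //; apply: rpredZ.
- rewrite rderivM; split; first exact: rpredM.
  by apply: rpredD; apply: rpredM.
- by rewrite rderivX; split; [exact: mem_X | exact: rpred1].
split; first exact: mem_inv.
set v := ratfunX K - ratfunC (tnth a i).
have v0 : v != 0 by apply: Xsub_nz.
have dv : rderiv v = 1.
  have -> : v = (- (tnth a i)) *: 1 + ratfunX K.
    by rewrite scaleNr -[_ *: 1]/(ratfunC (tnth a i) * 1) mulr1 addrC.
  by rewrite rderiv_linear D1 scaler0 add0r rderivX.
have -> : rderiv v^-1 = - (v^-1 * v^-1).
  have := rderivM v v^-1; rewrite divff // D1 dv mul1r => /esym/eqP.
  rewrite addrC addr_eq0 => /eqP e; apply: (mulfI v0); rewrite e.
  by rewrite mulrN mulrA divff // mul1r.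
by rewrite rpredN rpredM ?mem_inv.
Qed.

Definition Rad (x : R) : R := MkGenSubalg (rderiv_Ra (valP x)).

Lemma Ra_valM (x y : R) : gen_subalg_val (x * y) = gen_subalg_val x * gen_subalg_val y.
Proof. by []. Qed.
Lemma Ra_valD (x y : R) : gen_subalg_val (x + y) = gen_subalg_val x + gen_subalg_val y.
Proof. by []. Qed.

Lemma Rad_linear : linear Rad.
Proof. by move=> c x y; apply: val_inj; apply: rderiv_linear. Qed.
Lemma RadM x y : Rad (x * y) = Rad x * y + x * Rad y.
Proof.
apply: val_inj; change (rderiv (gen_subalg_val (x * y)) =
  gen_subalg_val (Rad x * y + x * Rad y)).
by rewrite Ra_valD !Ra_valM rderivM.
Qed.
Lemma RadX : Rad RaX = 1.
Proof. by apply: val_inj; apply: rderivX. Qed.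

End RaBasics.

(** * Lie automorphisms of derivations *)

Section WronskianIdentity.
Variables (A : comNzRingType) (d : A -> A).
Hypotheses (dD : forall x y, d (x + y) = d x + d y)
  (dM : forall x y, d (x * y) = d x * y + x * d y).

Definition wr (f g : A) := f * d g - g * d f.

(* The combination for which all terms that are not expressible through the product
   [f * k] cancel, see [wrQE]. *)
Definition wrQ f k x y := (wr (wr f x) (wr k y) + wr (wr k x) (wr f y)) *+ 2
  + (wr f (wr k (wr x y)) + wr k (wr f (wr x y))).

Lemma wr_dN x : d (- x) = - d x.
Proof.
have d0 : d 0 = 0 by apply: (addrI (d 0)); rewrite -dD !addr0.
by apply/eqP; rewrite -addr_eq0 -dD addNr d0.
Qed.

Lemma wrQE f k x y : let w := wr x y in
  wrQ f k x y = d (d (f * k)) * w - d (f * k) * d w *+ 3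
    + f * k * (d (d w) *+ 2 + (d x * d (d y) - d (d x) * d y) *+ 4).
Proof.
rewrite /wrQ /wr; rewrite !(dD, wr_dN, dM).
by ring.
Qed.

(** The test pairs (1, X), (1, X^2), (1, X^3) have brackets 1, 2X, 3X^2 and yield in turn F'' = 0, 6
    F' = 0 and 12 F = 18 X F'. *)
Lemma wrQ_inj (X F : A) : d X = 1 -> GRing.lreg (12%:R : A) ->
  (forall x y, let w := wr x y in d (d F) * w - d F * d w *+ 3
    + F * (d (d w) *+ 2 + (d x * d (d y) - d (d x) * d y) *+ 4) = 0) -> F = 0.
Proof.
move=> dX r12 H.
have d1 : d 1 = 0 by apply: (addrI (d 1)); rewrite addr0 -{3}(mulr1 1) dM mulr1 mul1r.
have d0 : d 0 = 0 by apply: (addrI (d 0)); rewrite -dD !addr0.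
have F2 : d (d F) = 0.
  have := H 1 X; rewrite /= /wr !(dD, wr_dN, dM, dX, d1, d0) => <-; ring.
have F1 : d F *+ 6 = 0.
  have := H 1 (X * X); rewrite /= /wr !(dD, wr_dN, dM, dX, d1, d0, F2) => e.
  by rewrite -[LHS]opprK -[RHS]oppr0; congr (- _); rewrite -e; ring.
have F0 : F *+ 12 = 0.
  have := H 1 (X * X * X); rewrite /= /wr !(dD, wr_dN, dM, dX, d1, d0, F2) => e.
  transitivity (F *+ 12 - d F *+ 6 * X *+ 3); first by rewrite F1 mul0r mul0rn subr0.
  by rewrite -[RHS]e; ring.
by apply: r12; rewrite mulr0 mulr_natl.
Qed.

End WronskianIdentity.

Section LieToAlg.
Variables (K : numFieldType) (A : comAlgType K) (d : A -> A) (X : A).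
Hypotheses (d_lin : linear d) (dM : forall x y, d (x * y) = d x * y + x * d y)
  (dX : d X = 1)
  (der_ext : forall D E : Der A, D X = E X -> D = E).

Definition is_alg_aut (s : A -> A) :=
  [/\ linear s, s 1 = 1, forall x y, s (x * y) = s x * s y & bijective s].

Let dD x y : d (x + y) = d x + d y. Proof. by rewrite -[x]scale1r d_lin !scale1r. Qed.
Lemma lin_add (U V : lmodType K) (f : U -> V) : linear f -> forall x y, f (x + y) = f x + f y.
Proof. by move=> fl x y; rewrite -[x]scale1r fl !scale1r. Qed.

Lemma lin_sub (U V : lmodType K) (f : U -> V) : linear f -> forall x y, f (x - y) = f x - f y.
Proof. by move=> fl x y; rewrite addrC -scaleN1r fl scaleN1r addrC. Qed.

Fact vf_proof u : (fun x => u * d x) \in @derivation_pred K A.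
Proof.
apply/asboolP; split=> [c x y|x y] /=; first by rewrite d_lin mulrDr scalerAr.
by rewrite dM mulrDr mulrA [u * (x * _)]mulrCA.
Qed.
Definition vf u : Der A := MkDer (vf_proof u).

Lemma vfX u : vf u X = u. Proof. by rewrite /= dX mulr1. Qed.

Lemma vfK (D : Der A) : vf (D X) = D. Proof. by apply: der_ext; rewrite vfX. Qed.

Lemma vf_lie f g : lie (vf f) (vf g) = vf (wr d f g).
Proof. by apply: der_ext; rewrite vfX /= dX !mulr1. Qed.

Lemma vf_lin : linear vf.
Proof.
move=> c u v; apply: der_ext; rewrite vfX /=.
by change (c *: u + v = c *: (u * d X) + v * d X); rewrite dX !mulr1.
Qed.

Theorem lie_aut_alg_aut (phi : LieAut (Der A)) :
  exists s, is_alg_aut s /\ forall (D : Der A) u, (phi D) (s u) = s (D u).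
Proof.
have [pl pb [qh phK qhK]] := lie_autP phi.
pose psi u := (phi (vf u)) X.
have psiE u : vf (psi u) = phi (vf u) by rewrite vfK.
have psi_lin : linear psi.
  by move=> c u v; rewrite /psi vf_lin pl.
have psi_wr f g : psi (wr d f g) = wr d (psi f) (psi g).
  by rewrite -[RHS]vfX -vf_lie !psiE -pb vf_lie.
pose chi u := (qh (vf u)) X.
have psiK : cancel psi chi by move=> u; rewrite /chi psiE phK vfX.
have chiK : cancel chi psi by move=> u; rewrite /psi vfK qhK vfX.
have psiD := lin_add psi_lin.
have psiQ f k x y : psi (wrQ d f k x y) = wrQ d (psi f) (psi k) (psi x) (psi y).
  by rewrite /wrQ !mulr2n !(psiD, psi_wr).
have r12 : GRing.lreg (12%:R : A).
  move=> u v; rewrite -!scaler_nat -!scalerAl !mul1r.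
  by move/(@scalerI _ _ _ _); apply; rewrite pnatr_eq0.
have prod f k g h : f * k = g * h -> psi f * psi k = psi g * psi h.
  move=> e; apply/eqP; rewrite -subr_eq0; apply/eqP.
  apply: (wrQ_inj dD dM dX r12) => x y /=.
  have : wrQ d f k (chi x) (chi y) = wrQ d g h (chi x) (chi y) by rewrite !(wrQE dD dM) e.
  move/(congr1 psi); rewrite !psiQ !chiK !(wrQE dD dM) /=.
  have dB u v : d (u - v) = d u - d v by rewrite dD wr_dN.
  move/eqP; rewrite -subr_eq0 => /eqP <-; rewrite !dB; ring.
pose p := psi 1.
(* Let f = [chi 1], so that psi(f) = 1. From f f = f^2 1 it follows that 1 = psi(f^2) psi(1). *)
have [q qp] : exists q, q * p = 1.
  exists (psi (chi 1 * chi 1)); rewrite -(prod (chi 1) (chi 1)) ?mulr1 //.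
  by rewrite chiK mulr1.
have pq : p * q = 1 by rewrite mulrC.
pose s u := q * psi u.
have psis u : psi u = p * s u by rewrite /s mulrA pq mul1r.
have sl : linear s by move=> c u v; rewrite /s psi_lin mulrDr scalerAr.
have s1 : s 1 = 1 by [].
have sM u v : s (u * v) = s u * s v.
  rewrite /s mulrACA (prod u v 1 (u * v)) ?mul1r //.
  by rewrite -/p mulrA -[q * q * p]mulrA qp mulr1.
pose t u := chi (p * u).
have sK : cancel s t by move=> u; rewrite /t -psis psiK.
have tK : cancel t s by move=> u; rewrite /s /t chiK mulrA qp mul1r.
exists s; split; first by split=> //; exists t.
have tl : linear t by move=> c x y; apply: (can_inj sK); rewrite sl !tK.
have tM x y : t (x * y) = t x * t y by apply: (can_inj sK); rewrite sM !tK.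
(* Apply psi to [wr d 1 X = 1]: as psi(X) = p s(X), the derivatives of p cancel and p = p^2 d(s X)
   remains. *)
have dsX : p * d (s X) = 1.
  have := psi_wr 1 X; rewrite /wr dX mulr1.
  have -> : d 1 = 0 by apply: (addrI (d 1)); rewrite addr0 -{3}(mulr1 1) dM mulr1 mul1r.
  rewrite mulr0 subr0 -/p psis dM => e.
  rewrite -[RHS]qp [in RHS]e; ring: qp.
(* E is the derivation p d pulled back along s. It takes the value 1 at X, so it is d; that is, s
   carries d to p d. *)
pose E u := t (p * d (s u)).
have EP : E \in @derivation_pred K A.
  apply/asboolP; split=> [c x y|x y]; rewrite /E.
    by rewrite sl d_lin mulrDr -scalerAr tl.
  by rewrite sM dM mulrDr (lin_add tl) mulrA [p * (s x * _)]mulrCA tM sK [t (s x * _)]tM sK.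
have Ed : MkDer EP = vf 1.
  by apply: der_ext; rewrite vfX /= /E dsX -s1 sK.
have pds u : p * d (s u) = s (d u).
  by have /(congr1 (fun D : Der A => s (D u))) := Ed; rewrite /= /E tK mul1r.
move=> D u; rewrite -(vfK D) -psiE psis /=.
by rewrite -mulrA mulrCA pds mulrC -sM mulrC.
Qed.

Lemma alg_aut_lie_aut s : is_alg_aut s ->
  exists phi : LieAut (Der A), forall (D : Der A) u, (phi D) (s u) = s (D u).
Proof.
case=> sl s1 sM [t sK tK].
have tl : linear t by move=> c x y; apply: (can_inj sK); rewrite sl !tK.
have tM x y : t (x * y) = t x * t y by apply: (can_inj sK); rewrite sM !tK.
have conjP (f g : A -> A) (fl : linear f) (gl : linear g) (fM : forall x y, f (x * y) = f x * f y)
    (gM : forall x y, g (x * y) = g x * g y) (gK : cancel g f) (D : Der A) :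
    (fun x => f (D (g x))) \in @derivation_pred K A.
  have [Dl DM] := derP D; apply/asboolP; split=> [c x y|x y]; first by rewrite gl Dl fl.
  by rewrite gM DM (lin_add fl) !fM !gK.
pose phi D := MkDer (conjP s t sl tl sM tM tK D).
pose psi D := MkDer (conjP t s tl sl tM sM sK D).
have phiP : phi \in @lie_aut_pred K (Der A).
  apply/asboolP; split=> [c D E|D E|].
  - by apply: val_inj; apply: funext => x; exact: (sl c (D (t x)) (E (t x))).
  - apply: val_inj; apply: funext => x.
    change (s (D (E (t x)) - E (D (t x))) = s (D (t (s (E (t x))))) - s (E (t (s (D (t x)))))).
    by rewrite !sK (lin_sub sl).
  by exists psi => D; apply: val_inj; apply: funext => x; rewrite /= ?sK ?tK.
by exists (MkLieAut phiP) => D u; rewrite /= sK.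
Qed.

Lemma lie_aut_det s (phi psi : LieAut (Der A)) : is_alg_aut s ->
  (forall (D : Der A) u, (phi D) (s u) = s (D u)) ->
  (forall (D : Der A) u, (psi D) (s u) = s (D u)) -> phi = psi.
Proof.
case=> _ _ _ [t sK tK] hphi hpsi; apply: val_inj; apply: funext => D.
apply: val_inj; apply: funext => u.
by rewrite -(tK u) -[LHS]/((phi D) (s (t u))) hphi -hpsi.
Qed.

(** r = s^-1 s' commutes with every derivation. Hence r X has derivative 1, and comparing both sides
    of r (u d X) = u d (r X) gives r u = u. *)
Lemma alg_aut_det s s' (phi : LieAut (Der A)) : is_alg_aut s -> is_alg_aut s' ->
  (forall (D : Der A) u, (phi D) (s u) = s (D u)) ->
  (forall (D : Der A) u, (phi D) (s' u) = s' (D u)) -> s =1 s'.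
Proof.
case=> sl s1 sM [t sK tK]; case=> sl' s1' sM' _ hs hs' u.
pose r x := t (s' x).
have rD (D : Der A) x : r (D x) = D (r x).
  by rewrite /r -hs' -{1}(tK (s' x)) hs sK.
have r1 : d (r X) = 1.
  have := rD (vf 1) X; rewrite /= !mul1r dX => <-.
  by rewrite /r s1' -s1 sK.
have := rD (vf u) X; rewrite /= dX r1 !mulr1 => e.
by rewrite -{1}e /r tK.
Qed.

End LieToAlg.

(** * Algebra automorphisms as Moebius substitutions *)

Section DegreeOne.
Variables (K F : fieldType) (iota e : {rmorphism {poly K} -> F}).
Hypotheses (iota_inj : injective iota) (eC : forall c, e c%:P = iota c%:P).
Implicit Types (P Q U V p : {poly K}).

Let homog N P Q p := \sum_(i < N.+1) p`_i *: (P ^+ i * Q ^+ (N - i)).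

Lemma homogE N P Q p : Q != 0 -> e 'X = iota P / iota Q -> (size p <= N.+1)%N ->
  e p * iota Q ^+ N = iota (homog N P Q p).
Proof.
move=> Q0 eX sp; have iQ0 : iota Q != 0 by rewrite -(rmorph0 iota) (inj_eq iota_inj).
rewrite rmorph_sum -{1}[p]coefK (poly_def _ _) rmorph_sum mulr_suml.
rewrite (big_ord_widen_cond N.+1 xpredT (fun i => e (p`_i *: 'X^i) * iota Q ^+ N)) //= big_mkcond /=.
apply: eq_bigr => i _; have [lt | le] := ltnP; last first.
  by rewrite (nth_default _ le) scale0r rmorph0.
rewrite -!mul_polyC !rmorphM eC !rmorphXn /= eX -mulrA; congr (_ * _).
rewrite expr_div_n -mulrA; congr (_ * _); have iN : (i <= N)%N by rewrite -ltnS.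
move: (nat_of_ord i) iN => k kN; rewrite -{1}(subnKC kN) exprD mulrA mulVf ?mul1r //.
by rewrite expf_neq0.
Qed.

(* If t = (U/V)(P/Q), then clearing denominators gives a homogeneous relation
   sum_i (V_i t - U_i) P^i Q^(N-i) = 0, whose extreme coefficients bound P and Q. *)
Lemma degree_one P Q U V : Q != 0 -> coprimep P Q -> e 'X = iota P / iota Q ->
  coprimep U V -> iota 'X * e V = e U -> (size P <= 2)%N /\ (size Q <= 2)%N.
Proof.
move=> Q0 cPQ eX cUV rel.
pose N := (maxn (size U) (size V)).-1.
have N0 : (0 < maxn (size U) (size V))%N.
  rewrite leq_max !size_poly_gt0; apply: contraTT cUV; rewrite negb_or !negbK.
  by move=> /andP[/eqP-> /eqP->]; rewrite coprimep0 -size_poly_eq1 size_poly0.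
have sU : (size U <= N.+1)%N by rewrite /N prednK // leq_maxl.
have sV : (size V <= N.+1)%N by rewrite /N prednK // leq_maxr.
pose L i := V`_i *: 'X - (U`_i)%:P.
have sL i : (size (L i) <= 2)%N.
  rewrite (leq_trans (size_polyD _ _)) // geq_max size_polyN size_polyC.
  by rewrite (leq_trans (size_scale_leq _ _)) ?size_polyX //; case: (_ != _).
have L0 i : L i = 0 -> V`_i = 0 /\ U`_i = 0.
  move=> Li; split.
    by have := congr1 (fun p : {poly K} => p`_1) Li; rewrite coefB coefZ coefX coefC coef0 /= mulr1 subr0.
  have := congr1 (fun p : {poly K} => p`_0) Li; rewrite coefB coefZ coefX coefC coef0 /= mulr0 sub0r.
  by move/eqP; rewrite oppr_eq0 => /eqP.
have sum0 : \sum_(i < N.+1) L i * (P ^+ i * Q ^+ (N - i)) = 0.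
  have : 'X * homog N P Q V = homog N P Q U.
    apply: iota_inj; rewrite rmorphM /= -(homogE Q0 eX sU) -(homogE Q0 eX sV).
    by rewrite mulrA rel.
  move=> h; transitivity ('X * homog N P Q V - homog N P Q U); last by rewrite h subrr.
  rewrite mulr_sumr -sumrB; apply: eq_bigr => i _.
  by rewrite mulrBl mul_polyC -!scalerAl -scalerAr.
split.
- have PL : P %| L 0%N * Q ^+ N.
    move: sum0; rewrite big_ord_recl /= subn0 expr0 mul1r => /eqP; rewrite addr_eq0 => /eqP ->.
    rewrite dvdpNr; apply: (big_ind (fun x => P %| x)) => [|x y|i _]; [exact: dvdp0 | exact: dvdp_add |].
    by rewrite dvdp_mull // dvdp_mulr // exprS dvdp_mulr.
  have {}PL : P %| L 0%N by rewrite Gauss_dvdpl // in PL; apply: coprimep_expr.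
  (* If [L 0] vanished, U and V would have the common root 0. Likewise [L N] survives below because
     N is the larger of the two degrees. *)
  have nz : L 0%N != 0.
    apply/eqP=> /L0[V0 U0]; have rU : root U 0 by apply/rootP; rewrite horner_coef0.
    have rV : root V 0 by apply/rootP; rewrite horner_coef0.
    by have := coprimep_root cUV rU; rewrite (rootP rV) eqxx.
  by apply: leq_trans (dvdp_leq nz PL) (sL _).
have QL : Q %| L N * P ^+ N.
  move: sum0; rewrite big_ord_recr /= subnn expr0 mulr1 addrC => /eqP; rewrite addr_eq0 => /eqP /= ->.
  rewrite dvdpNr; apply: (big_ind (fun x => Q %| x)) => [|x y|i _]; [exact: dvdp0 | exact: dvdp_add |].
  by rewrite /= dvdp_mull // dvdp_mull // -(subnSK (ltn_ord i)) exprS dvdp_mulr.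
have {}QL : Q %| L N by rewrite Gauss_dvdpl // in QL; rewrite coprimep_expr // coprimep_sym.
have nz : L N != 0.
  apply/eqP=> /L0[VN UN]; have := N0; rewrite /N in VN UN.
  have [le|/ltnW le] := leqP (size U) (size V).
    rewrite (maxn_idPr le) in VN * => sV0.
    by have := lead_coef_eq0 V; rewrite /lead_coef VN eqxx -size_poly_leq0 leqNgt sV0.
  rewrite (maxn_idPl le) in UN * => sU0.
  by have := lead_coef_eq0 U; rewrite /lead_coef UN eqxx -size_poly_leq0 leqNgt sU0.
by apply: leq_trans (dvdp_leq nz QL) (sL _).
Qed.

End DegreeOne.

Section FracLift.
Variables (K F : fieldType) (e : {rmorphism {poly K} -> F}).
Hypothesis e_inj : injective e.

Lemma frac_lift : exists E : ratfun K -> F,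
  [/\ forall p q, q != 0 -> E (rfrac p / rfrac q) = e p / e q,
      forall x y, E (x + y) = E x + E y & forall x y, E (x * y) = E x * E y].
Proof.
have e0 q : q != 0 -> e q != 0 by rewrite -(rmorph0 e) (inj_eq e_inj).
pose E x := e (num x) / e (den x).
have EE p q : q != 0 -> E (rfrac p / rfrac q) = e p / e q.
  move=> q0; pose x := rfrac p / rfrac q; have dx := den_nz x.
  have h := (rfrac_div_eq p (num x) q0 dx).1 (num_den x).
  rewrite -/x /E; apply/eqP; rewrite eqr_div; [|exact: e0 _ dx|exact: e0 _ q0].
  by rewrite -!rmorphM -h.
exists E; split=> [|x y|x y]; first exact: EE; have [p [q [q0 ->]]] := ratfun_frac x;
  have [p' [q' [q0' ->]]] := ratfun_frac y.
  have -> : rfrac p / rfrac q + rfrac p' / rfrac q' = rfrac (p * q' + p' * q) / rfrac (q * q').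
    by rewrite addf_div ?rfrac_eq0 // !(rmorphM, rmorphD).
  by rewrite !EE ?mulf_neq0 // addf_div ?e0 // !(rmorphM, rmorphD).
have -> : rfrac p / rfrac q * (rfrac p' / rfrac q') = rfrac (p * p') / rfrac (q * q').
  by rewrite mulf_div !rmorphM.
by rewrite !EE ?mulf_neq0 // mulf_div !rmorphM.
Qed.

End FracLift.

Lemma gen_alg_aut_inv (K : fieldType) (A B : comAlgType K) (f g : A -> B) (v w : A) :
  f 1 = 1 -> g 1 = 1 -> {morph f : x y / x * y} -> {morph g : x y / x * y} ->
  v * w = 1 -> f v = g v -> f w = g w.
Proof.
move=> f1 g1 fM gM vw e.
by rewrite -[LHS]mulr1 -g1 -vw gM -e mulrA [f w * f v]mulrC -fM vw f1 mul1r.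
Qed.

(** * Fractions of linear polynomials *)

Section LinearFractions.
Variable K : numClosedFieldType.
Implicit Types (a b c d : K).

Definition linp a b : {poly K} := a *: 'X + b%:P.

Lemma linpE a b z : (linp a b).[z] = a * z + b.
Proof. by rewrite /linp !hornerE. Qed.

Lemma linp_eq0 a b : linp a b = 0 -> a = 0 /\ b = 0.
Proof.
move=> e; have b0 : b = 0 by have := congr1 (horner^~ 0) e; rewrite /= linpE mulr0 add0r horner0.
by split=> //; have := congr1 (horner^~ 1) e; rewrite /= linpE b0 mulr1 addr0 horner0.
Qed.

Lemma linp_nz a b c d : a * d != b * c -> linp c d != 0.
Proof. by apply: contra_neq => /linp_eq0[-> ->]; rewrite !mulr0. Qed.

Lemma linp_size2 (p : {poly K}) : (size p <= 2)%N -> p = linp p`_1 p`_0.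
Proof.
move=> sp; apply/polyP=> i; rewrite coefD coefZ coefX coefC.
by case: i => [|[|i]] /=; rewrite ?mulr0 ?add0r ?mulr1 ?addr0 // nth_default // (leq_trans sp).
Qed.

Lemma proj_point_eq (u v u' v' : K) : (u != 0) || (v != 0) -> (u' != 0) || (v' != 0) ->
  u * v' = u' * v <-> proj_point u v = proj_point u' v'.
Proof.
rewrite /proj_point; have [->|v0] := eqVneq v 0; have [->|v0'] := eqVneq v' 0.
- by rewrite !mulr0.
- rewrite orbF mulr0 => u0 _; split=> // /eqP; rewrite mulf_eq0 (negPf u0) (negPf v0') //.
- rewrite orbF mulr0 => _ u0; split=> // /esym/eqP; rewrite mulf_eq0 (negPf u0) (negPf v0) //.
move=> _ _; split=> [e|[/eqP]]; first by congr Some; apply/eqP; rewrite eqr_div ?e.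
by rewrite eqr_div // => /eqP.
Qed.

(* [y = (a t + b) / (c t + d)], cross-multiplied *)
Definition mfrac (y : ratfun K) a b c d := y * rfrac (linp c d) = rfrac (linp a b).

Lemma mfrac_mob y a b c d a' b' c' d' : a * d != b * c -> a' * d' != b' * c' ->
  mfrac y a b c d -> mfrac y a' b' c' d' -> mob a b c d =1 mob a' b' c' d'.
Proof.
move=> nz nz' e e'.
have E : linp a b * linp c' d' = linp a' b' * linp c d.
  by apply: rfrac_inj; rewrite !rmorphM /= -e -e' mulrAC.
case=> [z|] /=.
  apply/proj_point_eq; [exact: mob_nz|exact: mob_nz|].
  by have := congr1 (horner^~ z) E; rewrite /= !hornerM !linpE.
apply/proj_point_eq; [exact: mob_nz_oo nz|exact: mob_nz_oo nz'|].
have c2 p q r s : (linp p q * linp r s)`_2 = p * r.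
  rewrite coefM !big_ord_recr big_ord0 /= /linp !(coefD, coefZ, coefX, coefC) /=.
  by rewrite !(mulr0, mul0r, addr0, add0r, mulr1).
by have := congr1 (fun p : {poly K} => p`_2) E; rewrite !c2.
Qed.

Lemma mob_mfrac y y' a b c d a' b' c' d' : a * d != b * c -> a' * d' != b' * c' ->
  mob a b c d =1 mob a' b' c' d' -> mfrac y a b c d -> mfrac y' a' b' c' d' -> y = y'.
Proof.
move=> nz nz' E e e'.
have ev z : (a * z + b) * (c' * z + d') = (a' * z + b') * (c * z + d).
  by apply/(proj_point_eq (mob_nz z nz) (mob_nz z nz')); exact: (E (Some z)).
have EE : linp a b * linp c' d' = linp a' b' * linp c d.
  (* Both products agree everywhere on K, in particular at more integers than a nonzero difference
     has roots. *)
  apply/eqP; rewrite -subr_eq0; apply/negPn/negP=> nz0.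
  pose s : seq K := [seq i%:R | i <- iota 0 (size (linp a b * linp c' d' - linp a' b' * linp c d))].
  have us : uniq s by rewrite map_inj_uniq ?iota_uniq // => i j /eqP; rewrite eqr_nat => /eqP.
  have rs : all (root (linp a b * linp c' d' - linp a' b' * linp c d)) s.
    by apply/allP=> z _; rewrite rootE hornerD hornerN !hornerM !linpE ev subrr.
  by have := max_poly_roots nz0 rs us; rewrite size_map size_iota ltnn.
have n0 : rfrac (linp c d) != 0 by rewrite rfrac_eq0; exact: linp_nz nz.
have n0' : rfrac (linp c' d') != 0 by rewrite rfrac_eq0; exact: linp_nz nz'.
apply: (mulIf n0); apply: (mulIf n0').
by rewrite e mulrAC e' -!rmorphM EE.
Qed.

Lemma mfrac_comp (s y1 : ratfun K) a b c d a' b' c' d' :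
  a * d != b * c -> mfrac y1 a b c d ->
  s * (rfrac c'%:P * y1 + rfrac d'%:P) = rfrac a'%:P * y1 + rfrac b'%:P ->
  mfrac s (a' * a + b' * c) (a' * b + b' * d) (c' * a + d' * c) (c' * b + d' * d).
Proof.
move=> nz e1 e2; rewrite /mfrac.
have n0 : rfrac (linp c d) != 0 by rewrite rfrac_eq0; exact: linp_nz nz.
have L p q : rfrac (linp (p * a + q * c) (p * b + q * d)) =
    (rfrac p%:P * y1 + rfrac q%:P) * rfrac (linp c d).
  rewrite mulrDl -mulrA e1 -!rmorphM -rmorphD; congr (rfrac _).
  by rewrite /linp !mul_polyC !scalerDr !scalerA !polyCD !polyCM scalerDl !mul_polyC addrACA.
by rewrite !L mulrA e2.
Qed.

End LinearFractions.

Lemma simple_pole_clear (F : fieldType) (u v c w : F) : w != 0 ->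
  (u * 1 + v * w^-1) * (c * w) = u * c * w + v * c.
Proof. by move=> w0; field. Qed.

(** * Poles of elements of R_a *)

Section RaAut.
Variables (K : numClosedFieldType) (n : nat) (a : n.-tuple K).
Local Notation R := (Ra a).
Local Notation X := (RaX a).
Local Notation val := (@gen_subalg_val K (ratfun K) (Ra_gens a)).

Definition is_alg_hom (s : R -> R) :=
  [/\ linear s, s 1 = 1 & forall x y, s (x * y) = s x * s y].

Lemma alg_aut_hom s : is_alg_aut s -> is_alg_hom s.
Proof. by case. Qed.

Lemma alg_homC s c : is_alg_hom s -> s c%:A = c%:A.
Proof.
case=> sl s1 _; have s0 : s 0 = 0 by have := lin_sub sl 0 0; rewrite !subrr.
by rewrite -[c%:A]addr0 sl s1 s0.
Qed.

Lemma Ra_hom_ext s s' : is_alg_hom s -> is_alg_hom s' -> s X = s' X -> s =1 s'.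
Proof.
move=> hs hs' e; have [sl s1 sM] := hs; have [sl' s1' sM'] := hs'.
apply: Ra_ind => [|c x y ex ey|x y ex ey||i].
- by rewrite s1 s1'.
- by rewrite sl sl' ex ey.
- by rewrite sM sM' ex ey.
- exact: e.
apply: (gen_alg_aut_inv s1 s1' sM sM' (RaVK a i)).
by rewrite (lin_sub sl) (lin_sub sl') e (alg_homC _ hs) (alg_homC _ hs').
Qed.

Lemma Ra_der_ext (D E : Der R) : D X = E X -> D = E.
Proof.
move=> e; apply: val_inj; apply: funext.
have der1 (B : Der R) : B 1 = 0.
  by have [_ BM] := derP B; apply: (addrI (B 1)); rewrite addr0 -{3}(mulr1 1) BM mulr1 mul1r.
have derC (B : Der R) c : B c%:A = 0.
  have [Bl _] := derP B; have B0 : B 0 = 0 by have := lin_sub Bl 0 0; rewrite !subrr.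
  by rewrite -[c%:A]addr0 Bl der1 B0 scaler0 addr0.
have derV (B : Der R) i : B (RaV a i) = - (RaV a i * RaV a i * B X).
  have [Bl BM] := derP B.
  have := BM (X - (tnth a i)%:A) (RaV a i); rewrite RaVK der1 (lin_sub Bl) derC subr0.
  move/esym/eqP; rewrite addrC addr_eq0 => /eqP h.
  transitivity (RaV a i * ((X - (tnth a i)%:A) * B (RaV a i))).
    by rewrite mulrA [RaV a i * _]mulrC RaVK mul1r.
  by rewrite h mulrN [B X * _]mulrC mulrA.
apply: Ra_ind => [|c x y ex ey|x y ex ey||i].
- by rewrite /= (der1 D) (der1 E).
- by have [Dl _] := derP D; have [El _] := derP E; rewrite /= Dl El ex ey.
- by have [_ DM] := derP D; have [_ EM] := derP E; rewrite /= DM EM ex ey.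
- exact: e.
by rewrite /= (derV D) (derV E) e.
Qed.

Definition is_puncture (p : option K) := p = None \/ exists j, p = Some (tnth a j).

Lemma regular_away b x : ~ is_puncture (Some b) -> x \in gen_subalg_pred (Ra_gens a) ->
  exists p q : {poly K}, q.[b] != 0 /\ x = rfrac p / rfrac q.
Proof.
move=> nb; have nz (q : {poly K}) : q.[b] != 0 -> q != 0.
  by apply: contra_neq => ->; rewrite horner0.
move: x; apply: gen_subalg_rec => [|c x y|x y|y].
- exists 1, 1; rewrite hornerC oner_neq0; split=> //.
  by rewrite rmorph1 divr1.
- case=> [p [q [q0 ->]]] [p' [q' [q0' ->]]].
  exists (c%:P * p * q' + p' * q), (q * q'); rewrite hornerM mulf_neq0 //; split=> //.
  have fq : rfrac q != 0 by rewrite rfrac_eq0; exact: nz.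
  have fq' : rfrac q' != 0 by rewrite rfrac_eq0; exact: nz.
  change (rfrac c%:P * (rfrac p / rfrac q) + rfrac p' / rfrac q'
    = rfrac (c%:P * p * q' + p' * q) / rfrac (q * q')).
  rewrite mulrA addf_div; [|exact: fq|exact: fq'].
  by rewrite !(rmorphM, rmorphD).
- case=> [p [q [q0 ->]]] [p' [q' [q0' ->]]]; exists (p * p'), (q * q').
  by rewrite hornerM mulf_neq0 //; split=> //; rewrite mulf_div !rmorphM.
case=> [->|[i ->]].
  by exists 'X, 1; rewrite hornerC oner_neq0; split=> //; rewrite rmorph1 divr1.
exists 1, ('X - (tnth a i)%:P); split; last by rewrite rmorph1 div1r rmorphB.
by rewrite hornerXsubC subr_eq0; apply/eqP=> e; apply: nb; right; exists i; rewrite e.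
Qed.

(** [proj_point D (- C)] is the pole of y, and elements of R_a are regular away from the
    punctures. *)
Lemma pole_puncture y A B C D : A * D != B * C -> mfrac y A B C D ->
  y \in gen_subalg_pred (Ra_gens a) -> is_puncture (proj_point D (- C)).
Proof.
move=> nz e yR; rewrite /proj_point oppr_eq0; have [|C0] := eqVneq C 0; first by left.
apply: contrapT => nb; have [p [q [q0 ey]]] := regular_away nb yR.
have q0' : q != 0 by apply: contraNneq q0 => ->; rewrite horner0.
have E : p * linp C D = linp A B * q.
  apply: rfrac_inj; rewrite !rmorphM /= -e ey mulrAC divfK; first by [].
  by rewrite rfrac_eq0.
have := congr1 (horner^~ (D / - C)) E; rewrite /= !hornerM !linpE.
have -> : C * (D / - C) + D = 0 by field; exact: C0.
rewrite mulr0 => /esym/eqP; rewrite mulf_eq0 (negPf q0) orbF => /eqP h.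
case/eqP: nz; have -> : B = A * D / C; last by field.
by apply/eqP; rewrite -subr_eq0 -h; apply/eqP; field; exact: C0.
Qed.

Lemma mem_mfrac y A B C D : A * D != B * C -> mfrac y A B C D ->
  is_puncture (proj_point D (- C)) -> y \in gen_subalg_pred (Ra_gens a).
Proof.
move=> nz e; have n0 : rfrac (linp C D) != 0 by rewrite rfrac_eq0; exact: linp_nz nz.
rewrite /proj_point oppr_eq0; have [C0 _|C0 [//|[j [ej]]]] := eqVneq C 0.
  have D0 : D != 0 by apply: contraNneq nz => ->; rewrite C0 !mulr0.
  suff -> : y = (A / D) *: ratfunX K + (B / D) *: 1.
    by apply: rpredD; apply: rpredZ; [exact: mem_X | exact: rpred1].
  apply: (mulIf n0); rewrite e; change (rfrac (linp A B) =
    (rfrac (A / D)%:P * rfrac 'X + rfrac (B / D)%:P * 1) * rfrac (linp C D)).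
  rewrite mulr1 -!rmorphM -rmorphD -rmorphM; congr (rfrac _).
  rewrite /linp C0 scale0r add0r mulrDl mulrAC -!polyCM !divfK // mul_polyC.
  by [].
suff -> : y = (A / C) *: 1 + ((B - A * D / C) / C) *: (ratfunX K - ratfunC (tnth a j))^-1.
  by apply: rpredD; apply: rpredZ; [exact: rpred1 | exact: mem_inv].
apply: (mulIf n0); rewrite e.
change (rfrac (linp A B) = (rfrac (A / C)%:P * 1 +
   rfrac ((B - A * D / C) / C)%:P * (rfrac 'X - rfrac (tnth a j)%:P)^-1) * rfrac (linp C D)).
have -> : linp C D = C%:P * ('X - (tnth a j)%:P).
  by rewrite /linp -ej mulrBr mul_polyC -polyCM -polyCN; congr (_ + _%:P); field; exact: C0.
have x0 : rfrac 'X - rfrac (tnth a j)%:P != 0 by exact: Xsub_nz.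
have -> : rfrac (C%:P * ('X - (tnth a j)%:P)) = rfrac C%:P * (rfrac 'X - rfrac (tnth a j)%:P).
  by rewrite (rmorphM (@rfrac K)) (rmorphB (@rfrac K)).
rewrite (simple_pole_clear (rfrac (A / C)%:P) (rfrac ((B - A * D / C) / C)%:P) (rfrac C%:P) x0).
rewrite -(rmorphB (@rfrac K)) -!(rmorphM (@rfrac K)) -(rmorphD (@rfrac K)); congr (rfrac _).
rewrite -!polyCM !divfK // mulrBr mul_polyC /linp -addrA; congr (_ + _).
by rewrite -ej -!polyCM -polyCN -polyCD; congr _%:P; field; exact: C0.
Qed.

End RaAut.

Lemma linp_sub (K : numClosedFieldType) (A B C D c : K) :
  linp (A - c * C) (B - c * D) = linp A B - c%:P * linp C D.
Proof.
apply/polyP=> i; rewrite /linp mul_polyC !(coefN, coefD, coefZ, coefX, coefC).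
by case: i => [|[|i]] /=; ring.
Qed.

(** A nonzero polynomial is a nonzero constant times linear factors, and e kills none of these. *)
Lemma poly_morph_inj (K : closedFieldType) (F : fieldType) (e : {rmorphism {poly K} -> F}) :
  (forall c, c != 0 -> e c%:P != 0) -> (forall c, e ('X - c%:P) != 0) -> injective e.
Proof.
move=> eC eX p q /eqP; rewrite -subr_eq0 -rmorphB => /eqP h.
apply/eqP; rewrite -subr_eq0; apply: contra_eqT h => nz0.
have [rs ->] := closed_field_poly_normal (p - q).
rewrite -mul_polyC rmorphM rmorph_prod mulf_neq0 //.
  by apply: eC; rewrite lead_coef_eq0.
by rewrite prodf_seq_neq0; apply/allP=> c _ /=.
Qed.

(** * Algebra automorphisms and the punctures *)

Section RaMoebius.
Variables (K : numClosedFieldType) (n : nat) (a : n.-tuple K).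
Local Notation R := (Ra a).
Local Notation X := (RaX a).
Local Notation val := (@gen_subalg_val K (ratfun K) (Ra_gens a)).

Lemma val_horner_X p : val (horner_alg X p) = rfrac p.
Proof.
elim/poly_ind: p => [|p c IH]; first by rewrite !rmorph0.
have -> : horner_alg X (p * 'X + c%:P) = horner_alg X p * X + c%:A.
  by rewrite rmorphD rmorphM /= horner_algX horner_algC.
rewrite Ra_valD Ra_valM IH.
rewrite (rmorphD (@rfrac K)) (rmorphM (@rfrac K)); congr (_ + _).
by change (ratfunC c * 1 = ratfunC c); rewrite mulr1.
Qed.

Lemma alg_aut_mfrac s : is_alg_aut s ->
  exists A B C D, A * D != B * C /\ mfrac (val (s X)) A B C D.
Proof.
move=> hs; have [sl s1 sM [t sK tK]] := hs; have hh := alg_aut_hom hs.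
pose ev (p : {poly K}) : ratfun K := val (s (horner_alg X p)).
have evB : zmod_morphism ev.
  by move=> p q; rewrite /ev rmorphB (lin_sub sl).
have evM : monoid_morphism ev.
  split=> [|p q]; rewrite /ev; first by rewrite rmorph1 s1.
  by rewrite rmorphM sM Ra_valM.
pose ev1 := GRing.isZmodMorphism.Build _ _ ev evB.
pose ev2 := GRing.isMonoidMorphism.Build _ _ ev evM.
pose e : {rmorphism {poly K} -> ratfun K} := HB.pack ev ev1 ev2.
have eC c : e c%:P = rfrac c%:P.
  rewrite /= /ev horner_algC (alg_homC _ hh).
  by change (ratfunC c * 1 = ratfunC c); rewrite mulr1.
have [P [Q [Q0 cPQ eX]]] := ratfun_coprime (val (s X)).
have [U [V [V0 cUV eT]]] := ratfun_coprime (val (t X)).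
(* This is s applied to t(X) V(X) = U(X), where U / V is the value of the inverse t at X. *)
have rel : rfrac 'X * e V = e U.
  suff h : t X * horner_alg X V = horner_alg X U.
    by rewrite /= /ev -h sM tK Ra_valM.
  apply: val_inj; change (val (t X * horner_alg X V) = val (horner_alg X U)).
  by rewrite Ra_valM !val_horner_X eT divfK // rfrac_eq0.
have eX' : e 'X = rfrac P / rfrac Q by rewrite /= /ev horner_algX.
have [sP sQ] := degree_one (@rfrac_inj K) eC Q0 cPQ eX' cUV rel.
have fQ : rfrac Q != 0 by rewrite rfrac_eq0.
have EX : val (s X) * rfrac Q = rfrac P by rewrite eX divfK.
rewrite (linp_size2 sP) (linp_size2 sQ) in EX.
(* With zero determinant s(X) would be a constant c = s(c), and injectivity of s would give X =
   c. *)
exists P`_1, P`_0, Q`_1, Q`_0; split=> //; apply/eqP=> det.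
have [c ec] : exists c, P = c%:P * Q.
  rewrite (linp_size2 sP) (linp_size2 sQ) in cPQ *.
  have [C0|C0] := eqVneq Q`_1 0.
    have D0 : Q`_0 != 0.
      by apply: contraNneq Q0 => D0; rewrite (linp_size2 sQ) C0 D0 /linp scale0r add0r.
    exists (P`_0 / Q`_0); rewrite /linp C0 scale0r add0r -polyCM divfK //.
    have /eqP : P`_1 * Q`_0 = 0 by rewrite det C0 mulr0.
    by rewrite mulf_eq0 (negPf D0) orbF => /eqP ->; rewrite scale0r add0r.
  exists (P`_1 / Q`_1); rewrite /linp mulrDr mul_polyC scalerA divfK // -polyCM.
  by congr (_ + _%:P); apply: (mulIf C0); rewrite -det mulrAC divfK.
have : X = c%:A.
  apply: (can_inj sK); rewrite (alg_homC _ hh); apply: val_inj.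
  change (val (s X) = ratfunC c * 1); rewrite mulr1 eX ec (rmorphM (@rfrac K)).
  by rewrite mulfK.
move/(congr1 val); change (rfrac 'X = ratfunC c * 1 -> False).
rewrite mulr1 => /rfrac_inj /(congr1 (fun p : {poly K} => size p)) /eqP.
by rewrite size_polyX size_polyC; case: (_ != _).
Qed.

(** [mob D (- B) (- C) A] is the inverse map. It sends infinity to the pole of s(t) and a_j to the
    pole of s((t - a_j)^-1), and both lie at punctures. *)
Lemma alg_aut_punctures s A B C D : is_alg_aut s -> A * D != B * C ->
  mfrac (val (s X)) A B C D ->
  forall p, is_puncture a p -> is_puncture a (mob D (- B) (- C) A p).
Proof.
move=> hs nz e p; have [sl s1 sM _] := hs; have hh := alg_aut_hom hs.
case=> [->|[j ->]] /=; first exact: (pole_puncture nz e (valP (s X))).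
set c := tnth a j.
have eV : s (RaV a j) * (s X - c%:A) = 1.
  by rewrite mulrC -(alg_homC c hh) -(lin_sub sl) -sM RaVK s1.
have nz' : C * (B - c * D) != D * (A - c * C).
  apply: contra nz => /eqP h; apply/eqP; apply/eqP; rewrite -subr_eq0.
  have -> : A * D - B * C = D * (A - c * C) - C * (B - c * D) by ring.
  by rewrite h subrr.
have fr : mfrac (val (s (RaV a j))) C D (A - c * C) (B - c * D).
  rewrite /mfrac; set v := val (s (RaV a j)); set y := val (s X) in e.
  have vy : v * (y - rfrac c%:P) = 1.
    have := congr1 val eV; rewrite Ra_valM.
    change (v * (y - ratfunC c * 1) = 1 -> v * (y - rfrac c%:P) = 1).
    by rewrite mulr1.
  have -> : linp (A - c * C) (B - c * D) = linp A B - c%:P * linp C D.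
    exact: linp_sub.
  rewrite (rmorphB (@rfrac K)) (rmorphM (@rfrac K)) /= -e -mulrBl mulrA vy mul1r.
  by [].
have := pole_puncture nz' fr (valP (s (RaV a j))).
have e1 : D * c + - B = - 1 * (B - c * D) by ring.
have e2 : - C * c + A = - 1 * - (A - c * C) by ring.
by rewrite e1 e2 proj_pointZ // oppr_eq0 oner_neq0.
Qed.

(** Substitution is defined on all of K(t) and maps each generator of R_a to a fraction whose pole
    is a puncture. Only an endomorphism results; invertibility follows by treating the inverse
    Moebius map in the same way. *)
Lemma mfrac_alg_aut_half A B C D : A * D != B * C ->
  (forall p, is_puncture a p -> is_puncture a (mob D (- B) (- C) A p)) ->
  exists s, is_alg_hom (a := a) s /\ mfrac (val (s X)) A B C D.
Proof.
move=> nz pun.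
have n0 : rfrac (linp C D) != 0 by rewrite rfrac_eq0; exact: linp_nz nz.
pose f := rfrac (linp A B) / rfrac (linp C D).
have ef : mfrac f A B C D by rewrite /mfrac /f divfK.
have fne c : f - rfrac c%:P != 0.
  apply/eqP=> /eqP; rewrite subr_eq0 => fc.
  have : linp A B = c%:P * linp C D.
    by apply: rfrac_inj; rewrite (rmorphM (@rfrac K)) /= -ef (eqP fc).
  move/eqP; rewrite -subr_eq0 (_ : _ - _ = linp (A - c * C) (B - c * D)); last first.
    by rewrite linp_sub.
  move/eqP/linp_eq0=> [/eqP h1 /eqP h2]; case/eqP: nz.
  by move: h1 h2; rewrite !subr_eq0 => /eqP-> /eqP->; ring.
pose e : {rmorphism {poly K} -> ratfun K} := horner_alg f.
have eC c : e c%:P = rfrac c%:P.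
  by rewrite /= horner_algC; change (ratfunC c * 1 = ratfunC c); rewrite mulr1.
have eX : e 'X = f by rewrite /= horner_algX.
have e_inj : injective e.
  apply: poly_morph_inj => c; first by rewrite eC rfrac_eq0 polyC_eq0.
  by rewrite (rmorphB e) eX eC; exact: fne.
have [E [EE ED EM]] := frac_lift e_inj.
have Ep p : E (rfrac p) = e p.
  rewrite -[rfrac p]divr1 -(rmorph1 (@rfrac K)) EE ?oner_neq0 //.
  by rewrite (rmorph1 e) divr1.
have EX : E (ratfunX K) = f by rewrite -eX -Ep.
have E1 : E 1 = 1 by rewrite -(rmorph1 (@rfrac K)) Ep (rmorph1 e) (rmorph1 (@rfrac K)).
have El c x y : E (c *: x + y) = c *: E x + E y.
  rewrite ED; congr (_ + _); change (E (rfrac c%:P * x) = rfrac c%:P * E x).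
  by rewrite EM Ep eC.
have fR : f \in gen_subalg_pred (Ra_gens a).
  by apply: (mem_mfrac nz ef); apply: (pun None); left.
have ER x : x \in gen_subalg_pred (Ra_gens a) -> E x \in gen_subalg_pred (Ra_gens a).
  move: x; apply: gen_subalg_rec => [|c x y Ex Ey|x y Ex Ey|y [->|[j ->]]].
  - by rewrite E1; exact: rpred1.
  - by rewrite El; apply: rpredD => //; apply: rpredZ.
  - by rewrite EM; apply: rpredM.
  - by rewrite EX.
  set c := tnth a j.
  have ev : E (ratfunX K - ratfunC c) = f - rfrac c%:P.
    by rewrite -[ratfunX K - _]/(rfrac 'X - rfrac c%:P) -(rmorphB (@rfrac K)) Ep (rmorphB e) eX eC.
  have eVi : E (ratfunX K - ratfunC c)^-1 * (f - rfrac c%:P) = 1.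
    by rewrite -ev -EM mulVf; [exact: E1 | exact: Xsub_nz].
  have nz' : C * (B - c * D) != D * (A - c * C).
    apply: contra nz => /eqP h; apply/eqP; apply/eqP; rewrite -subr_eq0.
    have -> : A * D - B * C = D * (A - c * C) - C * (B - c * D) by ring.
    by rewrite h subrr.
  apply: (@mem_mfrac _ _ _ _ C D (A - c * C) (B - c * D) nz').
    rewrite /mfrac; move: (E _) eVi => v vy.
    have -> : linp (A - c * C) (B - c * D) = linp A B - c%:P * linp C D.
      exact: linp_sub.
    by rewrite (rmorphB (@rfrac K)) (rmorphM (@rfrac K)) /= -ef -mulrBl mulrA vy mul1r.
  have := pun (Some c) (or_intror (ex_intro _ j erefl)); rewrite /=.
  have e1 : D * c + - B = - 1 * (B - c * D) by ring.
  have e2 : - C * c + A = - 1 * - (A - c * C) by ring.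
  by rewrite e1 e2 proj_pointZ // oppr_eq0 oner_neq0.
pose s (x : R) : R := MkGenSubalg (ER _ (valP x)).
exists s; split; last by rewrite /mfrac /= EX.
split=> [c x y||x y]; apply: val_inj.
- exact: (El c (val x) (val y)).
- exact: E1.
- exact: (EM (val x) (val y)).
Qed.

End RaMoebius.

Section Punctures.
Variables (K : numClosedFieldType) (n : nat) (a : n.-tuple K).
Hypothesis ua : uniq a.

Definition punctures (i : 'I_n.+1) : option K := omap (tnth a) (unlift ord0 i).

Lemma punctures_inj : injective punctures.
Proof.
move=> i j; rewrite /punctures; case: unliftP => [i' ->|->]; case: unliftP => [j' ->|->] //= [] e.
by congr lift; apply: (tuple_uniqP _ ua).
Qed.

Lemma puncturesP p : is_puncture a p <-> exists i, punctures i = p.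
Proof.
split=> [[->|[j ->]]|[i <-]]; first by exists ord0; rewrite /punctures unlift_none.
  by exists (lift ord0 j); rewrite /punctures liftK.
rewrite /punctures; case: unliftP => [j _|_]; last by left.
by right; exists j.
Qed.

Lemma realizes_of_stable f : moebius f ->
  (forall p, is_puncture a p -> is_puncture a (f p)) -> exists s, realizes punctures f s.
Proof.
move=> mf pf.
have h i : exists j, punctures j = f (punctures i).
  by apply/puncturesP/pf/puncturesP; exists i.
pose g i := projT1 (cid (h i)).
have gP i : punctures (g i) = f (punctures i) by rewrite /g; case: cid.
have gI : injective g.
  move=> i j e; apply: punctures_inj; apply: (moebius_inj mf).
  by rewrite -!gP e.
by exists (perm gI); split=> // i; rewrite permE gP.
Qed.

Lemma realizes_stable f s : realizes punctures f s ->
  forall p, is_puncture a p -> is_puncture a (f p).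
Proof.
by move=> [_ fs] p /puncturesP[i <-]; apply/puncturesP; exists (s i); rewrite fs.
Qed.

Lemma realizesV A B C D s : A * D != B * C -> realizes punctures (mob A B C D) s ->
  realizes punctures (mob D (- B) (- C) A) s^-1%g.
Proof.
move=> nz [_ fs]; split; first by apply: moebius_mob; rewrite mulrNN mulrC.
by move=> i; rewrite -{1}(permKV s i) -fs (mobK nz).
Qed.

End Punctures.

(** * The isomorphism with the stabilizer of the punctures *)

Section LieAutGroup.
Variables (K : numClosedFieldType) (n : nat) (a : n.-tuple K).
Hypotheses (ua : uniq a) (n_gt1 : (1 < n)%N).
Local Notation R := (Ra a).
Local Notation X := (RaX a).
Local Notation val := (@gen_subalg_val K (ratfun K) (Ra_gens a)).
Local Notation H := (mob_perms_group (punctures a)).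
Let m_gt2 : (2 < n.+1)%N. Proof. by []. Qed.

(** Composing substitutions reverses the composition of Moebius maps, and permutations compose from
    left to right; the two reversals cancel, so products correspond without taking inverses. *)
Definition lie_perm_rel (phi : LieAut (Virasoro a)) (s : [subg H]) :=
  exists sg A B C D, [/\ is_alg_aut sg,
    forall (E : Der R) u, (phi E) (sg u) = sg (E u), A * D != B * C,
    mfrac (val (sg X)) A B C D & realizes (punctures a) (mob A B C D) (sgval s)].

Lemma mfrac_alg_aut A B C D s : A * D != B * C ->
  realizes (punctures a) (mob A B C D) s ->
  exists sg, is_alg_aut sg /\ mfrac (val (sg X)) A B C D.
Proof.
move=> nz rs; have rs' := realizesV nz rs.
have nz' : D * A != - B * - C by rewrite mulrNN mulrC.
have [sg [hs es]] := mfrac_alg_aut_half nz (realizes_stable rs').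
have [tg [ht et]] : exists t, is_alg_hom (a := a) t /\ mfrac (val (t X)) D (- B) (- C) A.
  by apply: mfrac_alg_aut_half nz' _; rewrite !opprK; apply: realizes_stable rs.
(* The second matrix is the adjugate of the first, so the product is scalar and s1 (s2 X) = X. *)
have inv (s1 s2 : R -> R) P Q T U : is_alg_hom s1 -> is_alg_hom s2 -> P * U != Q * T ->
    mfrac (val (s1 X)) P Q T U -> mfrac (val (s2 X)) U (- Q) (- T) P -> s1 (s2 X) = X.
  move=> h1 h2 nz1 e1 e2; have [sl1 s11 sM1] := h1.
  have rel : s2 X * (- T *: X + P%:A) = U *: X + (- Q)%:A.
    apply: val_inj; move: e2; rewrite /mfrac /linp.
    change (val (s2 X) * rfrac (- T *: 'X + P%:P) = rfrac (U *: 'X + (- Q)%:P) ->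
      val (s2 X) * (rfrac (- T)%:P * rfrac 'X + rfrac P%:P * 1) =
      rfrac U%:P * rfrac 'X + rfrac (- Q)%:P * 1).
    by rewrite !mulr1 -!mul_polyC !(rmorphD (@rfrac K)) !(rmorphM (@rfrac K)).
  have := congr1 s1 rel; rewrite sM1 !sl1 !(alg_homC _ h1) => /(congr1 val).
  rewrite Ra_valM.
  change (val (s1 (s2 X)) * (rfrac (- T)%:P * val (s1 X) + rfrac P%:P * 1) =
    rfrac U%:P * val (s1 X) + rfrac (- Q)%:P * 1 -> s1 (s2 X) = X).
  rewrite !mulr1 => /(mfrac_comp nz1 e1) e3.
  have id_nz : (1 : K) * 1 != 0 * 0 by rewrite mulr1 mulr0 oner_neq0.
  have eX : mfrac (val X) 1 0 0 1.
    by rewrite /mfrac /linp scale1r scale0r addr0 add0r (rmorph1 (@rfrac K)) mulr1.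
  have dnz : P * U - Q * T != 0 by rewrite subr_eq0.
  apply: val_inj; apply: (mob_mfrac _ id_nz _ e3 eX).
    rewrite -subr_eq0 (_ : _ - _ = (P * U - Q * T) ^+ 2); last by ring.
    by rewrite expf_neq0.
  move=> p; rewrite mob_scalar ?oner_neq0 // -[RHS](@mob_scalar _ (P * U - Q * T)) //.
  by congr mob; ring.
have e2 : mfrac (val (sg X)) A (- - B) (- - C) D by rewrite !opprK.
have st : sg (tg X) = X by apply: inv hs ht nz es et.
have ts : tg (sg X) = X by apply: inv ht hs nz' et e2.
exists sg; split=> //; have [sl s1 sM] := hs; have [tl t1 tM] := ht; split=> //.
have hid : is_alg_hom (fun u : R => u) by [].
exists tg => u.
  apply: (@Ra_hom_ext _ _ _ (fun u => tg (sg u)) _ _ hid ts).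
  by split=> [c x y||x y]; rewrite ?sl ?tl ?s1 ?t1 ?sM ?tM.
apply: (@Ra_hom_ext _ _ _ (fun u => sg (tg u)) _ _ hid st).
by split=> [c x y||x y]; rewrite ?tl ?sl ?t1 ?s1 ?tM ?sM.
Qed.

Theorem lie_aut_mob_perms : group_iso (LieAut (Virasoro a)) [subg H].
Proof.
have dl := @Rad_linear K n a; have dM := @RadM K n a; have dX := @RadX K n a.
have ext := @Ra_der_ext K n a.
apply: (group_iso_of_rel (rho := lie_perm_rel)).
- move=> phi; have [sg [hs hphi]] := lie_aut_alg_aut dl dM dX ext phi.
  have [A [B [C [D [nz e]]]]] := alg_aut_mfrac hs.
  have nz' : D * A != - B * - C by rewrite mulrNN mulrC.
  have [s rs] := realizes_of_stable ua (moebius_mob nz') (alg_aut_punctures hs nz e).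
  have := realizesV nz' rs; rewrite !opprK => rs'.
  have [Hs _] := realizes_mob_of (punctures_inj ua) m_gt2 rs'.
  by exists (subg H s^-1%g), sg, A, B, C, D; rewrite subgK.
- move=> s; have Hs := subgP s; have := mob_ofP Hs.
  set f := mob_of _ _ => -[mf fs]; have [A [B [C [D [nz E]]]]] := mf.
  have rs : realizes (punctures a) (mob A B C D) (sgval s).
    by split=> [|i]; [apply: moebius_mob | rewrite -E fs].
  have [sg [hs e]] := mfrac_alg_aut nz rs.
  have [phi hphi] := alg_aut_lie_aut hs.
  by exists phi, sg, A, B, C, D.
- move=> phi s t [sg [A [B [C [D [hs hphi nz e rs]]]]]] [sg' [A' [B' [C' [D' [hs' hphi' nz' e' rt]]]]]].
  have eX : sg X = sg' X by apply: (alg_aut_det dl dM dX hs hs' hphi hphi').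
  rewrite eX in e; have E := mfrac_mob nz nz' e e'.
  apply: val_inj; apply/permP => i; apply: (punctures_inj ua).
  by case: rs rt => _ fs [_ ft]; rewrite -fs -ft E.
- move=> phi psi s [sg [A [B [C [D [hs hphi nz e rs]]]]]] [sg' [A' [B' [C' [D' [hs' hphi' nz' e' rt]]]]]].
  have E := realizes_uniq (punctures_inj ua) m_gt2 rs rt.
  have eX : sg X = sg' X by apply: val_inj; apply: mob_mfrac nz nz' E e e'.
  have es := Ra_hom_ext (alg_aut_hom hs) (alg_aut_hom hs') eX.
  apply: (lie_aut_det hs hphi) => F u; rewrite !es; exact: hphi'.
move=> phi psi s t [sg [A [B [C [D [hs hphi nz e rs]]]]]] [sg' [A' [B' [C' [D' [hs' hphi' nz' e' rt]]]]]].
have [sl s1 sM [si sK siK]] := hs; have [sl' s1' sM' [si' sK' siK']] := hs'.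
exists (sg \o sg'), (A' * A + B' * C), (A' * B + B' * D), (C' * A + D' * C), (C' * B + D' * D).
split.
- split=> [c x y||x y|] /=; [by rewrite sl' sl|by rewrite s1' s1|by rewrite sM' sM|].
  by exists (si' \o si) => x /=; rewrite ?sK ?siK ?sK' ?siK'.
- move=> F u; rewrite -[LHS]/((phi (psi F)) (sg (sg' u))) hphi; congr sg; exact: hphi'.
- have dnz : A * D - B * C != 0 by rewrite subr_eq0.
  have dnz' : A' * D' - B' * C' != 0 by rewrite subr_eq0.
  rewrite -subr_eq0 (_ : _ - _ = (A * D - B * C) * (A' * D' - B' * C')); last by ring.
  by rewrite mulf_neq0.
- have rel : sg' X * (C' *: X + D'%:A) = A' *: X + B'%:A.
    apply: val_inj; move: e'; rewrite /mfrac /linp.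
    change (val (sg' X) * rfrac (C' *: 'X + D'%:P) = rfrac (A' *: 'X + B'%:P) ->
      val (sg' X) * (rfrac C'%:P * rfrac 'X + rfrac D'%:P * 1) =
      rfrac A'%:P * rfrac 'X + rfrac B'%:P * 1).
    by rewrite !mulr1 -!mul_polyC !(rmorphD (@rfrac K)) !(rmorphM (@rfrac K)).
  have := congr1 sg rel; rewrite sM !sl !(alg_homC _ (alg_aut_hom hs)) => /(congr1 val).
  rewrite Ra_valM => h0.
  have h : val (sg (sg' X)) * (rfrac C'%:P * val (sg X) + rfrac D'%:P * 1) =
    rfrac A'%:P * val (sg X) + rfrac B'%:P * 1 by exact: h0.
  by rewrite !mulr1 in h; exact: mfrac_comp nz e h.
have [mf fr] := realizesM rs rt; split.
  by apply: eq_moebius mf => p; rewrite /= mob_comp.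
by move=> i; rewrite -fr /= mob_comp.
Qed.

End LieAutGroup.

(** * Realization *)

Lemma prim_root_exists (K : numClosedFieldType) N : (0 < N)%N ->
  exists z : K, N.-primitive_root z.
Proof.
move=> N0; have [rs Dp] := closed_field_poly_normal ('X^N - 1 : {poly K}).
rewrite (monicP _) ?monicXnsubC // scale1r in Dp.
have sep : separable_poly ('X^N - 1 : {poly K}).
  by apply: separable_Xn_sub_1; rewrite pnatr_eq0 -lt0n.
have: has N.-primitive_root rs.
  apply: has_prim_root => //.
  - by apply/allP=> w wrs; rewrite /root_of_unity Dp root_prod_XsubC.
  - by rewrite -separable_prod_XsubC -Dp.
  by rewrite -ltnS -(size_prod_XsubC _ id) -Dp size_XnsubC.
by case/hasP=> w _ pw; exists w.
Qed.

Section RingSet.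
Variables (K : numClosedFieldType) (N : nat) (z : K) (T : seq K).
Hypotheses (prim : N.-primitive_root z) (T0 : 0 \notin T).

(** For positive T this is a set of N equally spaced points on each of the circles with radius in
    T. *)
Definition ring_set := [seq r * z ^+ k | r <- T, k <- iota 0 N].

Lemma mem_ring_set w : reflect (exists2 r, r \in T & w ^+ N = r ^+ N) (w \in ring_set).
Proof.
apply: (iffP allpairsP) => [[[r k] /= [rT _ ->]]|[r rT e]].
  by exists r => //; rewrite exprMn exprAC (prim_expr_order prim) expr1n mulr1.
have r0 : r != 0 by apply: contraNneq T0 => <-.
have wrN : (w / r) ^+ N = 1 by rewrite expr_div_n e divff // expf_neq0.
have [k ek] := prim_rootP prim wrN.
by exists (r, val k); rewrite /= mem_iota add0n ltn_ord; split=> //; rewrite -ek mulrC divfK.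
Qed.

Lemma ring_set_neq0 : 0 \notin ring_set.
Proof.
apply/negP=> /mem_ring_set[r rT]; have r0 : r != 0 by apply: contraNneq T0 => <-.
rewrite expr0n gtn_eqF ?(prim_order_gt0 prim) // => /esym/eqP.
by rewrite (negPf (expf_neq0 _ r0)).
Qed.

Lemma size_ring_set : size ring_set = (size T * N)%N.
Proof. by rewrite size_allpairs size_iota. Qed.

Lemma uniq_ring_set : uniq T -> {in T &, injective (fun r => r ^+ N)} -> uniq ring_set.
Proof.
move=> uT injT; apply: allpairs_uniq; [exact: uT | exact: iota_uniq |].
move=> _ _ /allpairsP[[r k] /= [rT + ->]] /allpairsP[[r' k'] /= [rT' + ->]] /=.
rewrite !mem_iota !add0n /= => kN kN' e.
have rr : r = r'.
  apply: injT => //; have := congr1 (fun u => u ^+ N) e.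
  by rewrite !exprMn ![(z ^+ _) ^+ N]exprAC (prim_expr_order prim) !expr1n !mulr1.
have r0 : r != 0 by apply: contraNneq T0 => <-.
rewrite -rr in e *; congr (_, _); have /eqP := mulfI r0 e.
by rewrite (eq_prim_root_expr prim) !modn_small // => /eqP.
Qed.

Lemma ring_set_rot w : w \in ring_set -> z * w \in ring_set.
Proof.
move/mem_ring_set=> [r rT e]; apply/mem_ring_set; exists r => //.
by rewrite exprMn (prim_expr_order prim) mul1r.
Qed.

End RingSet.

Lemma index2_of_mul (gT : finGroupType) (H L : {group gT}) t : L \subset H -> t \in H -> t \notin L ->
  {in H :\: L, forall y, y * t \in L}%g -> (2 * #|L|)%N = #|H|.
Proof.
move=> sLH Ht Lt mul.
have : H \subset L :|: (L :* t^-1)%g.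
  apply/subsetP=> y Hy; rewrite inE; case Ly: (y \in L) => //=.
  by rewrite mem_rcoset invgK mul // inE Ly.
move/subset_leq_card; rewrite -(Lagrange sLH) [(#|L| * _)%N]mulnC => le.
have : (1 < #|H : L|%g)%N by rewrite indexg_gt1; apply: contra Lt => /subsetP; apply.
have : (#|H : L|%g * #|L| <= 2 * #|L|)%N.
  by apply: leq_trans le _; rewrite cardsU card_rcoset mul2n -addnn leq_subr.
rewrite leq_pmul2r ?cardG_gt0 // => l2 l1; congr (_ * _)%N; apply/eqP.
by rewrite eqn_leq l1 l2.
Qed.

Section StabElements.
Variables (K : numClosedFieldType) (n : nat) (a : n.-tuple K).
Hypotheses (ua : uniq a) (n_gt1 : (1 < n)%N).
Local Notation H := (mob_perms_group (punctures a)).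
Local Notation mob_of := (mob_of (punctures a)).
Let m_gt2 : (2 < n.+1)%N. Proof. by []. Qed.
Let inj := punctures_inj ua.

Lemma punctureE p : is_puncture a p <-> if p is Some w then w \in (a : seq K) else true.
Proof.
split=> [[->|[j ->]]|]; [by [] | exact: mem_tnth |].
by case: p => [w /tnthP[j ->]|_]; [right; exists j | left].
Qed.

Lemma stab_elt f : moebius f -> (forall p, is_puncture a p -> is_puncture a (f p)) ->
  exists2 s, s \in H & mob_of s =1 f.
Proof.
move=> mf pf; have [s rs] := realizes_of_stable ua mf pf.
by have [Hs E] := realizes_mob_of inj m_gt2 rs; exists s => // p; rewrite E.
Qed.

Lemma stab_eltP s p : s \in H -> is_puncture a p -> is_puncture a (mob_of s p).
Proof. by move=> Hs; apply: (realizes_stable (mob_ofP Hs)). Qed.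

Definition scaling c : option K -> option K := omap ( *%R c).

Lemma scaling_moebius c : c != 0 -> moebius (scaling c).
Proof.
move=> c0; have nz : c * 1 != 0 * 0 by rewrite mulr1 mul0r.
apply: eq_moebius (moebius_mob nz) => -[w|] /=; rewrite /proj_point.
  by rewrite mul0r add0r oner_eq0 addr0 divr1.
by rewrite eqxx.
Qed.

Lemma iter_scaling c k : iter k (scaling c) =1 scaling (c ^+ k).
Proof.
elim: k => [|k IH] [w|] //=; first by rewrite expr0 mul1r.
  by rewrite IH /= exprS mulrA.
by rewrite IH.
Qed.

Lemma fix_0oo_scaling f : moebius f -> f None = None -> f (Some 0) = Some 0 ->
  exists2 c, c != 0 & f =1 scaling c.
Proof.
move=> mf foo f0; have [c [l [c0 E]]] := moebius_affine mf foo; exists c => //.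
have l0 : l = 0 by move: f0; rewrite E mulr0 add0r => -[].
by case=> [w|]; rewrite ?E ?l0 ?addr0.
Qed.

Lemma order_scaling s c N : s \in H -> N.-primitive_root c -> mob_of s =1 scaling c -> #[s]%g = N.
Proof.
move=> Hs pc E; have N0 := prim_order_gt0 pc.
have pow k : (s ^+ k == 1)%g = (c ^+ k == 1).
  apply/eqP/eqP => [sk|ck].
    have := mob_of_iter inj m_gt2 k Hs (Some 1); rewrite sk (mob_of1 inj m_gt2).
    have it : iter k (mob_of s) =1 iter k (scaling c) by elim: k {sk} => // k IH p; rewrite !iterS IH E.
    by rewrite it iter_scaling /= mulr1 => -[].
  apply: (mob_of_id inj) => [|p]; first exact: groupX.
  rewrite (mob_of_iter inj m_gt2) //.
  have -> : iter k (mob_of s) p = iter k (scaling c) p by elim: k {ck} => // k IH; rewrite !iterS IH E.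
  by rewrite iter_scaling ck; case: p => //= w; rewrite mul1r.
apply/eqP; rewrite eqn_dvd order_dvdn pow (prim_expr_order pc) eqxx /=.
by rewrite (prim_order_dvd pc) -pow expg_order eqxx.
Qed.

Lemma scaling_norm1 s c : s \in H -> c != 0 -> mob_of s =1 scaling c -> `|c| = 1.
Proof.
move=> Hs c0 E.
have it : iter #[s]%g (mob_of s) (Some 1) = scaling (c ^+ #[s]%g) (Some 1).
  by rewrite -iter_scaling; elim: #[s]%g => // k IH; rewrite !iterS IH E.
move: it; rewrite (mob_of_torsion inj m_gt2) //= mulr1 => -[/esym/(congr1 (fun u => `|u|))].
rewrite normrX normr1 => /eqP; rewrite pexpr_eq1 ?normr_ge0 ?order_gt0 //.
by move/eqP.
Qed.

Lemma not_exotic_rotation : ~ exotic H (fixer_group inj m_gt2) -> cyclic H \/ has_rotation_subgroup H.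
Proof. by case: (mob_perms_classification inj m_gt2) => // h _; [left | right]. Qed.

End StabElements.

(** * Stabilizers of concentric rings of points *)

Section RingPunctures.
Variables (K : numClosedFieldType) (n : nat) (a : n.-tuple K).
Variables (N : nat) (z : K) (T : seq K) (b : bool).
Hypotheses (ua : uniq a) (n_gt1 : (1 < n)%N).
Hypotheses (N_gt2 : (2 < N)%N) (prim : N.-primitive_root z).
Hypotheses (T_gt0 : {in T, forall r, 0 < r}) (T_nil : T != [::]).
Hypothesis aE : forall w, (w \in (a : seq K)) = b && (w == 0) || (w \in ring_set N z T).
Local Notation H := (mob_perms_group (punctures a)).
Local Notation mob_of := (mob_of (punctures a)).
Let m_gt2 : (2 < n.+1)%N. Proof. by []. Qed.
Let inj := punctures_inj ua.
Hypothesis notex : ~ exotic H (fixer_group inj m_gt2).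

Let T0 : 0 \notin T. Proof. by apply/negP=> /T_gt0; rewrite ltxx. Qed.
Let z_neq0 : z != 0. Proof.
apply: contraNneq (oner_neq0 K) => z0; rewrite -(prim_expr_order prim) z0 expr0n.
by rewrite gtn_eqF // (prim_order_gt0 prim).
Qed.

Lemma rotation_elt : exists2 x, x \in H & mob_of x =1 scaling z.
Proof.
apply: stab_elt => //; first exact: scaling_moebius.
move=> p /punctureE; case: p => [w|] /= aw; apply/punctureE => //=.
move: aw; rewrite !aE => /orP[/andP[-> /eqP ->]|rw]; first by rewrite mulr0 eqxx.
by rewrite (ring_set_rot prim) ?orbT.
Qed.

Variable x : 'S_n.+1.
Hypotheses (Hx : x \in H) (Ex : mob_of x =1 scaling z).

Lemma rotation_order : #[x]%g = N.
Proof. exact: order_scaling prim Ex. Qed.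

(** 0 and infinity are the fixed points of x, which has order N > 2, so [fix_preserved] applies. *)
Lemma poles_stable y p : y \in H -> p = None \/ p = Some 0 ->
  mob_of y p = None \/ mob_of y p = Some 0.
Proof.
move=> Hy hp; have xp : mob_of x p = p by rewrite Ex; case: hp => -> //=; rewrite mulr0.
have rot : cyclic H \/ has_rotation_subgroup H by exact: not_exotic_rotation notex.
have x2 : (2 < #[x]%g)%N by rewrite rotation_order.
have := fix_preserved inj m_gt2 rot Hx x2 Hy xp; rewrite Ex; case: (mob_of y p) => [w|] /=; last by left.
move=> [e]; right; congr Some; apply/eqP; have : (z - 1) * w == 0 by rewrite mulrBl e mul1r subrr.
rewrite mulf_eq0 subr_eq0 => /orP[/eqP z1|//].
by have := prim_order_dvd prim 1; rewrite z1 expr1 eqxx dvdn1 => /eqP N1; move: N_gt2; rewrite N1.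
Qed.

(** y is a scaling by some c of finite order, so |c| = 1. It maps a circle of the set to one of the
    same radius, that is to itself, whence c^N = 1. *)
Lemma fix_poles_cycle y : y \in H -> mob_of y None = None -> mob_of y (Some 0) = Some 0 ->
  y \in <[x]>%g.
Proof.
move=> Hy yoo y0; have [c c0 Ec] := fix_0oo_scaling (mob_of_moebius Hy) yoo y0.
have c1 := (scaling_norm1 ua n_gt1 Hy c0 Ec).
have [r rT] : exists r, r \in T by case: T T_nil => // r s _; exists r; rewrite inE eqxx.
have r0 := T_gt0 rT.
have pr : is_puncture a (Some r).
  by apply/punctureE; rewrite aE; apply/orP; right; apply/mem_ring_set => //; exists r.
have := stab_eltP Hy pr; rewrite Ec /= => /punctureE; rewrite aE mulf_eq0 (negPf c0) gt_eqF //= andbF /=.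
case/mem_ring_set => // r' rT' e; have r0' := T_gt0 rT'.
have rr : r = r'.
  apply: (@pexpIrn _ N); rewrite ?nnegrE ?ltW // ?(ltn_trans _ N_gt2) //.
  have := congr1 (fun u => `|u|) e; rewrite !normrX normrM c1 mul1r.
  by rewrite !gtr0_norm.
have cN : c ^+ N = 1.
  move: e; rewrite -rr exprMn -{2}[r ^+ N]mul1r => /mulIf; apply.
  by rewrite expf_neq0 // gt_eqF.
have [k ek] := prim_rootP prim cN; apply/cycleP; exists k.
apply: (mob_of_inj inj) => [||p] //; first exact: groupX.
rewrite (mob_of_iter inj m_gt2) // Ec ek -iter_scaling.
by elim: (val k) p => // i IH p; rewrite !iterS IH Ex.
Qed.

Lemma poles_fixed_or_swapped y : y \in H ->
  mob_of y None = None /\ mob_of y (Some 0) = Some 0 \/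
  mob_of y None = Some 0 /\ mob_of y (Some 0) = None.
Proof.
move=> Hy; have iy := moebius_inj (mob_of_moebius Hy).
have := poles_stable Hy (or_introl erefl); have := poles_stable Hy (or_intror erefl).
by case=> e1 [] e2; [have := iy _ _ (etrans e1 (esym e2))|right|left|have := iy _ _ (etrans e1 (esym e2))].
Qed.

Lemma ring_cyclic : b = false -> cyclic H /\ #|H| = N.
Proof.
move=> bF; suff -> : H = <[x]>%G by rewrite cycle_cyclic -orderE rotation_order.
apply/val_inj/eqP; rewrite /= eqEsubset cycle_subG Hx andbT; apply/subsetP=> y Hy.
case: (poles_fixed_or_swapped Hy) => -[yoo y0]; first exact: fix_poles_cycle.
have : is_puncture a (mob_of y None) by apply: stab_eltP => //; left.
by rewrite yoo => /punctureE; rewrite aE bF /= (negPf (ring_set_neq0 prim T0)).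
Qed.

Lemma ring_dihedral t : t \in H -> mob_of t None = Some 0 ->
  [/\ <[x]>%g \subset H, (2 * #|<[x]>%g|)%N = #|H| & {in H :\: <[x]>, forall y, y ^+ 2 = 1}%g].
Proof.
move=> Ht too; have sx : <[x]>%g \subset H by rewrite cycle_subG.
have cyc_oo y : y \in <[x]>%g -> mob_of y None = None.
  case/cycleP=> k ->; rewrite (mob_of_iter inj m_gt2) //.
  by elim: k => // k IH; rewrite iterS IH Ex.
have swp y : y \in H -> y \notin <[x]>%g -> mob_of y None = Some 0 /\ mob_of y (Some 0) = None.
  move=> Hy nxy; case: (poles_fixed_or_swapped Hy) => // -[yoo y0].
  by rewrite fix_poles_cycle in nxy.
have nxt : t \notin <[x]>%g by apply/negP=> /cyc_oo; rewrite too.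
split=> //.
  apply: (index2_of_mul (L := <[x]>%G) sx Ht nxt) => y /setDP[Hy nxy].
  have [yoo y0] := swp y Hy nxy; have [too' t0] := swp t Ht nxt.
  by apply: fix_poles_cycle; rewrite ?groupM // (mob_ofM inj m_gt2) //= ?yoo ?y0.
move=> y /setDP[Hy nxy]; have [yoo y0] := swp y Hy nxy.
apply: (mob_of_id inj) => [|p]; first exact: groupX.
rewrite (mob_of_iter inj m_gt2) //.
by apply: (moebius_swap (mob_of_moebius Hy) (p := None) (q := Some 0)).
Qed.

End RingPunctures.

Section Realization.
Variable K : numClosedFieldType.

Lemma cyclic_realized N : (2 < N)%N -> exists (n : nat) (a : n.-tuple K),
  [/\ (1 < n)%N, uniq a & iso_cyclic (LieAut (Virasoro a)) N].
Proof.
move=> N3; have N0 : (0 < N)%N by apply: leq_trans N3.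
have [z pz] := @prim_root_exists K N N0.
(* Two circles and infinity make 2N + 1 points, an odd number. Since 0 is left out, no symmetry can
   send infinity to it. *)
pose T : seq K := [:: 1; 2%:R].
have T_gt0 : {in T, forall r, 0 < r} by move=> r; rewrite !inE => /orP[] /eqP ->; rewrite ?ltr01 ?ltr0n.
have T0 : 0 \notin T by apply/negP=> /T_gt0; rewrite ltxx.
have sz := size_ring_set N z T.
pose a := in_tuple (ring_set N z T).
have ua : uniq a.
  apply: (uniq_ring_set pz T0); first by rewrite /= inE andbT lt_eqF // ltr1n.
  move=> r r' /T_gt0 r0 /T_gt0 r0' /=; apply: pexpIrn; rewrite // nnegrE ltW //.
have n1 : (1 < size (ring_set N z T))%N by rewrite sz /=; lia.
exists _, a; split=> //.
have notex : ~ exotic (mob_perms_group (punctures a))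
    (fixer_group (punctures_inj ua) (n1 : 2 < _.+1)%N).
  by move/exotic_even; rewrite sz /= mul2n odd_double.
have aE w : (w \in (a : seq K)) = false && (w == 0) || (w \in ring_set N z T) by [].
have [x Hx Ex] := rotation_elt ua n1 pz T_gt0 aE.
have R := ring_cyclic N3 pz T_gt0 (isT : T != [::]) aE.
have [cH oH] := R ua n1 notex x Hx Ex erefl.
by have := cyclic_iso_cyclic (lie_aut_mob_perms ua n1) cH; rewrite oH.
Qed.

Lemma inversion_moebius : moebius (mob 0 1 1 0 : option K -> option K).
Proof. by apply: moebius_mob; rewrite mul0r mulr1 eq_sym oner_neq0. Qed.

Lemma dihedral_realized N : (2 < N)%N -> exists (n : nat) (a : n.-tuple K),
  [/\ (1 < n)%N, uniq a & iso_dihedral (LieAut (Virasoro a)) N].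
Proof.
move=> N3; have N0 : (0 < N)%N by apply: leq_trans N3.
have [z pz] := @prim_root_exists K N N0.
(* This gives 5N + 2 punctures: an odd number for N = 3 and N = 5, and 22 = 1 mod 3 for
   N = 4, where the octahedral group has to be excluded. *)
pose T : seq K := [:: 1; 2; 2^-1; 3; 3^-1].
have T_gt0 : {in T, forall r, 0 < r}.
  by apply/allP; rewrite /= !invr_gt0 ltr01 !ltr0n.
have T0 : 0 \notin T by apply/negP=> /T_gt0; rewrite ltxx.
(* This makes w -> 1 / w a symmetry, which swaps 0 and infinity. *)
have TV r : r \in T -> r^-1 \in T.
  rewrite !inE => /or4P[/eqP->|/eqP->|/eqP->|/orP[/eqP->|/eqP->]];
    by rewrite ?invr1 ?invrK !eqxx ?orbT.
have uT : uniq T.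
  have h3 : (3^-1 : K) < 2^-1 by rewrite ltf_pV2 ?posrE ?ltr0n // ltr_nat.
  have h2 : (2^-1 : K) < 1 by rewrite invf_lt1 ?ltr0n // ltr1n.
  have h1 : (1 : K) < 2 by rewrite ltr1n.
  have h0 : (2 : K) < 3 by rewrite ltr_nat.
  have : sorted <%R [:: 3^-1; 2^-1; 1; 2; 3 : K] by rewrite /= h3 h2 h1 h0.
  move/lt_sorted_uniq; rewrite (perm_uniq (_ : perm_eq _ T)) //.
  by apply/seq.permP => P /=; ring.
have sz := size_ring_set N z T.
pose a := in_tuple (0 :: ring_set N z T).
have ua : uniq a.
  rewrite /= (ring_set_neq0 pz T0); apply: (uniq_ring_set pz T0 uT).
  by move=> r r' /T_gt0 r0 /T_gt0 r0' /=; apply: pexpIrn; rewrite // nnegrE ltW.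
have n1 : (1 < size (0%R :: ring_set N z T))%N by rewrite /= sz /=; lia.
exists _, a; split=> //.
have aE w : (w \in (a : seq K)) = true && (w == 0) || (w \in ring_set N z T) by [].
have [x Hx Ex] := rotation_elt ua n1 pz T_gt0 aE.
have ox : #[x]%g = N by exact: order_scaling pz Ex.
have notex : ~ exotic (mob_perms_group (punctures a))
    (fixer_group (punctures_inj ua) (n1 : 2 < (size (0%R :: ring_set N z T)).+1)%N).
  (* Only even N >= 4 pass, and the orders then leave just N = 4 in the octahedral case. For this N
     a single circle would produce the octahedron itself, and three circles 14 points, a number that
     [octahedral_mod3] admits. *)
  move=> ex; have := exotic_even ex; rewrite /= sz /= => ev.
  case: ex => [[_ o]|oct|[_ o]].
  - by have := o x Hx; rewrite ox; move: N3 ev; clear; case: N => [|[|[|[|[|]]]]].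
  - have := octahedral_mod3 oct; rewrite /= sz /=; case: oct => _ /(_ x Hx) + _.
    by rewrite ox; move: N3 ev; clear; case: N => [|[|[|[|[|]]]]].
  by have := o x Hx; rewrite ox !inE; move: N3 ev; clear; case: N => [|[|[|[|[|[|]]]]]].
have [t Ht Et] : exists2 t, t \in mob_perms_group (punctures a) & mob_of (punctures a) t =1 mob 0 1 1 0.
  apply: stab_elt => //; first exact: inversion_moebius.
  case=> [w|] /= /punctureE aw; apply/punctureE; rewrite /proj_point ?mul0r ?mul1r ?add0r ?addr0.
    case: eqP => // w0; move: aw; rewrite div1r !aE /= invr_eq0 => /orP[->//|].
    move/(mem_ring_set pz T0) => [r rT e]; apply/orP; right; apply/(mem_ring_set pz T0).
    by exists r^-1; [exact: TV | rewrite !exprVn e].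
  by rewrite oner_eq0 aE eqxx.
have too : mob_of (punctures a) t None = Some 0 by rewrite Et /= /proj_point oner_eq0 mul0r.
have R := ring_dihedral N3 pz T_gt0 (isT : T != [::]) aE.
have [sx cx inv] := R ua n1 notex x Hx Ex t Ht too.
have := rotation_iso_dihedral (K := <[x]>%G) (lie_aut_mob_perms ua n1) sx (cycle_cyclic x) cx inv.
by rewrite /= -orderE ox.
Qed.

End Realization.

(** * Tetrahedron, octahedron and icosahedron *)

Section Exotic.
Variables (K : numClosedFieldType).

(** The rotation by z has order greater than 2 and fixes infinity, while f moves infinity to a point
    that the rotation does not fix. This cannot happen in the cyclic and dihedral cases. *)
Lemma exotic_from_scaling n (a : n.-tuple K) N z f (ua : uniq a) (m2 : (2 < n.+1)%N) :
  (2 < N)%N -> N.-primitive_root z -> moebius f ->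
  (forall p, is_puncture a p -> is_puncture a (scaling z p)) ->
  (forall p, is_puncture a p -> is_puncture a (f p)) ->
  scaling z (f None) <> f None ->
  exotic (mob_perms_group (punctures a)) (fixer_group (punctures_inj ua) m2) /\
  exists2 x, x \in mob_perms_group (punctures a) & #[x]%g = N.
Proof.
move=> N2 pz mf sz sf nf.
have z0 : z != 0.
  apply: contraNneq (oner_neq0 K) => z0; rewrite -(prim_expr_order pz) z0 expr0n.
  by rewrite gtn_eqF // (prim_order_gt0 pz).
have [x Hx Ex] := stab_elt ua m2 (scaling_moebius z0) sz.
have [y Hy Ey] := stab_elt ua m2 mf sf.
have ox : #[x]%g = N by exact: order_scaling pz Ex.
split; last by exists x.
have x2 : (2 < #[x]%g)%N by rewrite ox.
apply: (exotic_of_move (punctures_inj ua) m2 (p := None) Hx x2 Hy); first by rewrite Ex.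
by rewrite Ey Ex.
Qed.

Lemma card_mob_perms m (pts : 'I_m -> option K) (H : {group 'S_m}) : (#|H| <= m`!)%N.
Proof. by rewrite -[X in X`!]card_ord -card_Sym subset_leq_card ?subsetT. Qed.

Lemma tetrahedral_realized : exists (n : nat) (a : n.-tuple K),
  [/\ (1 < n)%N, uniq a & group_iso (LieAut (Virasoro a)) [subg 'Alt_('I_4)]].
Proof.
have [z pz] := @prim_root_exists K 3 isT.
have T0 : (0 : K) \notin [:: 1] by rewrite inE eq_sym oner_eq0.
have sz : size (ring_set 3 z [:: 1]) == 3 by rewrite size_ring_set.
pose a : 3.-tuple K := Tuple sz.
have ua : uniq a by apply: (uniq_ring_set pz T0) => // r r'; rewrite !inE => /eqP -> /eqP ->.
exists 3, a; split=> //.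
have aP w : (w \in (a : seq K)) = (w ^+ 3 == 1).
  apply/(mem_ring_set pz T0)/eqP => [[r]|e]; first by rewrite inE => /eqP ->; rewrite expr1n.
  by exists 1; rewrite ?inE // expr1n.
(* The map (w + 2) / (w - 1) swaps 1 with infinity and the two primitive cube roots of 1 with each
   other. *)
have nz : (1 : K) * (- 1) != 2 * 1.
  by rewrite -subr_eq0 mul1r mulr1 -opprD oppr_eq0 -(natrD _ 1 2) pnatr_eq0.
have [|||ex [x Hx ox]] := exotic_from_scaling ua isT (isT : (2 < 3)%N) pz (moebius_mob nz).
- case=> [w|] /punctureE; rewrite /= ?aP => aw; apply/punctureE; rewrite //= aP.
  by rewrite exprMn (prim_expr_order pz) mul1r.
- case=> [w|] /punctureE /=; rewrite ?aP => aw; apply/punctureE; rewrite /proj_point; last first.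
    by rewrite oner_eq0 divr1 aP expr1n.
  case: eqP => // /eqP w1; rewrite aP; rewrite !mul1r in w1 *.
  have w2 : w ^+ 2 = - 1 - w.
    apply: (mulfI w1); have -> : (w + -1) * w ^+ 2 = w ^+ 3 - w ^+ 2 by ring.
    by rewrite (eqP aw); ring.
  rewrite expr_div_n; have -> : (w + 2) ^+ 3 = (w + -1) ^+ 3.
    apply/eqP; rewrite -subr_eq0; apply/eqP.
    have -> : (w + 2) ^+ 3 - (w + -1) ^+ 3 = 9 * w ^+ 2 + 9 * w + 9 by ring.
    by rewrite w2; ring.
  by rewrite divff // expf_neq0.
- have -> : mob 1 2 1 (- 1) None = Some 1 :> option K by rewrite /= /proj_point oner_eq0 divr1.
  rewrite /= mulr1 => -[z1].
  by have := prim_order_dvd pz 1; rewrite z1 expr1 eqxx.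
have iso := lie_aut_mob_perms ua (isT : (1 < 3)%N).
(* Four points are 1 mod 3, and at most 24 permutations of them exist, against 60 elements of
   A_5. *)
case: ex => [[tet _] | oct | [ico _]].
- exact: group_iso_isog iso tet.
- by have := octahedral_mod3 oct.
have := card_isog ico; have := card_mob_perms (punctures a) (mob_perms_group (punctures a)) => le e.
have := card_Alt (T := 'I_5); rewrite card_ord -e => /(_ isT) c.
have : (2 * #|mob_perms_group (punctures a)| <= 2 * 4`!)%N by rewrite leq_mul2l.
by rewrite c.
Qed.

Lemma octahedral_realized : exists (n : nat) (a : n.-tuple K),
  [/\ (1 < n)%N, uniq a & group_iso (LieAut (Virasoro a)) [subg 'Sym_('I_4)]].
Proof.
have [z pz] := @prim_root_exists K 4 isT.
have T0 : (0 : K) \notin [:: 1] by rewrite inE eq_sym oner_eq0.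
have sz : size (0 :: ring_set 4 z [:: 1]) == 5.
  by rewrite -[size _]/(size (ring_set 4 z [:: 1])).+1 size_ring_set.
pose a : 5.-tuple K := Tuple sz.
have ua : uniq a.
  rewrite cons_uniq (ring_set_neq0 pz T0); apply: (uniq_ring_set pz T0) => // r r'.
  by rewrite !inE => /eqP -> /eqP ->.
exists 5, a; split=> //.
have aP w : (w \in (a : seq K)) = (w == 0) || (w ^+ 4 == 1).
  rewrite inE; congr (_ || _); apply/(mem_ring_set pz T0)/eqP => [[r]|e].
    by rewrite inE => /eqP ->; rewrite expr1n.
  by exists 1; rewrite ?inE // expr1n.
(* The map (w + 1) / (1 - w) is the quarter turn about the square roots of -1, with the cycle 0, 1,
   infinity, -1. *)
have nz : (1 : K) * 1 != 1 * (- 1).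
  by rewrite -subr_eq0 !mul1r opprK -(natrD _ 1 1) pnatr_eq0.
have [|||ex [x Hx ox]] := exotic_from_scaling ua isT (isT : (2 < 4)%N) pz (moebius_mob nz).
- case=> [w|] /punctureE; rewrite /= ?aP => aw; apply/punctureE; rewrite //= aP.
  case/orP: aw => [/eqP->|aw]; first by rewrite mulr0 eqxx.
  by rewrite exprMn (prim_expr_order pz) mul1r aw orbT.
- case=> [w|] /punctureE /=; rewrite ?aP => aw; apply/punctureE; rewrite /proj_point; last first.
    have -> : 1 / - 1 = - 1 :> K by rewrite invrN invr1 mul1r.
    have -> : (- 1 == 0 :> K) = false by rewrite oppr_eq0 oner_eq0.
    by rewrite aP (_ : (- 1) ^+ 4 = 1 :> K) ?eqxx ?orbT //; ring.
  case: eqP => // /eqP w1; rewrite aP; rewrite mul1r in w1 *.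
  case/orP: aw => [/eqP w0|/eqP w4].
    by rewrite w0 mulr0 !add0r divr1 expr1n eqxx orbT.
  have : (w - 1) * ((w + 1) * (w ^+ 2 + 1)) = 0.
    have -> : (w - 1) * ((w + 1) * (w ^+ 2 + 1)) = w ^+ 4 - 1 by ring.
    by rewrite w4 subrr.
  move/eqP; rewrite !mulf_eq0 => /or3P[] /eqP h.
  - by case/eqP: w1; rewrite -[RHS]oppr0 -h; ring.
  - by rewrite h mul0r eqxx.
  apply/orP; right; apply/eqP; rewrite -[RHS]w4; congr (_ ^+ 4).
  apply: (mulIf w1); rewrite divfK //.
  by apply/eqP; rewrite -subr_eq0 -h; apply/eqP; ring.
- have -> : mob 1 1 (- 1) 1 None = Some (- 1) :> option K.
    by rewrite /= /proj_point oppr_eq0 oner_eq0 invrN invr1 mul1r.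
  rewrite /= mulrN1 => -[/oppr_inj z1].
  by have := prim_order_dvd pz 1; rewrite z1 expr1 eqxx.
have iso := lie_aut_mob_perms ua (isT : (1 < 5)%N).
case: ex => [[_ o] | [oct _ _] | [_ o]].
- by have := o x Hx; rewrite ox.
- exact: group_iso_isog iso oct.
by have := o x Hx; rewrite ox.
Qed.

(* The vertices of an icosahedron with opposite vertices at 0 and infinity; the other
   ones are [g * z ^+ k] and [h * z ^+ k] with [h = - 1 / g]. *)
Lemma icosahedral_realized : exists (n : nat) (a : n.-tuple K),
  [/\ (1 < n)%N, uniq a & group_iso (LieAut (Virasoro a)) [subg 'Alt_('I_5)]].
Proof.
have [z pz] := @prim_root_exists K 5 isT.
have z1 : z - 1 != 0.
  rewrite subr_eq0; apply/eqP=> z1.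
  by have := prim_order_dvd pz 1; rewrite z1 expr1 eqxx.
have z4 : z ^+ 4 = - 1 - z - z ^+ 2 - z ^+ 3.
  apply: (mulfI z1); have -> : (z - 1) * z ^+ 4 = z ^+ 5 - z ^+ 4 by ring.
  by rewrite (prim_expr_order pz); ring.
pose g := z + z ^+ 4; pose h := z ^+ 2 + z ^+ 3.
have gE : g = - 1 - z ^+ 2 - z ^+ 3 by rewrite /g z4; ring.
have g2 : g ^+ 2 = 1 - g by rewrite gE; ring: z4.
have gh : g * h = - 1 by rewrite gE /h; ring: z4.
have hE : h = - 1 - g by rewrite gE /h; ring.
have g0 : g != 0 by apply: contra_eq_neq gh => ->; rewrite mul0r eq_sym oppr_eq0 oner_eq0.
have h0 : h != 0 by apply: contra_eq_neq gh => ->; rewrite mulr0 eq_sym oppr_eq0 oner_eq0.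
have n5 : (5 : K) != 0 by rewrite pnatr_eq0.
have T0 : (0 : K) \notin [:: g; h] by rewrite !inE negb_or ![0 == _]eq_sym g0.
(* g and h are the roots of X^2 + X - 1, so (g - h)^2 = 5. *)
have gh5 : g - h != 0.
  apply: contraNneq n5 => e; have -> : (5 : K) = (g - h) ^+ 2 - 4 * (g ^+ 2 - (1 - g)) by rewrite hE; ring.
  by rewrite e g2 subrr mulr0 expr0n subr0.
have g5 : g ^+ 5 = 5 * g - 3 by ring: g2.
have h5 : h ^+ 5 = 5 * h - 3 by rewrite hE; ring: g2.
have injT : {in [:: g; h] &, injective (fun r => r ^+ 5)}.
  have ne : g ^+ 5 != h ^+ 5.
    rewrite -subr_eq0 g5 h5 (_ : _ - _ = 5 * (g - h)); last by ring.
    by rewrite mulf_neq0.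
  move=> r r'; rewrite !inE => /orP[]/eqP-> /orP[]/eqP-> // e; by rewrite e eqxx in ne.
have sz : size (0 :: ring_set 5 z [:: g; h]) == 11.
  by rewrite -[size _]/(size (ring_set 5 z [:: g; h])).+1 size_ring_set.
pose a : 11.-tuple K := Tuple sz.
have ua : uniq a.
  rewrite cons_uniq (ring_set_neq0 pz T0); apply: (uniq_ring_set pz T0) => //.
  by rewrite /= inE andbT -subr_eq0.
exists 11, a; split=> //.
have aE w : (w \in (a : seq K)) = (w == 0) || (w \in ring_set 5 z [:: g; h]) by [].
have ag k : g * z ^+ k \in ring_set 5 z [:: g; h].
  apply/(mem_ring_set pz T0); exists g; first by rewrite inE eqxx.
  by rewrite exprMn exprAC (prim_expr_order pz) expr1n mulr1.
have ah k : h * z ^+ k \in ring_set 5 z [:: g; h].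
  apply/(mem_ring_set pz T0); exists h; first by rewrite !inE eqxx orbT.
  by rewrite exprMn exprAC (prim_expr_order pz) expr1n mulr1.
(* The map (g w + 1) / (w - g) has trace zero: it is the half turn that swaps infinity with g and 0
   with h. *)
have nz : g * (- g) != 1 * 1.
  apply: contraNneq n5 => e.
  have gg : g ^+ 2 = - (1 * 1) by rewrite -e; ring.
  have e2 : g = 2 by transitivity (1 - (1 - g)); [ring | rewrite -g2 gg; ring].
  have -> : (5 : K) = g ^+ 2 - (1 - g) by rewrite e2; ring.
  by rewrite g2 subrr.
have [|||ex [x Hx ox]] := exotic_from_scaling ua isT (isT : (2 < 5)%N) pz (moebius_mob nz).
- case=> [w|] /punctureE; rewrite /= ?aE => aw; apply/punctureE; rewrite //= aE.
  case/orP: aw => [/eqP->|aw]; first by rewrite mulr0 eqxx.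
  by rewrite (ring_set_rot pz T0) ?orbT.
- case=> [w|] /punctureE; last first.
    move=> _; apply/punctureE; rewrite /= /proj_point oner_eq0 divr1 aE.
    by have := ag 0; rewrite expr0 mulr1 => ->; rewrite orbT.
  rewrite aE => aw; apply/punctureE; rewrite /= /proj_point mul1r.
  case: eqP => // /eqP nw; rewrite aE.
  have to v : g * w + 1 = (w - g) * v -> v \in ring_set 5 z [:: g; h] ->
      ((g * w + 1) / (w + - g) == 0) || ((g * w + 1) / (w + - g) \in ring_set 5 z [:: g; h]).
    by move=> -> av; rewrite mulrC mulrA mulVf // mul1r av orbT.
  case/orP: aw => [/eqP w0|].
    apply: (to (h * z ^+ 0)) => //; rewrite w0 mulr0 !add0r mulr1 mulNr gh opprK //.
  move/allpairsP=> [[r k] /= [rT kT wE]]; rewrite !inE in rT kT; case/orP: rT => /eqP rE;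
    rewrite rE in wE; move: kT => /or4P[/eqP kE|/eqP kE|/eqP kE|/orP[/eqP kE|/eqP kE]];
    rewrite kE in wE; rewrite {}wE {r k rE kE} in nw to *.
  - by move: nw; rewrite expr0 mulr1 subrr eqxx.
  - by apply: (to (h * z ^+ 1)) => //; rewrite gE /h; ring: z4.
  - by apply: (to (g * z ^+ 3)) => //; rewrite gE; ring: z4.
  - by apply: (to (g * z ^+ 2)) => //; rewrite gE; ring: z4.
  - by apply: (to (h * z ^+ 4)) => //; rewrite gE /h; ring: z4.
  - by rewrite expr0 mulr1 gh addNr mul0r eqxx.
  - by apply: (to (g * z ^+ 1)) => //; rewrite gE /h; ring: z4.
  - by apply: (to (h * z ^+ 3)) => //; rewrite gE /h; ring: z4.
  - by apply: (to (h * z ^+ 2)) => //; rewrite gE /h; ring: z4.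
  - by apply: (to (g * z ^+ 4)) => //; rewrite gE /h; ring: z4.
- rewrite /= /proj_point oner_eq0 divr1 => -[zg].
  case/eqP: z1; apply: (mulIf g0); rewrite mulrBl zg mul0r mul1r subrr //.
have iso := lie_aut_mob_perms ua (isT : (1 < 11)%N).
case: ex => [[_ o] | [_ o _] | [ico _]].
- by have := o x Hx; rewrite ox.
- by have := o x Hx; rewrite ox.
exact: group_iso_isog iso ico.
Qed.

End Exotic.

(** * Cross-ratios *)

Section CrossRatio.
Variable K : numClosedFieldType.

Definition hcoord (p : option K) : K * K := if p is Some w then (w, 1) else (1, 0).
Definition dt (R : pzRingType) (p q : R * R) : R := p.1 * q.2 - q.1 * p.2.

Lemma hcoord_proj_point (u v : K) : (u != 0) || (v != 0) ->
  exists l, [/\ l != 0, u = l * (hcoord (proj_point u v)).1 & v = l * (hcoord (proj_point u v)).2].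
Proof.
rewrite /proj_point; case: (eqVneq v 0) => [->|v0] /=.
  by rewrite orbF => u0; exists u; rewrite mulr1 mulr0.
by move=> _; exists v; rewrite mulr1 mulrC divfK.
Qed.

Lemma hcoord_moebius f : moebius f -> exists (k : K) (l : option K -> K), forall p, l p != 0 /\
  forall q, l p * l q * dt (hcoord (f p)) (hcoord (f q)) = k * dt (hcoord p) (hcoord q).
Proof.
move=> [A [B [C [D [nz E]]]]]; exists (A * D - B * C).
have h p : exists l, [/\ l != 0, A * (hcoord p).1 + B * (hcoord p).2 = l * (hcoord (f p)).1 &
    C * (hcoord p).1 + D * (hcoord p).2 = l * (hcoord (f p)).2].
  rewrite E; case: p => [w|] /=; rewrite !(mulr1, mulr0, addr0); apply: hcoord_proj_point.
    exact: mob_nz.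
  exact: mob_nz_oo nz.
exists (fun p => projT1 (cid (h p))) => p; case: (cid (h p)) => lp [l0 e1 e2]; split=> //= q.
case: (cid (h q)) => lq [l0' e1' e2'] /=; rewrite /dt.
transitivity (lp * (hcoord (f p)).1 * (lq * (hcoord (f q)).2)
    - lq * (hcoord (f q)).1 * (lp * (hcoord (f p)).2)); first by ring.
by rewrite -e1 -e2 -e1' -e2'; ring.
Qed.

(** Clearing denominators spares a separate treatment of infinity and of coinciding points. The
    scale factors l cancel because each image occurs once on either side. *)
Lemma cross_ratio f p q r s : moebius f -> let d x y := dt (hcoord x) (hcoord y) in
  d (f p) (f r) * d (f q) (f s) * d p s * d q r = d (f p) (f s) * d (f q) (f r) * d p r * d q s.
Proof.
move=> /hcoord_moebius[k [l H]] d.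
have E x y : l x * l y * d (f x) (f y) = k * d x y by have [_] := H x; apply.
have L x : l x != 0 by have [] := H x.
apply: (mulfI (mulf_neq0 (mulf_neq0 (L p) (L q)) (mulf_neq0 (L r) (L s)))).
transitivity ((l p * l r * d (f p) (f r)) * (l q * l s * d (f q) (f s)) * d p s * d q r); first by ring.
rewrite !E; transitivity ((k * d p s) * (k * d q r) * d p r * d q s); first by ring.
by rewrite -!E; ring.
Qed.

End CrossRatio.

Section IntegerPunctures.
Variables (K : numClosedFieldType) (n : nat) (a : n.-tuple K) (zs : seq int).
Hypotheses (n_gt1 : (1 < n)%N) (azs : (a : seq K) = [seq w%:~R | w <- zs]).
Local Notation H := (mob_perms_group (punctures a)).

Definition int_coords : seq (int * int) := (1, 0) :: [seq (w, 1) | w <- zs].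

(** This is [cross_ratio] for the points of index 0, 1, 2, l in integer coordinates, so that all
    permutations, given as words of values, can be tested by computation. *)
Definition preserves_cross_ratio (t : seq nat) :=
  let d i j := dt (nth (0, 0) int_coords i) (nth (0, 0) int_coords j) in
  let e i j := d (nth 0%N t i) (nth 0%N t j) in
  all (fun l => e 0%N 2%N * e 1%N l * d 0%N l * d 1%N 2%N ==
    e 0%N l * e 1%N 2%N * d 0%N 2%N * d 1%N l) (iota 0 n.+1).

Definition perm_word (s : 'S_n.+1) : seq nat := [seq val (s i) | i <- enum 'I_n.+1].

Lemma nth_perm_word s (i : 'I_n.+1) : nth 0%N (perm_word s) i = s i.
Proof. by rewrite (nth_map i) ?size_enum_ord // nth_ord_enum. Qed.

Lemma hcoord_punctures (i : 'I_n.+1) :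
  hcoord (punctures a i) = ((nth (0, 0) int_coords i).1%:~R, (nth (0, 0) int_coords i).2%:~R).
Proof.
rewrite /punctures; case: unliftP => [j ->|-> //]; rewrite lift0 /=.
have sz : size zs = n by rewrite -(size_map (fun w => w%:~R : K)) -azs size_tuple.
rewrite (nth_map 0) ?sz //=.
by rewrite (tnth_nth 0) azs (nth_map 0) ?sz.
Qed.

Lemma perm_word_cross_ratio s : s \in H -> preserves_cross_ratio (perm_word s).
Proof.
move=> Hs; have [mf fs] := mob_ofP Hs; apply/allP=> l; rewrite mem_iota add0n => /andP[_ ln].
have dE (i j : 'I_n.+1) : dt (hcoord (punctures a i)) (hcoord (punctures a j)) =
    (dt (nth (0, 0) int_coords i) (nth (0, 0) int_coords j))%:~R :> K.
  by rewrite !hcoord_punctures /dt /= rmorphB !rmorphM.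
pose i0 : 'I_n.+1 := ord0; pose i1 : 'I_n.+1 := Ordinal (leqW n_gt1 : 1 < n.+1)%N.
pose i2 : 'I_n.+1 := Ordinal (n_gt1 : 2 < n.+1)%N; pose il := Ordinal ln.
have := cross_ratio (punctures a i0) (punctures a i1) (punctures a i2) (punctures a il) mf.
rewrite /= !fs !dE -!rmorphM /= => /intr_inj e; apply/eqP.
have nE (i : 'I_n.+1) := nth_perm_word s i.
rewrite -(nE i0) -(nE i1) -(nE i2) -(nE il) in e.
exact: e.
Qed.

Lemma perm_word_inj : injective perm_word.
Proof.
move=> s t e; apply/permP=> i; apply: val_inj.
by rewrite /= -!nth_perm_word e.
Qed.

Lemma perm_word_allowed (allowed : seq (seq nat)) s :
  all (fun t => preserves_cross_ratio t ==> (t \in allowed)) (permutations (iota 0 n.+1)) ->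
  s \in H -> perm_word s \in allowed.
Proof.
move=> /allP h Hs; have := h (perm_word s); rewrite perm_word_cross_ratio // implyTb; apply.
rewrite mem_permutations; apply: uniq_perm; [| exact: (iota_uniq 0 n.+1) |].
  rewrite map_inj_uniq ?enum_uniq // => i j /val_inj; exact: perm_inj.
move=> k; rewrite mem_iota add0n leq0n andTb; apply/mapP/idP => [[i _ ->]|kn]; first exact: ltn_ord.
exists ((s^-1)%g (Ordinal kn)); first by rewrite mem_enum.
by rewrite permKV.
Qed.

Lemma card_allowed (allowed : seq (seq nat)) :
  all (fun t => preserves_cross_ratio t ==> (t \in allowed)) (permutations (iota 0 n.+1)) ->
  (#|H| <= size allowed)%N.
Proof.
move=> h; rewrite cardE -(size_map perm_word); apply: uniq_leq_size.
  by rewrite (map_inj_uniq perm_word_inj) enum_uniq.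
by move=> _ /mapP[s + ->]; rewrite mem_enum; apply: perm_word_allowed.
Qed.

End IntegerPunctures.

(** * The groups C_1, C_2, D_1 and D_2 *)

Section SmallGroups.
Variable K : numClosedFieldType.

Definition int_tuple (zs : seq int) : (size zs).-tuple K := map_tuple intr (in_tuple zs).

Lemma uniq_int_tuple zs : uniq zs -> uniq (int_tuple zs).
Proof. by move=> uz; rewrite /= map_inj_uniq //; apply: intr_inj. Qed.

Lemma trivial_realized : exists (n : nat) (a : n.-tuple K),
  [/\ (1 < n)%N, uniq a & iso_cyclic (LieAut (Virasoro a)) 1].
Proof.
(* Any four points are permuted by a Klein four-group and any three by a symmetric group, so five
   are needed here, infinity included. *)
pose zs : seq int := [:: 0; 1; 2; 5].
have ua : uniq (int_tuple zs) by apply: uniq_int_tuple.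
exists _, (int_tuple zs); split=> //.
have c1 : (#|mob_perms_group (punctures (int_tuple zs))| <= 1)%N.
  have := @card_allowed K _ (int_tuple zs) zs isT erefl [:: iota 0 5]; apply.
  by vm_compute.
have H1 : mob_perms_group (punctures (int_tuple zs)) = 1%G.
  by apply/val_inj/eqP; rewrite /= trivg_card_le1.
have cH : cyclic (mob_perms_group (punctures (int_tuple zs))) by rewrite H1 cyclic1.
have := cyclic_iso_cyclic (lie_aut_mob_perms ua (isT : (1 < 4)%N)) cH.
by rewrite H1 cards1.
Qed.

Lemma mem_int_tuple zs w : (w \in (int_tuple zs : seq K)) = has (fun v => w == v%:~R) zs.
Proof.
apply/mapP/hasP => [[v vz ->]|[v vz /eqP ->]]; first by exists v.
by exists v.
Qed.

Lemma involution_realized : exists (n : nat) (a : n.-tuple K),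
  [/\ (1 < n)%N, uniq a, iso_cyclic (LieAut (Virasoro a)) 2 & iso_dihedral (LieAut (Virasoro a)) 1].
Proof.
(* Index 0 stands for infinity, so the two words allowed below are the identity and w -> - w. *)
pose zs : seq int := [:: 1; -1; 2; -2].
pose a := int_tuple zs; pose H := mob_perms_group (punctures a).
have ua : uniq a by apply: uniq_int_tuple.
have le2 : (#|H| <= 2)%N.
  have := @card_allowed K _ a zs isT erefl [:: [:: 0; 1; 2; 3; 4]; [:: 0; 2; 1; 4; 3]]%N; apply.
  by vm_compute.
have [s Hs Es] : exists2 s, s \in H & mob_of (punctures a) s =1 scaling (-1).
  apply: stab_elt => //; first by apply: scaling_moebius; rewrite oppr_eq0 oner_eq0.
  case=> [w|] /punctureE aw; apply/punctureE => //.
  change (-1 * w \in (a : seq K)); case/mapP: aw => v vz ->; apply/mapP.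
  exists (- v); last by rewrite mulN1r rmorphN.
  by move: vz; rewrite !inE => /or4P[]/eqP->.
have s1 : s != 1%g.
  apply/eqP=> s1; have := Es (Some 1); rewrite s1 (mob_of1 (punctures_inj ua)) //= mulN1r => -[] /eqP.
  by rewrite -subr_eq0 opprK -(natrD _ 1 1) pnatr_eq0.
have oH : #|H| = 2.
  by apply/eqP; rewrite eqn_leq le2 cardG_gt1; apply/trivgPn; exists s.
have iso := lie_aut_mob_perms ua (isT : (1 < 4)%N).
have cH : cyclic H by apply: prime_cyclic; rewrite oH.
exists _, a; split=> //.
  by have := cyclic_iso_cyclic iso cH; rewrite oH.
have := rotation_iso_dihedral iso (sub1G H) (cyclic1 _); rewrite cards1 oH; apply=> // y.
case/setDP=> Hy _; have := order_dvdG Hy; rewrite oH order_dvdn => /eqP //.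
Qed.

Lemma klein_realized : exists (n : nat) (a : n.-tuple K),
  [/\ (1 < n)%N, uniq a & iso_dihedral (LieAut (Virasoro a)) 2].
Proof.
(* With infinity these are four points of cross-ratio 3; a harmonic or equianharmonic quadruple
   would have further symmetries. *)
pose zs : seq int := [:: 0; 1; 3].
pose a := int_tuple zs; pose H := mob_perms_group (punctures a).
have ua : uniq a by apply: uniq_int_tuple.
pose words := [:: [:: 0; 1; 2; 3]; [:: 1; 0; 3; 2]; [:: 2; 3; 0; 1]; [:: 3; 2; 1; 0]]%N.
have allw : all (fun t => preserves_cross_ratio 3 zs t ==> (t \in words)) (permutations (iota 0 4)).
  by vm_compute.
have le4 : (#|H| <= 4)%N.
  by have := @card_allowed K _ a zs isT erefl words; apply.
have inv : {in H, forall s, s ^+ 2 = 1}%g.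
  move=> s Hs; have := perm_word_allowed (a := a) (isT : (1 < 3)%N) erefl allw Hs => w.
  apply/permP=> i; apply: val_inj; rewrite perm1 expgS expg1 permM.
  apply: etrans (esym (nth_perm_word s (s i))) _; rewrite -(nth_perm_word s i).
  have : all (fun t => all (fun k => nth 0 t (nth 0 t k) == k) (iota 0 4))%N words by [].
  by move/allP/(_ _ w)/allP/(_ (val i)); rewrite mem_iota ltn_ord => /(_ isT)/eqP.
have aE (w : K) : (w \in (a : seq K)) = [|| w == 0, w == 1 | w == 3].
  by rewrite mem_int_tuple /= orbF.
have n3 : (3 : K) != 0 by rewrite pnatr_eq0.
(* The maps 3 / w and (w - 3) / (w - 1) are two of the three double transpositions of infinity, 0,
   1, 3. *)
have nzx : (0 : K) * 0 != 3 * 1 by rewrite mulr0 mulr1 eq_sym.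
have nzy : (1 : K) * (- 1) != - 3 * 1.
  by rewrite !mulr1 mul1r eqr_opp eq_sym -subr_eq0 -(natrB _ (isT : 1 <= 3)%N) pnatr_eq0.
have [x Hx Ex] : exists2 s, s \in H & mob_of (punctures a) s =1 mob 0 3 1 0.
  apply: stab_elt => //; first exact: moebius_mob.
  case=> [w|] /punctureE aw; apply/punctureE; move: aw; rewrite /= /proj_point; last first.
    by rewrite oner_eq0 aE mul0r eqxx.
  rewrite aE => /or3P[]/eqP->.
  - by rewrite !(mulr0, addr0, add0r) eqxx.
  - by rewrite mul0r add0r mul1r addr0 oner_eq0 aE divr1 eqxx !orbT.
  by rewrite mul0r add0r mul1r addr0 (negPf n3) aE divff // eqxx !orbT.
have [y Hy Ey] : exists2 s, s \in H & mob_of (punctures a) s =1 mob 1 (-3) 1 (-1).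
  apply: stab_elt => //; first exact: moebius_mob.
  case=> [w|] /punctureE aw; apply/punctureE; move: aw; rewrite /= /proj_point; last first.
    by rewrite oner_eq0 aE divr1 eqxx !orbT.
  rewrite aE => /or3P[]/eqP->.
  - by rewrite mulr0 !add0r oppr_eq0 oner_eq0 aE invrN invr1 mulrN1 opprK eqxx !orbT.
  - by rewrite mulr1 addrN eqxx.
  rewrite mul1r addrN mul0r; case: ifP => // _.
  by rewrite aE eqxx.
have xn1 : x != 1%g.
  apply/eqP=> x1; have := Ex None; rewrite x1 (mob_of1 (punctures_inj ua)) //= /proj_point.
  by rewrite oner_eq0.
have ox : #[x]%g = 2.
  have : (#[x]%g %| 2)%N by rewrite order_dvdn inv.
  by rewrite dvdn_divisors // !inE order_eq1 (negPf xn1) => /eqP.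
have yx : y \notin <[x]>%g.
  apply/negP; rewrite cycle2g // !inE => /orP[]/eqP e; have := Ey None; rewrite e.
    by rewrite (mob_of1 (punctures_inj ua)) //= /proj_point oner_eq0.
  rewrite Ex /= /proj_point oner_eq0 mul0r divr1 => -[] /esym/eqP.
  by rewrite oner_eq0.
have sx : <[x]>%g \subset H by rewrite cycle_subG.
have oH : (2 * #|<[x]>%g|)%N = #|H|.
  rewrite -orderE ox; apply/eqP; rewrite eqn_leq le4 andbT -(Lagrange sx) -orderE ox.
  by rewrite (leq_mul2l 2 2) /= indexg_gt1; apply: contra yx => /subsetP; apply.
exists _, a; split=> //.
have := rotation_iso_dihedral (K := <[x]>%G) (lie_aut_mob_perms ua (isT : (1 < 3)%N)) sx (cycle_cyclic x) oH.
by rewrite /= -orderE ox; apply=> t /setDP[Ht _]; apply: inv.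
Qed.

End SmallGroups.

Local Close Scope ring_scope.
Unset Implicit Arguments.

Theorem mainTheorem5 (R : realType) :
  (forall (n : nat) (a : n.-tuple R[i]), (1 < n)%N -> uniq a ->
     (exists2 N : nat, (0 < N)%N & iso_cyclic (LieAut (Virasoro a)) N)
     \/ (exists2 N : nat, (0 < N)%N & iso_dihedral (LieAut (Virasoro a)) N)
     \/ group_iso (LieAut (Virasoro a)) [subg 'Alt_('I_4)]
     \/ group_iso (LieAut (Virasoro a)) [subg 'Sym_('I_4)]
     \/ group_iso (LieAut (Virasoro a)) [subg 'Alt_('I_5)])
  /\ (forall N : nat, (0 < N)%N ->
        exists (n : nat) (a : n.-tuple R[i]),
          [/\ (1 < n)%N, uniq a & iso_cyclic (LieAut (Virasoro a)) N])
  /\ (forall N : nat, (0 < N)%N ->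
        exists (n : nat) (a : n.-tuple R[i]),
          [/\ (1 < n)%N, uniq a & iso_dihedral (LieAut (Virasoro a)) N])
  /\ (exists (n : nat) (a : n.-tuple R[i]),
        [/\ (1 < n)%N, uniq a &
            group_iso (LieAut (Virasoro a)) [subg 'Alt_('I_4)]])
  /\ (exists (n : nat) (a : n.-tuple R[i]),
        [/\ (1 < n)%N, uniq a &
            group_iso (LieAut (Virasoro a)) [subg 'Sym_('I_4)]])
  /\ (exists (n : nat) (a : n.-tuple R[i]),
        [/\ (1 < n)%N, uniq a &
            group_iso (LieAut (Virasoro a)) [subg 'Alt_('I_5)]]).
Proof.
split=> [n a n1 ua|].
  have iso := lie_aut_mob_perms ua n1.
  have m2 : (2 < n.+1)%N by [].
  case: (mob_perms_classification (punctures_inj ua) m2) => [cH | [L [sL cL oL inv]] | ex].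
  - left; exists #|mob_perms_group (punctures a)|; first exact: cardG_gt0.
    exact: cyclic_iso_cyclic iso cH.
  - right; left; exists #|L|; first exact: cardG_gt0.
    exact: rotation_iso_dihedral iso sL cL oL inv.
  right; right; case: ex => [[isoT _] | [isoO _ _] | [isoI _]].
  - by left; apply: group_iso_isog iso isoT.
  - by right; left; apply: group_iso_isog iso isoO.
  by right; right; apply: group_iso_isog iso isoI.
split=> [[|[|[|N]]] // _|].
- exact: trivial_realized.
- by have [n [a [n1 ua c2 _]]] := involution_realized R[i]; exists n, a.
- exact: cyclic_realized.
split=> [[|[|[|N]]] // _|].
- by have [n [a [n1 ua _ d1]]] := involution_realized R[i]; exists n, a.
- exact: klein_realized.
- exact: dihedral_realized.
split; first exact: tetrahedral_realized.
split; first exact: octahedral_realized.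
exact: icosahedral_realized.
Qed.
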